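(* Let the historical and current data, the reliability estimates $(\hat\alpha_j,\hat\beta_j)_{j=1}^m$ and the estimator $\hat\mu_{\text{HERO-1}}$ be as defined in the context. Suppose the following two assumptions hold. (1) Randomized labeling. The silver-label availability indicators $A_{ij}$ and $\tilde A_{ij}$ are completely randomized, satisfying $P(A_{ij}=1)\ge \pi_{\min}>0$ and $P(\tilde A_{ij}=1)\ge\pi_{\min}>0$, and the historical gold-routing indicators $\tilde R_i$ are completely randomized, satisfying $P(\tilde R_i=1)=\rho\ge\rho_{\min}>0$, where $\pi_{\min}$ and $\rho_{\min}$ are positive constants. (2) Correct specification and transportable reliability. For each labeler $j$ there exist constants $(\alpha_j,\beta_j)$ satisfying $c<\alpha_j,\beta_j<1-c$ for some $c>0$ such that the conditional reliabilities are identical in historical and current data: $$P(\tilde Z_{ij}=1\mid\tilde Y_i=1)=P(Z_{ij}=1\mid Y_i=1)=\alpha_j,\qquad P(\tilde Z_{ij}=0\mid\tilde Y_i=0)=P(Z_{ij}=0\mid Y_i=0)=\beta_j,$$ for all instances $i$ and all labelers $j$. The silver labels are independent across labelers conditional on the gold label: $$P(\tilde Z_{i1}=z_1,\dots,\tilde Z_{im}=z_m\mid \tilde Y_i=y)=\prod_{j=1}^m P(\tilde Z_{ij}=z_j\mid\tilde Y_i=y),$$ $$P(Z_{i1}=z_1,\dots,Z_{im}=z_m\mid Y_i=y)=\prod_{j=1}^m P(Z_{ij}=z_j\mid Y_i=y),$$ for all instances $i$. The parameters $\mu=\mathbb{E}[Y]$ and $\tilde\mu=\mathbb{E}[\tilde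 Y]$ may differ, but are bounded away from $0$ and $1$: $c<\mu,\tilde\mu<1-c$. Then the HERO-1 estimator satisfies $$\hat\mu_{\text{HERO-1}}-\mu=O_p(n^{-1/2})+O_p(N^{-1/2}).$$ In contrast, the majority-vote estimator and the classical Dawid--Skene EM estimator without gold anchor do not necessarily converge to the gold-oriented truth.
   Context: Data. There is a pool of $m$ silver labelers. Historical data: $N$ instances, each with a gold label $\tilde Y_i\in\{0,1\}$, binary silver labels $\tilde Z_{ij}$, availability indicators $\tilde A_{ij}\in\{0,1\}$ recording whether labeler $j$ labeled instance $i$, and a routing indicator $\tilde R_i\in\{0,1\}$; the gold label $\tilde Y_i$ is observed only when $\tilde R_i=1$. Current data: $n$ instances, with $n\ll N$, each with a gold label $Y_i\in\{0,1\}$ that is never observed, binary silver labels $Z_{ij}$ and availability indicators $A_{ij}\in\{0,1\}$. The target (''gold-oriented truth'') is $\mu=\mathbb{E}[Y_i]$. Historical likelihood. With parameters $\tilde\mu,\{\alpha_j,\beta_j\}$, $$\tilde\ell_i(1)=\prod_{j:\tilde A_{ij}=1}\alpha_j^{\tilde Z_{ij}}(1-\alpha_j)^{1-\tilde Z_{ij}},\quad \tilde\ell_i(0)=\prod_{j:\tilde A_{ij}=1}(1-\beta_j)^{\tilde Z_{ij}}\beta_j^{1-\tilde Z_{ij}},$$ $$\tilde{\mathcal L}=\sum_{i=1}^N\Big[\tilde R_i\log\tilde\ell_i(\tilde Y_i)+(1-\tilde R_i)\log\big(\tilde\mu\tilde\ell_i(1)+(1-\tilde\mu)\tilde\ell_i(0)\big)\Big].$$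 Gold-anchored EM producing $(\hat\alpha_j,\hat\beta_j)$. Let $\mathcal G=\{i:\tilde R_i=1\}$. Initialize $$\tilde\mu\leftarrow\frac{1}{|\mathcal G|}\sum_{i\in\mathcal G}\tilde Y_i,\quad \alpha_j\leftarrow\frac{\sum_{i\in\mathcal G}\tilde A_{ij}\tilde Y_i\tilde Z_{ij}}{\sum_{i\in\mathcal G}\tilde A_{ij}\tilde Y_i},\quad \beta_j\leftarrow\frac{\sum_{i\in\mathcal G}\tilde A_{ij}(1-\tilde Y_i)(1-\tilde Z_{ij})}{\sum_{i\in\mathcal G}\tilde A_{ij}(1-\tilde Y_i)},$$ with all initial values clipped to $[\delta,1-\delta]$ for a small $\delta>0$. Repeat until the relative change in $\tilde{\mathcal L}$ is less than $\epsilon=o(N^{-1})$: (E-step) set $\tilde\gamma_i=\tilde Y_i$ if $\tilde R_i=1$ and $\tilde\gamma_i=\tilde\mu\tilde\ell_i(1)/[\tilde\mu\tilde\ell_i(1)+(1-\tilde\mu)\tilde\ell_i(0)]$ otherwise; (M-step) set $$\tilde\mu\leftarrow\frac1N\sum_{i=1}^N\tilde\gamma_i,\quad \alpha_j\leftarrow\frac{\sum_i\tilde A_{ij}\tilde\gamma_i\tilde Z_{ij}}{\sum_i\tilde A_{ij}\tilde\gamma_i},\quad \beta_j\leftarrow\frac{\sum_i\tilde A_{ij}(1-\tilde\gamma_i)(1-\tilde Z_{ij})}{\sum_i\tilde A_{ij}(1-\tilde\gamma_i)},$$ and clip $\tilde\mu,\alpha_j,\beta_j$ to $[\delta,1-\delta]$.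 The final values of $\alpha_j,\beta_j$ are $\hat\alpha_j,\hat\beta_j$. HERO-1. On the current data put $\ell_i(1)=\prod_{j:A_{ij}=1}\hat\alpha_j^{Z_{ij}}(1-\hat\alpha_j)^{1-Z_{ij}}$, $\ell_i(0)=\prod_{j:A_{ij}=1}(1-\hat\beta_j)^{Z_{ij}}\hat\beta_j^{1-Z_{ij}}$, and $$\hat\mu_{\text{HERO-1}}=\arg\max_{\mu\in(0,1)}\sum_{i=1}^n\log[\mu\,\ell_i(1)+(1-\mu)\,\ell_i(0)].$$ Baselines. The majority-vote estimator estimates $\mu$ by aggregating the current silver labels by majority vote, weighting labelers equally and without calibration. The classical Dawid--Skene EM estimator without gold anchor fits, by EM, the standard latent-class model (likelihood $\sum_i\log(\mu\,\ell_i(1)+(1-\mu)\,\ell_i(0))$ with $\ell_i$ evaluated at free parameters $\alpha_j,\beta_j$) to silver labels alone, using no gold labels, jointly estimating $\mu$ and $\{(\alpha_j,\beta_j)\}$.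
   Formalization: Adds that some labeler has α_j+β_j≠1 (else the observed data carry no information on μ and the rate fails, e.g. m=1, α=β=1/2); ''n≪N'' is read as n=o(N) with n→∞, and ''small δ'' as 0<δ≤c. *)

(* Defs.v *)
(* MathComp world (MathComp-Analysis). *)
From HB Require Import structures.
From mathcomp Require Import all_boot all_order all_algebra.
From mathcomp Require Import all_classical all_reals all_analysis.

Set Implicit Arguments.
Unset Strict Implicit.
Unset Printing Implicit Defensive.

Import Order.TTheory GRing.Theory Num.Theory.
Import numFieldNormedType.Exports.

Local Open Scope classical_set_scope.
Local Open Scope ring_scope.

(* Estimators are functions of the realized data: [z i j] is the label given by
   labeler [j] to instance [i], [a i j] tells whether it is available, [y i] is
   the gold label and [r i] the gold-routing indicator.  Entries [z i j] with
   [a i j = false] and [y i] with [r i = false] are unobserved, and the formulas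
   below do not depend on them. *)
Section estimators.
Context {R : realType} {m : nat}.

Record params := Params {
  prevalence : R ;
  sensitivity : 'I_m -> R ;
  specificity : 'I_m -> R }.

Definition lik1 (alpha : 'I_m -> R) (z a : 'I_m -> bool) : R :=
  \prod_(j < m | a j) (alpha j ^+ z j * (1 - alpha j) ^+ (~~ z j)).

Definition lik0 (beta : 'I_m -> R) (z a : 'I_m -> bool) : R :=
  \prod_(j < m | a j) ((1 - beta j) ^+ z j * beta j ^+ (~~ z j)).

Definition mixture (mu : R) (alpha beta : 'I_m -> R)
    (z a : 'I_m -> bool) : R :=
  mu * lik1 alpha z a + (1 - mu) * lik0 beta z a.

Definition clip (delta x : R) : R := Num.max delta (Num.min x (1 - delta)).

Section em.
Context {N : nat}.
Variables (y r : 'I_N -> bool) (z a : 'I_N -> 'I_m -> bool).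

Definition loglik (th : params) : R :=
  \sum_(i < N)
    if r i then
      ln (if y i then lik1 (sensitivity th) (z i) (a i)
          else lik0 (specificity th) (z i) (a i))
    else ln (mixture (prevalence th) (sensitivity th) (specificity th)
               (z i) (a i)).

(* As for every quotient below, 0 / 0 = 0. *)
Definition gold_init (delta : R) : params := Params
  (clip delta ((\sum_(i < N | r i) (y i)%:R) / (\sum_(i < N | r i) 1)))
  (fun j => clip delta ((\sum_(i < N | r i) (a i j && y i && z i j)%:R)
                      / (\sum_(i < N | r i) (a i j && y i)%:R)))
  (fun j => clip delta ((\sum_(i < N | r i) (a i j && ~~ y i && ~~ z i j)%:R)
                      / (\sum_(i < N | r i) (a i j && ~~ y i)%:R))).

Definition e_step (th : params) (i : 'I_N) : R :=
  if r i then (y i)%:R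
  else prevalence th * lik1 (sensitivity th) (z i) (a i)
       / mixture (prevalence th) (sensitivity th) (specificity th) (z i) (a i).

Definition m_step (delta : R) (gamma : 'I_N -> R) : params := Params
  (clip delta (N%:R^-1 * \sum_(i < N) gamma i))
  (fun j => clip delta ((\sum_(i < N) (a i j)%:R * gamma i * (z i j)%:R)
                      / (\sum_(i < N) (a i j)%:R * gamma i)))
  (fun j => clip delta
     ((\sum_(i < N) (a i j)%:R * (1 - gamma i) * (1 - (z i j)%:R))
      / (\sum_(i < N) (a i j)%:R * (1 - gamma i)))).

Definition em_iter (delta : R) (th0 : params) (t : nat) : params :=
  iter t (fun th => m_step delta (e_step th)) th0.

Definition relative_change (delta : R) (th0 : params) (t : nat) : R :=
  `|loglik (em_iter delta th0 t.+1) - loglik (em_iter delta th0 t)|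
  / `|loglik (em_iter delta th0 t)|.

(* Index of the first iteration whose relative change is below [eps] ([get]
   returns 0 if there is none). *)
Definition em_stop (delta eps : R) (th0 : params) : nat :=
  [get t : nat | relative_change delta th0 t < eps /\
           (forall s, (s < t)%N -> eps <= relative_change delta th0 s)].

Definition em (delta eps : R) (th0 : params) : params :=
  em_iter delta th0 (em_stop delta eps th0).+1.

Definition gold_anchored_em (delta eps : R) : params :=
  em delta eps (gold_init delta).

End em.

Section current_estimators.
Context {n : nat}.

Definition hero1_loglik (alpha beta : 'I_m -> R)
    (z a : 'I_n -> 'I_m -> bool) (mu : R) : R :=
  \sum_(i < n) ln (mixture mu alpha beta (z i) (a i)).

(* The maximum over the open interval need not be attained; [get] then returns
   a default value. *)
Definition hero1 (alpha beta : 'I_m -> R)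
    (z a : 'I_n -> 'I_m -> bool) : R :=
  [get mu : R | 0 < mu < 1 /\
     (forall nu : R, 0 < nu < 1 ->
        hero1_loglik alpha beta z a nu <= hero1_loglik alpha beta z a mu)].

(* [tie] is the vote attributed to an instance without a strict majority. *)
Definition majority (tie : R) (z a : 'I_m -> bool) : R :=
  let ones := (\sum_(j < m) (a j && z j))%N in
  let zeros := (\sum_(j < m) (a j && ~~ z j))%N in
  if (zeros < ones)%N then 1 else if (ones < zeros)%N then 0 else tie.

Definition majority_vote (tie : R) (z a : 'I_n -> 'I_m -> bool) : R :=
  n%:R^-1 * \sum_(i < n) majority tie (z i) (a i).

(* With an empty routing indicator, [loglik], [e_step] and [m_step] are those of
   the latent-class model for the silver labels alone, and the gold labels
   (here a dummy) are ignored.  Classical EM is unclipped: [delta = 0]. *)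
Definition dawid_skene (init : ('I_n -> 'I_m -> bool) ->
    ('I_n -> 'I_m -> bool) -> params) (delta eps : R)
    (z a : 'I_n -> 'I_m -> bool) : R :=
  prevalence (em (fun=> false) (fun=> false) z a delta eps (init z a)).

End current_estimators.
End estimators.
Arguments params : clear implicits.

Section probability_notions.
Context {R : realType} {d : measure_display} {T : measurableType d}.
Variable P : probability T R.

Definition pr (A : set T) : R := fine (P A).

Definition cond_pr (A B : set T) : R := pr (A `&` B) / pr B.

Definition independent2 (V W : finType) (X : T -> V) (Y : T -> W) : Prop :=
  forall (B : {set V}) (C : {set W}),
    pr [set w | X w \in B /\ Y w \in C] =
    pr [set w | X w \in B] * pr [set w | Y w \in C].

Definition mutually_independent (I V : finType) (X : I -> T -> V) : Prop :=
  forall B : I -> {set V},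
    pr [set w | forall i, X i w \in B i] =
    \prod_(i : I) pr [set w | X i w \in B i].

End probability_notions.

(* All N historical and n current instances of one experiment live on a common
   probability space.  Silver labels are potential labels: they are defined also
   when unavailable. *)
Record experiment (R : realType) (m n N : nat) := Experiment {
  sample_disp : measure_display ;
  sample_space : measurableType sample_disp ;
  sample_prob : probability sample_space R ;
  hgold : 'I_N -> {RV sample_prob >-> bool} ;
  hsilver : 'I_N -> 'I_m -> {RV sample_prob >-> bool} ;
  havail : 'I_N -> 'I_m -> {RV sample_prob >-> bool} ;
  hrouted : 'I_N -> {RV sample_prob >-> bool} ;
  gold : 'I_n -> {RV sample_prob >-> bool} ;
  silver : 'I_n -> 'I_m -> {RV sample_prob >-> bool} ;
  avail : 'I_n -> 'I_m -> {RV sample_prob >-> bool} }.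

Section model.
Context {R : realType} {m n N : nat}.
Variable E : experiment R m n N.
Local Notation P := (sample_prob E).

Definition hlabels (i : 'I_N) (w : sample_space E) : bool * {ffun 'I_m -> bool} :=
  (hgold E i w, [ffun j => hsilver E i j w]).
Definition havails (i : 'I_N) (w : sample_space E) : {ffun 'I_m -> bool} :=
  [ffun j => havail E i j w].
Definition labels (i : 'I_n) (w : sample_space E) : bool * {ffun 'I_m -> bool} :=
  (gold E i w, [ffun j => silver E i j w]).
Definition avails (i : 'I_n) (w : sample_space E) : {ffun 'I_m -> bool} :=
  [ffun j => avail E i j w].

(* Instances are independent within each sample; none of the results needs the
   two samples to be independent of each other. *)
Definition independent_instances : Prop :=
  mutually_independent P (fun i w => (hlabels i w, havails i w, hrouted E i w))
  /\ mutually_independent P (fun i w => (labels i w, avails i w)).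

(* Complete randomization: availability is independent of all the labels of the
   instance, and routing of all its labels and availabilities.  No independence
   between the availabilities of different labelers is required. *)
Record randomized_labeling (pi_min rho_min rho : R) : Prop := {
  avail_randomized : forall i, independent2 P (labels i) (avails i) ;
  havail_randomized : forall i, independent2 P (hlabels i) (havails i) ;
  hrouted_randomized : forall i,
    independent2 P (fun w => (hlabels i w, havails i w)) (hrouted E i) ;
  avail_ge : forall i j, pi_min <= pr P [set w | avail E i j w = true] ;
  havail_ge : forall i j, pi_min <= pr P [set w | havail E i j w = true] ;
  hrouted_pr : forall i, pr P [set w | hrouted E i w = true] = rho ;
  rho_ge : rho_min <= rho }.

Record correct_specification (c mu mut : R) (alpha beta : 'I_m -> R) : Prop := {
  alpha_bounds : forall j, c < alpha j < 1 - c ;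
  beta_bounds : forall j, c < beta j < 1 - c ;
  mu_bounds : c < mu < 1 - c ;
  mut_bounds : c < mut < 1 - c ;
  gold_mean : forall i, ('E_P[fun w => (gold E i w)%:R%R])%E = mu%:E ;
  hgold_mean : forall i, ('E_P[fun w => (hgold E i w)%:R%R])%E = mut%:E ;
  hsensitivityE : forall i j,
    cond_pr P [set w | hsilver E i j w = true] [set w | hgold E i w = true]
    = alpha j ;
  sensitivityE : forall i j,
    cond_pr P [set w | silver E i j w = true] [set w | gold E i w = true]
    = alpha j ;
  hspecificityE : forall i j,
    cond_pr P [set w | hsilver E i j w = false] [set w | hgold E i w = false]
    = beta j ;
  specificityE : forall i j,
    cond_pr P [set w | silver E i j w = false] [set w | gold E i w = false]
    = beta j ;
  hsilver_cond_indep : forall i (z : 'I_m -> bool) (y : bool),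
    cond_pr P [set w | forall j, hsilver E i j w = z j]
              [set w | hgold E i w = y]
    = \prod_(j < m) cond_pr P [set w | hsilver E i j w = z j]
                              [set w | hgold E i w = y] ;
  silver_cond_indep : forall i (z : 'I_m -> bool) (y : bool),
    cond_pr P [set w | forall j, silver E i j w = z j] [set w | gold E i w = y]
    = \prod_(j < m) cond_pr P [set w | silver E i j w = z j]
                              [set w | gold E i w = y] }.

Definition historical_fit (delta eps : R) (w : sample_space E) : params R m :=
  gold_anchored_em (hgold E ^~ w) (hrouted E ^~ w)
    (fun i j => hsilver E i j w) (fun i j => havail E i j w) delta eps.

Definition mu_hero1 (delta eps : R) (w : sample_space E) : R :=
  hero1 (sensitivity (historical_fit delta eps w))
        (specificity (historical_fit delta eps w))
        (fun i j => silver E i j w) (fun i j => avail E i j w).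

Definition mu_majority_vote (tie : R) (w : sample_space E) : R :=
  majority_vote tie (fun i j => silver E i j w) (fun i j => avail E i j w).

Definition mu_dawid_skene (init : ('I_n -> 'I_m -> bool) ->
    ('I_n -> 'I_m -> bool) -> params R m) (delta eps : R) (w : sample_space E) : R :=
  dawid_skene init delta eps
    (fun i j => silver E i j w) (fun i j => avail E i j w).

End model.
Arguments mu_hero1 {R m n N} E delta eps w.
Arguments mu_majority_vote {R m n N} E tie w.
Arguments mu_dawid_skene {R m n N} E init delta eps w.

Section asymptotics.
Context {R : realType} {m : nat} {n N : nat -> nat}.
Variable E : forall k, experiment R m (n k) (N k).

Definition admissible_model (c pi_min rho_min rho mu mut : R)
    (alpha beta : 'I_m -> R) : Prop :=
  [/\ 0 < c, 0 < pi_min, 0 < rho_min &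
      forall k, [/\ independent_instances (E k),
                    randomized_labeling (E k) pi_min rho_min rho &
                    correct_specification (E k) c mu mut alpha beta]].

(* Identifiability of mu from the silver labels: if alpha j + beta j = 1 for
   every j, then their law does not depend on the gold label. *)
Definition informative_labeler (alpha beta : 'I_m -> R) : Prop :=
  exists j, alpha j + beta j != 1.

Definition O_p (X : forall k, sample_space (E k) -> R) (r : nat -> R) : Prop :=
  forall e : R, 0 < e -> exists2 M : R, 0 < M &
    \forall k \near \oo,
      pr (sample_prob (E k)) [set w | M * r k < `|X k w|] <= e.

Definition cvg_in_probability (X : forall k, sample_space (E k) -> R) (l : R) : Prop :=
  forall e : R, 0 < e ->
    pr (sample_prob (E k)) [set w | e < `|X k w - l|] @[k --> \oo] --> (0 : R).

End asymptotics.

(* Main.v *)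
(* Proof idea for HERO-1.  The M-step with clipping is the exact maximizer, over the
   box of clipped parameters, of a sum of binomial log-likelihoods, so EM increases
   [anchored_loglik], whatever the number of iterations.  Hence the gold part can
   only lose between the initialization and the final fit what the part without
   gold labels gains.  The loss is at least a constant times N times the squared
   distance of the fit to the initialization; the gain is at most that of the
   saturated model, a chi-square statistic of expectation O(1).  The initialization
   is a ratio of sums of independent terms, so the fit is at distance O_p(N^(-1/2))
   of the truth.  The likelihood of HERO-1 is concave in mu with curvature of order
   n and, at the truth, slope O_p(n^(1/2)) + n O_p(N^(-1/2)).  As n = o(N), the whole
   error is O_p(n^(-1/2)), and the second summand can be taken to be 0.

   Proof idea for the baselines.  Exchanging the two latent classes, that is
   (mu, alpha, beta) and (1 - mu, 1 - beta, 1 - alpha), preserves the law of the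
   silver labels, so that no estimator based on them alone can be consistent in
   both models. *)
Require Import Defs.
From HB Require Import structures.
From mathcomp Require Import all_boot all_order all_algebra.
From mathcomp Require Import all_classical all_reals all_analysis.
From mathcomp Require Import ring lra.

Set Implicit Arguments.
Unset Strict Implicit.
Unset Printing Implicit Defensive.

Import Order.TTheory GRing.Theory Num.Theory.
Import numFieldNormedType.Exports.

Local Open Scope classical_set_scope.
Local Open Scope ring_scope.

(** * Logarithmic inequalities and clipped binomial likelihoods *)

(** HERO-1 receives the output of an EM run of unknown length, so the fit cannot be treated as a
    maximizer or a stationary point. What survives any number of steps is that [anchored_loglik] at
    the fit is at least its value at the initialization. To exploit this, the gain on unrouted
    instances must be bounded uniformly over the box: it is compared, cell by cell, with the
    empirical frequencies of the visible label patterns, within each availability pattern since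
    availabilities may be dependent. The gain is measured from the initialization, which depends on
    the data; recentring the chi-square statistic at the truth costs N times the squared
    initialization error, again O(1). Clipping keeps the parameters in a box that contains the truth
    because [delta <= c], so cell probabilities are at least [delta ^+ m] and all Lipschitz
    constants are explicit. The data are finite-valued: events are measurable whatever estimator
    they involve, and expectations are finite sums over data tables. Probability bounds have the
    form constant / K ^ 2, with constants common to all experiments of the sequence. *)

Section logarithm.
Context {R : realType}.
Implicit Types x p : R.

Lemma ln_le_subr1 x : 0 < x -> ln x <= x - 1.
Proof.
move=> x0; have := @le_ln1Dx R (x - 1).
by rewrite (_ : 1 + (x - 1) = x); [apply; lra|ring].
Qed.

Lemma ln_sub_le (a b : R) : 0 < a -> 0 < b -> ln a - ln b <= a / b - 1.
Proof.
move=> a0 b0; rewrite -ln_div ?posrE//; apply: ln_le_subr1.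
exact: divr_gt0.
Qed.

(** With x = s ^ 2, ln x = 2 ln s <= 2 (s - 1) = (x - 1) - (s - 1) ^ 2, and (x - 1) ^ 2 = (s - 1) ^
    2 (s + 1) ^ 2 with (s + 1) ^ 2 <= 4 K. This supplies the curvature both of binomial likelihoods
    and of the HERO-1 likelihood. *)
Lemma ln_quadratic_le (K x : R) :
  1 <= K -> 0 < x <= K -> ln x <= (x - 1) - (x - 1) ^+ 2 / (4 * K).
Proof.
move=> K1 /andP[x0 xK]; set s := Num.sqrt x.
have s0 : 0 < s by rewrite sqrtr_gt0.
have xE : x = s ^+ 2 by rewrite sqr_sqrtr// ltW.
have K0 : 0 < K by rewrite (lt_le_trans ltr01).
have lns : ln x = ln s *+ 2 by rewrite xE lnXn.
have h1 := ln_le_subr1 s0.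
have h2 : (s + 1) ^+ 2 <= 4 * K by rewrite xE in xK; nra.
have h3 : (x - 1) ^+ 2 / (4 * K) <= (s - 1) ^+ 2.
  rewrite ler_pdivrMr; last lra.
  rewrite xE (_ : (s ^+ 2 - 1) ^+ 2 = (s - 1) ^+ 2 * (s + 1) ^+ 2); last ring.
  by rewrite ler_wpM2l// sqr_ge0.
by rewrite lns; nra.
Qed.

(** Average of the tangent inequalities at the mean [M]. It serves as Jensen's inequality for the
    E-step and for the concavity of the HERO-1 likelihood. *)
Lemma ln_concave (g a b : R) : 0 <= g <= 1 -> 0 < a -> 0 < b ->
  g * ln a + (1 - g) * ln b <= ln (g * a + (1 - g) * b).
Proof.
move=> /andP[g0 g1] a0 b0; set M := g * a + (1 - g) * b.
have M0 : 0 < M.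
  rewrite /M; have [->|gN0] := eqVneq g 0; first by lra.
  apply: ltr_wpDr; first by apply: mulr_ge0; lra.
  by rewrite mulr_gt0// lt_def gN0.
have ha := ler_wpM2l g0 (ln_sub_le a0 M0).
have hb := ler_wpM2l (_ : 0 <= 1 - g) (ln_sub_le b0 M0).
have {}hb : (1 - g) * (ln b - ln M) <= (1 - g) * (b / M - 1) by apply: hb; lra.
have h : g * (a / M) + (1 - g) * (b / M) = 1.
  by rewrite !mulrA -mulrDl divff// gt_eqF.
lra.
Qed.

End logarithm.

Section clipped_binomial.
Context {R : realType}.
Implicit Types A B x : R.

(** Binomial log-likelihood of [A] successes and [B] failures; the counts are real because posterior
    weights are fractional. *)
Definition binlik A B x : R := A * ln x + B * ln (1 - x).

Lemma clipE (delta x : R) : delta <= 2^-1 ->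
  clip delta x = if x < delta then delta else if 1 - delta < x then 1 - delta else x.
Proof.
move=> d; rewrite /clip minEge maxElt.
by case: (leP (1 - delta) x) => h1; do 3?(case: ltP => ?) => //; lra.
Qed.

Lemma clip_bounds (delta x : R) : 0 <= delta <= 2^-1 ->
  delta <= clip delta x <= 1 - delta.
Proof.
move=> d; rewrite clipE; last lra.
by case: (ltP x delta) => h1; [|case: (ltP _ x) => h2]; lra.
Qed.

(** Clipping is a projection, so the error of a clipped estimate of a truth in the interval is
    controlled by that of the raw ratio. *)
Lemma clip_contract (delta x y : R) : delta <= y <= 1 - delta ->
  `|clip delta x - y| <= `|x - y|.
Proof.
move=> d; rewrite clipE; last lra.
case: (ltP x delta) => h1; [|case: (ltP _ x) => h2]; last by [].
- rewrite !ler0_norm; lra.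
- rewrite !ger0_norm; lra.
Qed.

(** The clipped frequency is the projection of the unconstrained maximizer: its variational
    inequality disposes of the first-order term, and [ln_quadratic_le] leaves the quadratic gap. For
    A + B = 0 both sides vanish, whatever the quotient 0 / 0. *)
Lemma binlik_clip_max (delta A B x : R) : 0 < delta <= 2^-1 -> 0 <= A -> 0 <= B ->
  delta <= x <= 1 - delta ->
  delta / 4 * (A + B) * (x - clip delta (A / (A + B))) ^+ 2
    <= binlik A B (clip delta (A / (A + B))) - binlik A B x.
Proof.
move=> d A0 B0 xb.
have [S0|SN0] := eqVneq (A + B) 0.
  have -> : A = 0 by lra.
  have -> : B = 0 by lra.
  by rewrite /binlik addr0 mulr0 !mul0r addr0 subrr.
have S_gt0 : 0 < A + B by rewrite lt_def SN0 addr_ge0.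
set p := A / (A + B).
have p0 : 0 <= p by rewrite divr_ge0// ltW.
have AE : A = (A + B) * p by rewrite /p mulrC divfK.
have BE : B = (A + B) * (1 - p) by rewrite mulrBr mulr1 -AE addrC addKr.
have p1 : 0 <= 1 - p by rewrite -(pmulr_rge0 _ S_gt0) -BE.
set y := clip delta p.
have yb : delta <= y <= 1 - delta by apply: clip_bounds; lra.
(* Variational inequality of the projection [y] of [p]. *)
have foc : (x - y) * (p - y) <= 0.
  rewrite /y clipE; last lra.
  by case: (ltP p delta) => h1; [|case: (ltP _ p) => h2]; nra.
set n := A + B in AE BE S_gt0 *.
clearbody y p n.
(* On the interval u / v <= delta^-1, which is taken as the [K] of [ln_quadratic_le]; the factor 1 /
   v ^ 2 that appears is at least 1. *)
have key (u v : R) : delta <= u <= 1 - delta -> delta <= v <= 1 - delta ->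
    ln u - ln v <= (u - v) / v - delta / 4 * (u - v) ^+ 2.
  move=> ub vb; have u0 : 0 < u by lra.
  have v0 : 0 < v by lra.
  have d1 : 1 <= delta^-1 by rewrite invf_ge1; lra.
  have duv : 0 < u / v <= delta^-1.
    rewrite divr_gt0//= ler_pdivrMr// ler_pdivlMl; last lra.
    nra.
  have := ln_quadratic_le d1 duv.
  rewrite ln_div ?posrE// (_ : u / v - 1 = (u - v) / v); last first.
    by rewrite mulrBl divff// gt_eqF.
  move=> /le_trans; apply; rewrite lerD2l lerN2.
  rewrite (_ : _ / (4 * delta^-1) = delta / 4 * (u - v)^+2 / v ^+ 2); last first.
    by field; rewrite !gt_eqF//; lra.
  have d4 : 0 <= delta / 4 * (u - v) ^+ 2 by rewrite mulr_ge0 ?sqr_ge0//; lra.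
  rewrite ler_pdivlMr ?exprn_gt0//.
  rewrite -[leRHS]mulr1 ler_wpM2l// exprn_ile1//; lra.
have k1 := ler_wpM2l p0 (key x y xb yb).
have k2 : (1 - p) * (ln (1 - x) - ln (1 - y)) <=
          (1 - p) * ((1 - x - (1 - y)) / (1 - y)
                     - delta / 4 * (1 - x - (1 - y)) ^+ 2).
  by apply: ler_wpM2l => //; apply: key; lra.
(* The tangent terms at [y], weighted by p and 1 - p, combine into a multiple of the product in
   [foc]. *)
have e1 : p * ((x - y) / y) + (1 - p) * ((1 - x - (1 - y)) / (1 - y)) =
          ((x - y) * (p - y)) / (y * (1 - y)).
  by field; rewrite !gt_eqF//; lra.
have e2 : ((x - y) * (p - y)) / (y * (1 - y)) <= 0.
  rewrite mulr_le0_ge0// invr_ge0 mulr_ge0//; lra.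
have k : delta / 4 * (x - y) ^+ 2 <=
   p * (ln y - ln x) + (1 - p) * (ln (1 - y) - ln (1 - x)).
  have -> : delta / 4 * (x - y) ^+ 2 = p * (delta / 4 * (x - y) ^+ 2) +
     (1 - p) * (delta / 4 * (1 - x - (1 - y)) ^+ 2) by ring.
  lra.
have := ler_wpM2l (ltW S_gt0) k.
rewrite /binlik [X in X * ln y]AE [X in X * ln (1 - y)]BE.
rewrite [X in X * ln x]AE [X in X * ln (1 - x)]BE.
by move=> h; apply: (le_trans _ (le_trans h _)); rewrite le_eqVlt; apply/orP; left;
  apply/eqP; ring.
Qed.

End clipped_binomial.

(** * The latent-class likelihood *)

Section likelihood.
Context {R : realType} {m : nat}.
Implicit Types (p q alpha beta : 'I_m -> R) (z a : 'I_m -> bool).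

Definition bern (x : R) (b : bool) : R := x ^+ b * (1 - x) ^+ (~~ b).

Lemma bernE x b : bern x b = if b then x else 1 - x.
Proof. by case: b; rewrite /bern /= expr0 expr1 ?mulr1 ?mul1r. Qed.

Lemma lik1E p z a : lik1 p z a = \prod_(j < m | a j) bern (p j) (z j).
Proof. by []. Qed.

Lemma lik0E beta z a : lik0 beta z a = lik1 (fun j => 1 - beta j) z a.
Proof. by rewrite /lik0 /lik1; apply: eq_bigr => j _; rewrite subKr. Qed.

Lemma lik1_ge (delta : R) p z a : 0 <= delta <= 1 ->
  (forall j, delta <= p j <= 1 - delta) -> delta ^+ m <= lik1 p z a.
Proof.
move=> d pb; rewrite lik1E -{1}(card_ord m) -prodr_const [leRHS]big_mkcond /=.
apply: ler_prod => j _; rewrite andbC; have := pb j; rewrite bernE.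
by case: (a j); case: (z j) => //; lra.
Qed.

Lemma lik1_ge0 p z a : (forall j, 0 <= p j <= 1) -> 0 <= lik1 p z a.
Proof.
move=> pb; rewrite lik1E; apply: prodr_ge0 => j _; have := pb j; rewrite bernE.
by case: (z j); lra.
Qed.

Lemma lik1_le1 p z a : (forall j, 0 <= p j <= 1) -> lik1 p z a <= 1.
Proof.
move=> pb; rewrite lik1E; apply: prodr_ile1 => j _; have := pb j; rewrite bernE.
by case: (z j); lra.
Qed.

(** Telescoping: the factors are exchanged one at a time, and the remaining products lie in
    [0, 1]. *)
Lemma prod_lip (I : Type) (s : seq I) (P : pred I) (f g : I -> R) :
  (forall i, 0 <= f i <= 1) -> (forall i, 0 <= g i <= 1) ->
  `|\prod_(i <- s | P i) f i - \prod_(i <- s | P i) g i|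
    <= \sum_(i <- s | P i) `|f i - g i|.
Proof.
move=> f01 g01; elim: s => [|i s IH]; first by rewrite !big_nil subrr normr0.
rewrite !big_cons; case: (P i) => //.
set F := \prod_(_ <- _ | _) f _ in IH *; set G := \prod_(_ <- _ | _) g _ in IH *.
have G01 : 0 <= G <= 1.
  rewrite /G prodr_ge0 ?prodr_ile1//; by move=> j _; have := g01 j; lra.
rewrite (_ : f i * F - g i * G = f i * (F - G) + G * (f i - g i)); last ring.
apply: (le_trans (ler_normD _ _)); rewrite addrC !normrM; apply: lerD.
  by rewrite ler_piMl// ger0_norm; lra.
apply: le_trans IH; rewrite ler_piMl// ger0_norm; have := f01 i; lra.
Qed.

Lemma lik1_lip p q z a : (forall j, 0 <= p j <= 1) -> (forall j, 0 <= q j <= 1) ->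
  `|lik1 p z a - lik1 q z a| <= \sum_(j < m) `|p j - q j|.
Proof.
move=> pb qb; rewrite !lik1E; apply: (le_trans (prod_lip _ _ _ _)).
- by move=> j; have := pb j; rewrite bernE; case: (z j); lra.
- by move=> j; have := qb j; rewrite bernE; case: (z j); lra.
rewrite [leLHS]big_mkcond /=; apply: ler_sum => j _.
case: (a j) => //; rewrite !bernE; case: (z j) => //.
by rewrite (_ : 1 - p j - (1 - q j) = q j - p j); [rewrite distrC|ring].
Qed.

Lemma lik0_lip p q z a : (forall j, 0 <= p j <= 1) -> (forall j, 0 <= q j <= 1) ->
  `|lik0 p z a - lik0 q z a| <= \sum_(j < m) `|p j - q j|.
Proof.
move=> pb qb; rewrite !lik0E.
rewrite (eq_bigr (fun j => `|1 - p j - (1 - q j)|)).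
  by apply: lik1_lip => j; [have := pb j|have := qb j]; lra.
by move=> j _; rewrite distrC; congr (`|_|); ring.
Qed.

Lemma ln_prod (I : Type) (s : seq I) (P : pred I) (f : I -> R) :
  (forall i, 0 < f i) -> ln (\prod_(i <- s | P i) f i) = \sum_(i <- s | P i) ln (f i).
Proof.
move=> f0; elim: s => [|i s IH]; first by rewrite !big_nil ln1.
rewrite !big_cons; case: (P i) => //.
by rewrite lnM ?IH// posrE// prodr_gt0.
Qed.

Lemma ln_lik1 p z a : (forall j, 0 < p j < 1) ->
  ln (lik1 p z a) =
  \sum_(j < m) (a j)%:R * ((z j)%:R * ln (p j) + (1 - (z j)%:R) * ln (1 - p j)).
Proof.
move=> pb; rewrite lik1E ln_prod; last first.
  by move=> j; have := pb j; rewrite bernE; case: (z j); lra.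
rewrite big_mkcond /=; apply: eq_bigr => j _; rewrite bernE.
by case: (a j); case: (z j); rewrite ?mul0r ?mul1r ?subrr ?subr0 ?mul0r ?addr0 ?add0r ?mul1r.
Qed.

Definition obs (z a : 'I_m -> bool) : {ffun 'I_m -> bool} := [ffun j => a j && z j].

Definition observable (a : 'I_m -> bool) : pred {ffun 'I_m -> bool} :=
  fun z : {ffun 'I_m -> bool} => [forall j, z j ==> a j].

Lemma lik1_obs p z a : lik1 p (obs z a) a = lik1 p z a.
Proof. by rewrite !lik1E; apply: eq_bigr => j aj; rewrite ffunE aj. Qed.

Lemma mixture_obs (mu : R) alpha beta z a :
  mixture mu alpha beta (obs z a) a = mixture mu alpha beta z a.
Proof. by rewrite /mixture !lik0E !lik1_obs. Qed.

Lemma obs_observable z a : observable a (obs z a).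
Proof. by apply/forallP => j; rewrite ffunE; case: (a j); case: (z j). Qed.

Lemma sum_lik1_obs p a (g : {ffun 'I_m -> bool} -> R) :
  \sum_(z : {ffun 'I_m -> bool}) lik1 p z xpredT * g (obs z a) =
  \sum_(z : {ffun 'I_m -> bool} | observable a z) lik1 p z a * g z.
Proof.
rewrite (partition_big (fun z : {ffun 'I_m -> bool} => obs z a) (observable a)) /=.
  2: by move=> z _; exact: obs_observable.
apply: eq_bigr => z' /forallP z'a.
rewrite (eq_bigr (fun z : {ffun 'I_m -> bool} => (\prod_j bern (p j) (z j)) * g z'));
  last by move=> z /eqP ->; rewrite lik1E.
rewrite -big_distrl /=; congr (_ * _).
rewrite (eq_bigl (fun z : {ffun 'I_m -> bool} => z \in family (fun j => [pred b | (a j && b) == z' j])));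
  last first.
  move=> z; apply/eqP/familyP => [<- j|h]; first by rewrite !inE ffunE.
  by apply/ffunP => j; have := h j; rewrite !inE ffunE => /eqP.
rewrite -(bigA_distr_big_dep (fun j b => (a j && b) == z' j)
  (fun j b => bern (p j) b)) lik1E [RHS]big_mkcond /=.
apply: eq_bigr => j _; have := z'a j; case: (a j) => /=.
  by move=> _; rewrite big_pred1_eq.
rewrite implybF => /negbTE ->; rewrite (eq_bigl predT)// big_bool !bernE.
by rewrite /= addrC subrK.
Qed.

Lemma sum_mixture_obs (mu : R) alpha beta a (g : {ffun 'I_m -> bool} -> R) :
  \sum_(z : {ffun 'I_m -> bool}) mixture mu alpha beta z xpredT * g (obs z a) =
  \sum_(z : {ffun 'I_m -> bool} | observable a z) mixture mu alpha beta z a * g z.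
Proof.
rewrite /mixture.
transitivity (mu * \sum_(z : {ffun 'I_m -> bool}) lik1 alpha z xpredT * g (obs z a)
  + (1 - mu) * \sum_(z : {ffun 'I_m -> bool})
      lik1 (fun j => 1 - beta j) z xpredT * g (obs z a)).
  rewrite !big_distrr -big_split /=; apply: eq_bigr => z _.
  by rewrite lik0E !mulrDl !mulrA.
rewrite !sum_lik1_obs !big_distrr -big_split /=; apply: eq_bigr => z _.
by rewrite lik0E !mulrDl !mulrA.
Qed.

Lemma sum_lik1 p : \sum_(z : {ffun 'I_m -> bool}) lik1 p z xpredT = 1.
Proof.
transitivity (\sum_(z : {ffun 'I_m -> bool}) \prod_j bern (p j) (z j)) => //.
rewrite -(bigA_distr_bigA (fun j b => bern (p j) b)) big1// => j _.
by rewrite big_bool !bernE /= addrC subrK.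
Qed.

(** That the total is the same for all parameters is what cancels the linear terms in
    [mixture_gap_chi_square]. *)
Lemma sum_mixture_observable (mu : R) alpha beta a :
  \sum_(z : {ffun 'I_m -> bool} | observable a z) mixture mu alpha beta z a = 1.
Proof.
transitivity (\sum_(z : {ffun 'I_m -> bool} | observable a z) mixture mu alpha beta z a * 1).
  by apply: eq_bigr => z _; rewrite mulr1.
rewrite -(sum_mixture_obs mu alpha beta a (fun=> 1)).
transitivity (mu * \sum_(z : {ffun 'I_m -> bool}) lik1 alpha z xpredT
  + (1 - mu) * \sum_(z : {ffun 'I_m -> bool}) lik1 (fun j => 1 - beta j) z xpredT).
  rewrite !big_distrr -big_split /=; apply: eq_bigr => z _.
  by rewrite mulr1 /mixture lik0E.
by rewrite !sum_lik1 !mulr1 addrC subrK.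
Qed.

Definition in_box (delta : R) (th : params R m) : Prop :=
  [/\ delta <= prevalence th <= 1 - delta,
      forall j, delta <= sensitivity th j <= 1 - delta &
      forall j, delta <= specificity th j <= 1 - delta].

Definition pdist (th th' : params R m) : R :=
  `|prevalence th - prevalence th'|
  + \sum_(j < m) `|sensitivity th j - sensitivity th' j|
  + \sum_(j < m) `|specificity th j - specificity th' j|.

Lemma pdist_ge0 th th' : 0 <= pdist th th'.
Proof. by rewrite !addr_ge0// sumr_ge0. Qed.

Definition pmixture (th : params R m) z a : R :=
  mixture (prevalence th) (sensitivity th) (specificity th) z a.

Section box.
Variable delta : R.
Hypothesis d01 : 0 < delta <= 2^-1.

Lemma box01 th : in_box delta th ->
  [/\ 0 < prevalence th < 1, forall j, 0 < sensitivity th j < 1 &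
      forall j, 0 < specificity th j < 1].
Proof.
move: d01 => d [h1 h2 h3].
by split => [|j|j]; [|have := h2 j|have := h3 j]; lra.
Qed.

Lemma lik1_box th z a : in_box delta th ->
  delta ^+ m <= lik1 (sensitivity th) z a <= 1.
Proof.
move: d01 => d [h1 h2 h3]; rewrite lik1_ge//; last lra.
by apply: lik1_le1 => j; have := h2 j; lra.
Qed.

Lemma lik0_box th z a : in_box delta th ->
  delta ^+ m <= lik0 (specificity th) z a <= 1.
Proof.
move: d01 => d [h1 h2 h3]; rewrite lik0E; apply/andP; split.
  by apply: lik1_ge => [|j]; [|have := h3 j]; lra.
by apply: lik1_le1 => j; have := h3 j; lra.
Qed.

Lemma pmixture_box th z a : in_box delta th -> delta ^+ m <= pmixture th z a <= 1.
Proof.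
move: d01 => d h; have := lik0_box z a h; have := lik1_box z a h.
have [mu01 _ _] := box01 h; rewrite /pmixture /mixture.
have : 0 < delta ^+ m by rewrite exprn_gt0//; lra.
nra.
Qed.

Lemma pmixture_lip th th' z a : in_box delta th -> in_box delta th' ->
  `|pmixture th z a - pmixture th' z a| <= pdist th th'.
Proof.
move: d01 => d h h'; have [mu01 al be] := box01 h; have [mu01' al' be'] := box01 h'.
have L1 := lik1_box z a h; have L0 := lik0_box z a h.
have k1 : `|lik1 (sensitivity th) z a - lik1 (sensitivity th') z a| <=
    \sum_(j < m) `|sensitivity th j - sensitivity th' j|.
  by apply: lik1_lip => j; [have := al j|have := al' j]; lra.
have k0 : `|lik0 (specificity th) z a - lik0 (specificity th') z a| <=
    \sum_(j < m) `|specificity th j - specificity th' j|.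
  by apply: lik0_lip => j; [have := be j|have := be' j]; lra.
rewrite /pmixture /mixture /pdist.
have dm : 0 < delta ^+ m by rewrite exprn_gt0//; lra.
set l1 := lik1 (sensitivity th) z a in L1 k1 *.
set l0 := lik0 (specificity th) z a in L0 k0 *.
set l1' := lik1 (sensitivity th') z a in k1 *.
set l0' := lik0 (specificity th') z a in k0 *.
set mu := prevalence th; set mu' := prevalence th'.
rewrite (_ : mu * l1 + (1 - mu) * l0 - (mu' * l1' + (1 - mu') * l0') = (mu - mu') * (l1 - l0) + mu' * (l1 - l1') + (1 - mu') * (l0 - l0'));
  last ring.
apply: (le_trans (ler_normD _ _)); apply: lerD.
  apply: (le_trans (ler_normD _ _)); apply: lerD.
    by rewrite normrM ler_piMr// ler_norml; lra.
  by apply: le_trans k1; rewrite normrM ler_piMl// ger0_norm /mu'; lra.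
by apply: le_trans k0; rewrite normrM ler_piMl// ger0_norm /mu'; lra.
Qed.

End box.
End likelihood.

(** * Monotonicity of clipped EM *)

Section em_monotone.
Context {R : realType} {m N : nat}.
Variables (z a : 'I_N -> 'I_m -> bool) (delta : R).
Hypothesis d01 : 0 < delta <= 2^-1.
Implicit Types (u v : 'I_N -> R) (th : params R m).

(* The complete-data log-likelihood when instance [i] counts for [u i] positive
   and [v i] negative gold labels. *)
Definition complete_loglik u v th : R :=
  \sum_(i < N)
    (u i * ln (prevalence th * lik1 (sensitivity th) (z i) (a i)) +
     v i * ln ((1 - prevalence th) * lik0 (specificity th) (z i) (a i))).

Definition hits u j : R := \sum_(i < N) (a i j)%:R * u i * (z i j)%:R.
Definition misses u j : R := \sum_(i < N) (a i j)%:R * u i * (1 - (z i j)%:R).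
Definition votes u j : R := \sum_(i < N) (a i j)%:R * u i.

Lemma hitsDmisses u j : hits u j + misses u j = votes u j.
Proof. by rewrite -big_split; apply: eq_bigr => i _ /=; ring. Qed.

Lemma hits_ge0 u j : (forall i, 0 <= u i) -> 0 <= hits u j.
Proof. by move=> u0; apply: sumr_ge0 => i _; rewrite !mulr_ge0. Qed.

Lemma misses_ge0 u j : (forall i, 0 <= u i) -> 0 <= misses u j.
Proof.
by move=> u0; apply: sumr_ge0 => i _; case: (z i j); rewrite ?subrr ?subr0 ?mulr0 ?mulr1 ?mulr_ge0.
Qed.

(** The 2 m + 1 parameters separate into binomial likelihoods, so the maximization over the box is
    coordinatewise. For a specificity, a negative label is the success. *)
Lemma complete_loglikE u v th : in_box delta th ->
  complete_loglik u v th =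
  binlik (\sum_i u i) (\sum_i v i) (prevalence th) +
  \sum_(j < m) (binlik (hits u j) (misses u j) (sensitivity th j) +
                binlik (misses v j) (hits v j) (specificity th j)).
Proof.
move=> h; have [mu01 al be] := box01 d01 h.
have dm : 0 < delta ^+ m by rewrite exprn_gt0//; case/andP: d01.
have e i : u i * ln (prevalence th * lik1 (sensitivity th) (z i) (a i)) +
     v i * ln ((1 - prevalence th) * lik0 (specificity th) (z i) (a i)) =
  (u i * ln (prevalence th) + v i * ln (1 - prevalence th)) +
  \sum_(j < m) (((a i j)%:R * u i * (z i j)%:R * ln (sensitivity th j) +
     (a i j)%:R * u i * (1 - (z i j)%:R) * ln (1 - sensitivity th j)) +
     ((a i j)%:R * v i * (1 - (z i j)%:R) * ln (specificity th j) +
     (a i j)%:R * v i * (z i j)%:R * ln (1 - specificity th j))).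
  have /andP[L1 _] := lik1_box d01 (z i) (a i) h.
  have /andP[L0 _] := lik0_box d01 (z i) (a i) h.
  have L1' := lt_le_trans dm L1; have L0' := lt_le_trans dm L0.
  rewrite !lnM ?posrE//; try lra.
  rewrite lik0E !ln_lik1//; last by move=> j; have := be j; lra.
  rewrite 2!mulrDr addrACA !big_distrr -big_split /=; congr (_ + _).
  by apply: eq_bigr => j _; rewrite subKr; ring.
rewrite /complete_loglik (eq_bigr _ (fun i _ => e i)) big_split /=; congr (_ + _).
  by rewrite big_split /= /binlik !big_distrl.
rewrite exchange_big /=; apply: eq_bigr => j _.
by rewrite !big_split /= /binlik /hits /misses !big_distrl.
Qed.

Definition complete_argmax u v : params R m := Params
  (clip delta ((\sum_i u i) / (\sum_i u i + \sum_i v i)))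
  (fun j => clip delta (hits u j / votes u j))
  (fun j => clip delta (misses v j / votes v j)).

Lemma complete_argmax_box u v : in_box delta (complete_argmax u v).
Proof. by split => [|j|j] /=; apply: clip_bounds; move: d01 => /andP[/ltW -> ->]. Qed.

(** Only the reliabilities keep their quadratic gap; that of the prevalence is bounded below by 0,
    since HERO-1 does not take over the historical prevalence. *)
Lemma complete_argmax_gap u v th : (forall i, 0 <= u i) -> (forall i, 0 <= v i) ->
  in_box delta th ->
  delta / 4 * \sum_(j < m)
    (votes u j * (sensitivity th j - sensitivity (complete_argmax u v) j) ^+ 2 +
     votes v j * (specificity th j - specificity (complete_argmax u v) j) ^+ 2)
  <= complete_loglik u v (complete_argmax u v) - complete_loglik u v th.
Proof.
move=> u0 v0 h; rewrite !complete_loglikE//; last exact: complete_argmax_box.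
rewrite opprD addrACA -sumrB big_distrr -[leLHS]add0r /=; case: h => h1 h2 h3.
apply: lerD.
  apply: le_trans (binlik_clip_max d01 _ _ h1); rewrite ?sumr_ge0//.
  rewrite mulr_ge0 ?sqr_ge0// mulr_ge0 ?addr_ge0 ?sumr_ge0//.
  by move: d01 => d; lra.
apply: ler_sum => j _; rewrite opprD addrACA mulrDr; apply: lerD.
  have := binlik_clip_max d01 (hits_ge0 j u0) (misses_ge0 j u0) (h2 j).
  by rewrite hitsDmisses mulrA.
have := binlik_clip_max d01 (misses_ge0 j v0) (hits_ge0 j v0) (h3 j).
by rewrite (addrC (misses v j)) hitsDmisses mulrA.
Qed.

Lemma complete_argmax_ge u v th : (forall i, 0 <= u i) -> (forall i, 0 <= v i) ->
  in_box delta th ->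
  complete_loglik u v th <= complete_loglik u v (complete_argmax u v).
Proof.
move=> u0 v0 h; rewrite -subr_ge0; apply: le_trans (complete_argmax_gap u0 v0 h).
rewrite mulr_ge0 ?sumr_ge0//; first by move: d01 => d; lra.
by move=> j _; rewrite addr_ge0// mulr_ge0 ?sqr_ge0// sumr_ge0// => i _; rewrite mulr_ge0.
Qed.

Variables (y r : 'I_N -> bool).

Definition gold_pos (i : 'I_N) : R := (r i && y i)%:R.
Definition gold_neg (i : 'I_N) : R := (r i && ~~ y i)%:R.

(* The objective that EM increases: [loglik] leaves out the contribution of the
   prevalence to the gold-labelled instances, although the M-step for the
   prevalence uses these instances. *)
Definition anchored_loglik th : R :=
  complete_loglik gold_pos gold_neg th +
  \sum_(i < N | ~~ r i) ln (pmixture th (z i) (a i)).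

(** The initialization is an M-step on the gold-labelled instances alone, so the gap inequality
    applies with the initialization as maximizer. *)
Lemma gold_initE : gold_init y r z a delta = complete_argmax gold_pos gold_neg.
Proof.
have e (Q : 'I_N -> bool) :
  (\sum_(i < N | r i) (Q i)%:R : R) = \sum_(i < N) (r i && Q i)%:R.
  by rewrite big_mkcond; apply: eq_bigr => i _; case: (r i).
rewrite /gold_init /complete_argmax /hits /misses /votes; congr Params.
- congr (clip _ (_ / _)); first by rewrite e.
  rewrite -big_split big_mkcond /=; apply: eq_bigr => i _.
  by rewrite /gold_pos /gold_neg; case: (r i); case: (y i); rewrite ?addr0 ?add0r.
- apply/funext => j; congr (clip _ (_ / _)); rewrite e; apply: eq_bigr => i _;
    rewrite /gold_pos;
    by case: (r i); case: (y i); case: (z i j); case: (a i j); rewrite ?mulr1 ?mulr0 ?mul0r.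
- apply/funext => j; congr (clip _ (_ / _)); rewrite e; apply: eq_bigr => i _;
    rewrite /gold_neg;
    by case: (r i); case: (y i); case: (z i j); case: (a i j);
       rewrite ?mulr1 ?mulr0 ?mul0r ?subr0 ?subrr ?mulr0 ?mulr1.
Qed.

Lemma m_stepE (gamma : 'I_N -> R) :
  m_step z a delta gamma = complete_argmax gamma (fun i => 1 - gamma i).
Proof.
rewrite /m_step /complete_argmax; congr Params; congr (clip _ _).
rewrite mulrC; congr (_ / _); rewrite -big_split /= (eq_bigr (fun=> 1)).
  by rewrite sumr_const card_ord.
by move=> i _; rewrite addrC subrK.
Qed.

(** The EM argument, instance by instance: a gold-labelled instance changes the complete and the
    anchored likelihood by the same amount, and for an unrouted one Jensen's inequality under its
    posterior compares the two. *)
Lemma m_step_anchored_ge th : in_box delta th ->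
  anchored_loglik th <= anchored_loglik (m_step z a delta (e_step y r z a th)).
Proof.
move=> h; set g := e_step y r z a th; rewrite m_stepE.
set th' := complete_argmax _ _; have h' : in_box delta th' := complete_argmax_box _ _.
have [mu01 al be] := box01 d01 h; have [mu01' al' be'] := box01 d01 h'.
have dm : 0 < delta ^+ m by rewrite exprn_gt0//; case/andP: d01.
have pos1 t i : in_box delta t ->
    0 < prevalence t * lik1 (sensitivity t) (z i) (a i).
  move=> ht; have [? _ _] := box01 d01 ht; have /andP[L _] := lik1_box d01 (z i) (a i) ht.
  by have L' := lt_le_trans dm L; rewrite mulr_gt0//; lra.
have pos0 t i : in_box delta t ->
    0 < (1 - prevalence t) * lik0 (specificity t) (z i) (a i).
  move=> ht; have [? _ _] := box01 d01 ht; have /andP[L _] := lik0_box d01 (z i) (a i) ht.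
  by have L' := lt_le_trans dm L; rewrite mulr_gt0//; lra.
have g01 i : 0 <= g i <= 1.
  rewrite /g /e_step; case: (r i); first by case: (y i); rewrite /= ?lexx ?ler01.
  have p1 := pos1 _ i h; have p0 := pos0 _ i h.
  rewrite /mixture ler_pdivrMr ?addr_gt0// divr_ge0//=; lra.
have g0 i : 0 <= g i by have := g01 i; lra.
have g1 i : 0 <= 1 - g i by have := g01 i; lra.
have := complete_argmax_ge g0 g1 h; rewrite -/th' -subr_ge0 -sumrB => Q0.
rewrite -subr_ge0; apply: (le_trans Q0).
rewrite /anchored_loglik opprD addrACA -!sumrB [X in _ <= _ + X]big_mkcond -big_split /=.
apply: ler_sum => i _; have p1 := pos1 _ i h; have p0 := pos0 _ i h.
have p1' := pos1 _ i h'; have p0' := pos0 _ i h'.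
have -> : g i = e_step y r z a th i by [].
rewrite /gold_pos /gold_neg /e_step; case: (r i) => /=.
  by case: (y i) => /=; rewrite ?subrr ?subr0 ?mul1r ?mul0r ?addr0 ?add0r.
rewrite /pmixture /mixture.
move: p1 p0 p1' p0'.
set A := prevalence th * _; set B := (1 - prevalence th) * _.
set A' := prevalence th' * _; set B' := (1 - prevalence th') * _ => p1 p0 p1' p0'.
have AB : 0 < A + B by rewrite addr_gt0.
have t01 : 0 <= A / (A + B) <= 1 by rewrite ler_pdivrMr// divr_ge0//=; lra.
have := ln_concave t01 (divr_gt0 p1' p1) (divr_gt0 p0' p0).
(* The posterior mean of the ratios A' / A and B' / B is the ratio of the mixtures. *)
rewrite (_ : _ / _ * (A' / A) + _ = (A' + B') / (A + B)); last first.
  by field; rewrite !gt_eqF.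
rewrite !ln_div ?posrE ?addr_gt0//; lra.
Qed.

Lemma em_iter_box th t : in_box delta th -> in_box delta (em_iter y r z a delta th t).
Proof.
by elim: t => //= t IH h; rewrite m_stepE; apply: complete_argmax_box.
Qed.

Lemma em_iter_anchored_ge th t : in_box delta th ->
  anchored_loglik th <= anchored_loglik (em_iter y r z a delta th t).
Proof.
move=> h; elim: t => //= t IH; apply: (le_trans IH).
by apply: m_step_anchored_ge; apply: em_iter_box.
Qed.

Lemma gold_init_box : in_box delta (gold_init y r z a delta).
Proof. by rewrite gold_initE; exact: complete_argmax_box. Qed.

Lemma gold_anchored_em_box eps : in_box delta (gold_anchored_em y r z a delta eps).
Proof. exact: em_iter_box gold_init_box. Qed.

Lemma em_gold_gap eps :
  let th0 := gold_init y r z a delta in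
  let th := gold_anchored_em y r z a delta eps in
  delta / 4 * \sum_(j < m)
    (votes gold_pos j * (sensitivity th j - sensitivity th0 j) ^+ 2 +
     votes gold_neg j * (specificity th j - specificity th0 j) ^+ 2)
  <= \sum_(i < N | ~~ r i)
       (ln (pmixture th (z i) (a i)) - ln (pmixture th0 (z i) (a i))).
Proof.
cbv zeta; set th0 := gold_init _ _ _ _ _; set th := gold_anchored_em _ _ _ _ _ _.
rewrite sumrB.
(* [em] performs [em_stop] + 1 steps; the inequality holds for any number of them, also when
   [em_stop] takes its default value. *)
have := @em_iter_anchored_ge th0 (em_stop y r z a delta eps th0).+1 gold_init_box.
rewrite -/(em y r z a delta eps th0) -/(gold_anchored_em y r z a delta eps) -/th.
have := @complete_argmax_gap gold_pos gold_neg th (fun i => ler0n _ _)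
  (fun i => ler0n _ _) (gold_anchored_em_box eps).
rewrite -gold_initE -/th0 /anchored_loglik; lra.
Qed.

End em_monotone.

(** * The saturated model *)

Section saturated_bound.
Context {R : realType} {m N : nat}.
Variables (r : 'I_N -> bool) (z a : 'I_N -> 'I_m -> bool).
Local Notation pattern := {ffun 'I_m -> bool}.

Definition unrouted_with (s : pattern) (i : 'I_N) : bool :=
  ~~ r i && ([ffun j => a i j] == s).

Definition pattern_count (s : pattern) : R := \sum_(i < N) (unrouted_with s i)%:R.

Definition cell_count (s x : pattern) : R :=
  \sum_(i < N) (unrouted_with s i && (obs (z i) s == x))%:R.

(** Pearson's statistic stratified by availability pattern, without the cell probability in the
    denominator; in the box that probability lies between [delta ^+ m] and 1. An empty stratum
    contributes 0. *)
Definition chi_square (th : params R m) : R :=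
  \sum_(s : pattern) \sum_(x : pattern | observable s x)
    (cell_count s x - pattern_count s * pmixture th x s) ^+ 2 / pattern_count s.

Lemma sum_unrouted_cells (h : pattern -> pattern -> R) :
  \sum_(i < N | ~~ r i) h [ffun j => a i j] (obs (z i) (a i)) =
  \sum_(s : pattern) \sum_(x : pattern | observable s x) cell_count s x * h s x.
Proof.
rewrite (partition_big (fun i => [ffun j => a i j] : pattern) predT)//=.
apply: eq_bigr => s _.
rewrite (partition_big (fun i => obs (z i) s) (observable s)) /=; last first.
  by move=> i _; exact: obs_observable.
apply: eq_bigr => x _.
rewrite /cell_count big_distrl [LHS]big_mkcond /=; apply: eq_bigr => i _.
rewrite -/(unrouted_with s i); case: (boolP (unrouted_with s i)) => [/andP[_ /eqP si]|_] /=;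
  last by rewrite mul0r.
case: eqP => [<-|_]; last by rewrite mul0r.
rewrite mul1r -si; congr (h _ _); apply/ffunP => j; by rewrite !ffunE.
Qed.

Lemma cell_count_le s x : cell_count s x <= pattern_count s.
Proof.
apply: ler_sum => i _; case: (unrouted_with s i) => //=.
by case: (_ == _); rewrite ?ler01.
Qed.

Lemma sum_pattern_count : \sum_(s : pattern) pattern_count s <= N%:R.
Proof.
rewrite exchange_big /= -[leRHS]mulr_natr mul1r -[X in _ <= X%:R]card_ord -sumr_const.
apply: ler_sum => i _; rewrite (bigD1 ([ffun j => a i j] : pattern))//= big1.
  by rewrite addr0 /unrouted_with; case: (~~ _); case: (_ == _); rewrite ?ler01.
by move=> s /negbTE; rewrite eq_sym /unrouted_with => ->; rewrite andbF.
Qed.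

Lemma pattern_count_ge0 s : 0 <= pattern_count s.
Proof. by apply: sumr_ge0. Qed.

Lemma cell_count_ge0 s x : 0 <= cell_count s x.
Proof. by apply: sumr_ge0. Qed.

(* Compares [f] and [g] through the empirical frequency [k / n]. *)
Lemma cell_bound (k n f g : R) : 0 <= k <= n -> 0 < f -> 0 < g ->
  k * (ln f - ln g) <= n * f - 2 * k + k ^+ 2 / (n * g).
Proof.
move=> /andP[k0 kn] f0 g0.
have [->|kN0] := eqVneq k 0.
  rewrite mul0r mulr0 subr0 expr0n /= mul0r addr0 mulr_ge0//; [|lra].
  exact: le_trans kn.
have kp : 0 < k by rewrite lt_def kN0.
have np : 0 < n by rewrite (lt_le_trans kp).
have h1 := ler_wpM2l k0 (ln_sub_le f0 (divr_gt0 kp np)).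
have h2 := ler_wpM2l k0 (ln_sub_le (divr_gt0 kp np) g0).
have e1 : k * (f / (k / n) - 1) = n * f - k by field; rewrite !gt_eqF.
have e2 : k * (k / n / g - 1) = k ^+ 2 / (n * g) - k by field; rewrite !gt_eqF.
lra.
Qed.

Variable delta : R.
Hypothesis d01 : 0 < delta <= 2^-1.

(** The bound is uniform in [th], which will be the EM fit. [th1] will be the initialization, which
    depends on the data; the statistic is centred at [th0], the truth, where its expectation can be
    computed. *)
Lemma mixture_gap_chi_square (th th1 th0 : params R m) :
  in_box delta th -> in_box delta th1 -> in_box delta th0 ->
  \sum_(i < N | ~~ r i)
     (ln (pmixture th (z i) (a i)) - ln (pmixture th1 (z i) (a i)))
  <= 2 / delta ^+ m *
     (chi_square th0 + 2 ^+ m * N%:R * pdist th1 th0 ^+ 2).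
Proof.
move=> h h1 h0; have dm : 0 < delta ^+ m by rewrite exprn_gt0//; case/andP: d01.
pose L (s x : pattern) := ln (pmixture th x s) - ln (pmixture th1 x s).
have -> : \sum_(i < N | ~~ r i)
     (ln (pmixture th (z i) (a i)) - ln (pmixture th1 (z i) (a i))) =
  \sum_(i < N | ~~ r i) L [ffun j => a i j] (obs (z i) (a i)).
  apply: eq_bigr => i _; rewrite /L.
  have -> : ([ffun j => a i j] : 'I_m -> bool) = a i by apply/funext => j; rewrite ffunE.
  by rewrite /pmixture !mixture_obs.
rewrite sum_unrouted_cells mulrDr.
have pos t (s x : pattern) : in_box delta t -> 0 < pmixture t x s.
  by move=> ht; have /andP[] := pmixture_box d01 x s ht => /(lt_le_trans dm).
have sum1 t (s : pattern) : \sum_(x : pattern | observable s x) pmixture t x s = 1.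
  exact: sum_mixture_observable.
have chi (s : pattern) : \sum_(x : pattern | observable s x) cell_count s x * L s x <=
    \sum_(x : pattern | observable s x)
    (cell_count s x - pattern_count s * pmixture th1 x s) ^+ 2
      / (pattern_count s * pmixture th1 x s).
  have [n0|nN0] := eqVneq (pattern_count s) 0.
    rewrite !big1// => x _; first by rewrite n0 !(mul0r, invr0, mulr0).
    have := cell_count_le s x; have := cell_count_ge0 s x; rewrite n0 => ? ?.
    by rewrite (_ : cell_count s x = 0) ?mul0r//; lra.
  apply: (@le_trans _ _ (\sum_(x : pattern | observable s x)
    (pattern_count s * pmixture th x s - 2 * cell_count s x +
      cell_count s x ^+ 2 / (pattern_count s * pmixture th1 x s)))).
    apply: ler_sum => x _; apply: cell_bound; [|exact: pos|exact: pos].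
    by rewrite cell_count_ge0 cell_count_le.
  rewrite le_eqVlt; apply/orP; left; apply/eqP.
  (* Replacing n f by n g costs nothing, as both sum to n; then n g - 2 k + k ^ 2 / (n g) = (k - n
     g) ^ 2 / (n g). *)
  transitivity (\sum_(x : pattern | observable s x)
     (pattern_count s * (pmixture th x s - pmixture th1 x s) +
    (cell_count s x - pattern_count s * pmixture th1 x s) ^+ 2
      / (pattern_count s * pmixture th1 x s))).
    apply: eq_bigr => x _; field; rewrite nN0 gt_eqF//; exact: pos.
  by rewrite big_split /= -big_distrr /= sumrB !sum1 subrr mulr0 add0r.
apply: (le_trans (ler_sum _ (fun s _ => chi s))).
(* (k - n f1) ^ 2 <= 2 (k - n f0) ^ 2 + 2 n ^ 2 D ^ 2 moves the centre, and f1 >= [delta ^+ m]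
   clears the denominator. *)
apply: (@le_trans _ _ (\sum_(s : pattern) \sum_(x : pattern | observable s x)
   2 / delta ^+ m *
   ((cell_count s x - pattern_count s * pmixture th0 x s) ^+ 2 / pattern_count s
    + pattern_count s * pdist th1 th0 ^+ 2))).
  apply: ler_sum => s _; apply: ler_sum => x _.
  have [->|nN0] := eqVneq (pattern_count s) 0.
    by rewrite !(mul0r, invr0, mulr0, addr0).
  have np : 0 < pattern_count s by rewrite lt_def nN0 pattern_count_ge0.
  have := pmixture_lip d01 x s h1 h0.
  have /andP[dp _] := pmixture_box d01 x s h1.
  have p1 := pos _ s x h1.
  set f1 := pmixture th1 x s in dp p1 *; set f0 := pmixture th0 x s.
  set n := pattern_count s in np *; set k := cell_count s x; set D := pdist _ _ => lip.
  have D2 : (f1 - f0) ^+ 2 <= D ^+ 2.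
    by rewrite -[leLHS]real_normK ?num_real// lerXn2r ?nnegrE// (le_trans _ lip).
  rewrite (_ : 2 / delta ^+ m * _ = (2 * (k - n * f0) ^+ 2 + 2 * (n ^+ 2 * D ^+ 2)) / (n * delta ^+ m));
    last by field; rewrite !gt_eqF.
  apply: (@le_trans _ _ ((2 * (k - n * f0) ^+ 2 + 2 * (n ^+ 2 * D ^+ 2)) / (n * f1))).
    rewrite ler_pM2r ?invr_gt0 ?mulr_gt0//.
    have nD := ler_wpM2l (sqr_ge0 n) D2.
    have := sqr_ge0 (k - n * f0 + n * (f1 - f0)); nra.
  rewrite ler_wpM2l//; last by rewrite lef_pV2 ?posrE ?mulr_gt0// ler_pM2l.
  by rewrite addr_ge0// mulr_ge0 ?sqr_ge0// mulr_ge0// sqr_ge0.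
under eq_bigr do rewrite -big_distrr /=.
rewrite -big_distrr /= -mulrDr ler_wpM2l ?divr_ge0 ?(ltW dm)//.
under eq_bigr do rewrite big_split /=.
rewrite big_split /= lerD2l.
(* A stratum has at most 2 ^ m cells. *)
apply: (@le_trans _ _ (\sum_(s : pattern) 2 ^+ m * (pattern_count s * pdist th1 th0 ^+ 2))).
  apply: ler_sum => s _; rewrite sumr_const -[leLHS]mulr_natl ler_wpM2r//.
    by rewrite mulr_ge0 ?sqr_ge0// pattern_count_ge0.
  rewrite -natrX ler_nat; apply: (@leq_trans #|{: pattern}|); first exact: max_card.
  by rewrite card_ffun card_bool card_ord.
rewrite -big_distrr -big_distrl /= -mulrA ler_wpM2l ?exprn_ge0//.
by rewrite ler_wpM2r ?sqr_ge0// sum_pattern_count.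
Qed.

End saturated_bound.

(** * Concavity of the HERO-1 likelihood *)

Section hero.
Context {R : realType} {m n : nat}.
Variables (z a : 'I_n -> 'I_m -> bool).

(** Derivative of [mixture] in the prevalence; [score] below is the logarithmic derivative. *)
Definition contrast (th : params R m) (s x : 'I_m -> bool) : R :=
  lik1 (sensitivity th) s x - lik0 (specificity th) s x.

Definition score (th : params R m) (s x : 'I_m -> bool) : R :=
  contrast th s x / pmixture th s x.

Lemma contrast_obs th s x : contrast th (obs s x) x = contrast th s x.
Proof. by rewrite /contrast !lik0E !lik1_obs. Qed.

Lemma score_obs th s x : score th (obs s x) x = score th s x.
Proof. by rewrite /score contrast_obs /pmixture mixture_obs. Qed.

Section concave.
Variables (delta mu : R) (alpha beta : 'I_m -> R).
Let th := Params mu alpha beta.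
Hypotheses (d01 : 0 < delta <= 2^-1) (th_box : in_box delta th).
Let H := hero1_loglik alpha beta z a.

Lemma mixture_gt0 nu s x : 0 < nu < 1 -> 0 < mixture nu alpha beta s x.
Proof.
move=> nu01; have dm : 0 < delta ^+ m by rewrite exprn_gt0//; case/andP: d01.
have /= := lik1_box d01 s x th_box; have /= := lik0_box d01 s x th_box.
rewrite /mixture => L0 L1; have := lt_le_trans dm (proj1 (andP L0)).
have := lt_le_trans dm (proj1 (andP L1)) => l1 l0.
by rewrite addr_gt0// mulr_gt0//; lra.
Qed.

Lemma hero1_loglik_concave (s x y : R) : 0 <= s <= 1 -> 0 < x < 1 -> 0 < y < 1 ->
  s * H x + (1 - s) * H y <= H (s * x + (1 - s) * y).
Proof.
move=> s01 x01 y01; rewrite /H /hero1_loglik !big_distrr -big_split /=.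
apply: ler_sum => i _.
have -> : mixture (s * x + (1 - s) * y) alpha beta (z i) (a i) =
  s * mixture x alpha beta (z i) (a i) + (1 - s) * mixture y alpha beta (z i) (a i).
  by rewrite /mixture; ring.
by apply: ln_concave => //; exact: mixture_gt0.
Qed.

Lemma hero1_loglik_beyond (x y w : R) :
  0 < x < 1 -> 0 < y < 1 -> (x < w < y) || (y < w < x) ->
  H w < H x -> H y < H w.
Proof.
move=> x01 y01 xwy Hwx.
have yx : y - x != 0 by rewrite subr_eq0; apply/eqP => yx; lra.
pose s := (w - x) / (y - x).
have s01 : 0 < s < 1.
  case/orP: xwy => xwy; rewrite /s.
    by rewrite ltr_pdivrMr ?divr_gt0//=; lra.
  rewrite -mulrNN -invrN.
  by rewrite ltr_pdivrMr ?divr_gt0//=; lra.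
have wE : w = s * y + (1 - s) * x by rewrite /s; field.
have := @hero1_loglik_concave s y x _ y01 x01.
rewrite -wE => /(_ ltac:(lra)) h; nra.
Qed.

Lemma hero1_loglik_continuous x : 0 < x < 1 -> {for x, continuous H}.
Proof.
move=> x01; rewrite /H /hero1_loglik.
pose f (s : seq 'I_n) : R -> R :=
  fun nu => \sum_(i <- s) ln (mixture nu alpha beta (z i) (a i)).
suff : forall s, continuous_at x (f s) by apply.
elim=> [|i s IH].
  have -> : f [::] = cst 0 by apply/funext => nu; rewrite /f big_nil.
  exact: cst_continuous.
have -> : f (i :: s) = (fun nu => ln (mixture nu alpha beta (z i) (a i))) \+ f s.
  by apply/funext => nu; rewrite /f big_cons.
apply: continuousD => //.
apply: (@continuous_comp _ _ _ (fun nu => mixture nu alpha beta (z i) (a i)) (@ln R)).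
  rewrite /mixture; apply: continuousD.
    by apply: continuousM; [exact: cvg_id|exact: cst_continuous].
  apply: continuousM; last exact: cst_continuous.
  by apply: continuousB; [exact: cst_continuous|exact: cvg_id].
by apply: continuous_ln; exact: mixture_gt0.
Qed.

(** Concavity excludes maximizers outside the interval and compactness provides one inside, so [get]
    returns a true maximizer although the domain of [hero1] is open. *)
Lemma hero1_localized (t : R) : 0 < t -> 0 < mu - t -> mu + t < 1 ->
  H (mu - t) < H mu -> H (mu + t) < H mu -> `|hero1 alpha beta z a - mu| <= t.
Proof.
move=> t0 lo hi Hlo Hhi.
have mu01 : 0 < mu < 1 by lra.
have out y : 0 < y < 1 -> t < `|y - mu| -> H y < H mu.
  move=> y01; case: (leP mu y) => ymu.
    rewrite ger0_norm ?subr_ge0// => ty.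
    by apply: (lt_trans _ Hhi); apply: (@hero1_loglik_beyond mu) => //; apply/orP; left; lra.
  rewrite ltr0_norm ?subr_lt0// => ty.
  by apply: (lt_trans _ Hlo); apply: (@hero1_loglik_beyond mu) => //; apply/orP; right; lra.
have [c cin cmax] : exists2 c, c \in `[mu - t, mu + t]%R &
    forall x, x \in `[mu - t, mu + t]%R -> H x <= H c.
  apply: EVT_max; first lra.
  apply: continuous_in_subspaceT => x; rewrite inE/= in_itv/= => xin.
  by apply: hero1_loglik_continuous; lra.
have Hmu : H mu <= H c by apply: cmax; rewrite in_itv/=; lra.
have : 0 < hero1 alpha beta z a < 1 /\
   (forall nu : R, 0 < nu < 1 -> H nu <= H (hero1 alpha beta z a)).
  have hero1P := @getPex R [set x : R | 0 < x < 1 /\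
    (forall nu : R, 0 < nu < 1 -> H nu <= H x)].
  apply: hero1P.
  exists c; move: cin; rewrite in_itv/= => cin; split; first lra.
  move=> nu nu01; case: (leP `|nu - mu| t) => [|/(out _ nu01) h]; last first.
    by rewrite (le_trans (ltW h)).
  by rewrite ler_norml => nut; apply: cmax; rewrite in_itv/=; lra.
case=> h01 hmax; rewrite leNgt; apply/negP => /(out _ h01).
by rewrite ltNge hmax.
Qed.

End concave.

Variable delta : R.
Hypothesis d01 : 0 < delta <= 2^-1.

Lemma contrast_lip th th0 s x : in_box delta th -> in_box delta th0 ->
  `|contrast th s x - contrast th0 s x| <= pdist th th0.
Proof.
move=> h h0; have [_ al be] := box01 d01 h; have [_ al0 be0] := box01 d01 h0.
have k1 := @lik1_lip R m (sensitivity th) (sensitivity th0) s x.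
have k0 := @lik0_lip R m (specificity th) (specificity th0) s x.
have {}k1 := k1 (fun j => ltac:(have := al j; lra)) (fun j => ltac:(have := al0 j; lra)).
have {}k0 := k0 (fun j => ltac:(have := be j; lra)) (fun j => ltac:(have := be0 j; lra)).
have p0 := normr_ge0 (prevalence th - prevalence th0).
rewrite /contrast /pdist.
move: (lik1 _ _ _) (lik1 _ _ _) k1 (lik0 _ _ _) (lik0 _ _ _) k0 => l1' l1 k1 l0' l0 k0.
rewrite (_ : l1 - l0 - (l1' - l0') = (l1 - l1') - (l0 - l0')); last ring.
apply: (le_trans (ler_normB _ _)); lra.
Qed.

Lemma contrast_le1 th s x : in_box delta th -> `|contrast th s x| <= 1.
Proof.
move=> h; have := lik1_box d01 s x h; have := lik0_box d01 s x h.
have : 0 < delta ^+ m by rewrite exprn_gt0//; case/andP: d01.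
by rewrite /contrast ler_norml; lra.
Qed.

(** Both denominators are at least [delta ^+ m]; the 2 adds the variations of numerator and
    denominator. *)
Lemma score_lip th th0 s x : in_box delta th -> in_box delta th0 ->
  `|score th s x - score th0 s x| <= 2 / (delta ^+ m) ^+ 2 * pdist th th0.
Proof.
move=> h h0; have dm : 0 < delta ^+ m by rewrite exprn_gt0//; case/andP: d01.
have F := pmixture_box d01 s x h; have F0 := pmixture_box d01 s x h0.
have cl := contrast_lip s x h h0; have fl := pmixture_lip d01 s x h h0.
have c1 := contrast_le1 s x h0.
rewrite /score; set u := contrast th s x in cl *; set u0 := contrast th0 s x in cl c1 *.
set f := pmixture th s x in F fl *; set f0 := pmixture th0 s x in F0 fl *.
set D := pdist _ _ in cl fl *; set e := delta ^+ m in dm F F0 *.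
have f_gt0 : 0 < f by lra.
have f0_gt0 : 0 < f0 by lra.
rewrite (_ : u / f - u0 / f0 = ((u - u0) * f0 - u0 * (f - f0)) / (f * f0)); last first.
  by field; rewrite !gt_eqF.
rewrite normrM normfV (ger0_norm (ltW (mulr_gt0 f_gt0 f0_gt0))).
have D0 : 0 <= D by rewrite (le_trans _ cl).
have num : `|(u - u0) * f0 - u0 * (f - f0)| <= 2 * D.
  rewrite (_ : 2 * D = D + D); last ring.
  apply: (le_trans (ler_normB _ _)); rewrite !normrM; apply: lerD.
    by apply: le_trans cl; rewrite ler_piMr// ger0_norm; lra.
  by apply: le_trans fl; rewrite ler_piMl.
apply: (@le_trans _ _ (2 * D / (f * f0))).
  by rewrite ler_pM2r// invr_gt0 mulr_gt0.
rewrite [leRHS]mulrAC ler_wpM2l//; first by rewrite mulr_ge0.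
rewrite lef_pV2 ?posrE; [|exact: mulr_gt0|exact: exprn_gt0].
by rewrite expr2; apply: ler_pM; lra.
Qed.

(** Both mixture weights are at least [delta], which gives delta^-1 rather than a power depending on
    m; shifts of the prevalence up to [delta] are then allowed below. *)
Lemma score_le th s x : in_box delta th -> `|score th s x| <= delta^-1.
Proof.
move=> h; have dm : 0 < delta ^+ m by rewrite exprn_gt0//; case/andP: d01.
have L1 := lik1_box d01 s x h; have L0 := lik0_box d01 s x h; case: h => mu01 _ _.
rewrite /score /contrast /pmixture /mixture normrM normfV.
set l1 := lik1 _ _ _ in L1 *; set l0 := lik0 _ _ _ in L0 *; set mu := prevalence th in mu01 *.
have f0 : 0 < mu * l1 + (1 - mu) * l0.
  by rewrite addr_gt0// mulr_gt0//; move: d01 => d; lra.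
rewrite (gtr0_norm f0) ler_pdivrMr// ler_pdivlMl; last by case/andP: d01.
move: d01 => d; have k1 : delta * l1 <= mu * l1 by rewrite ler_wpM2r//; lra.
have k0 : delta * l0 <= (1 - mu) * l0 by rewrite ler_wpM2r//; lra.
have p1 : 0 <= delta * l1 by rewrite mulr_ge0//; lra.
have p0 : 0 <= delta * l0 by rewrite mulr_ge0//; lra.
have -> : delta * `|l1 - l0| = `|delta * l1 - delta * l0|.
  by rewrite -mulrBr normrM gtr0_norm//; lra.
by rewrite ler_norml; lra.
Qed.

(** Mixtures are at most 1. The squared contrast is a lower bound for the curvature that is easier
    to compare between parameters. *)
Lemma contrast_sqr_le_score th s x : in_box delta th ->
  contrast th s x ^+ 2 <= score th s x ^+ 2.
Proof.
move=> h; have dm : 0 < delta ^+ m by rewrite exprn_gt0//; case/andP: d01.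
have /andP[f0 f1] := pmixture_box d01 s x h; have {}f0 := lt_le_trans dm f0.
rewrite /score expr_div_n ler_pdivlMr ?exprn_gt0//.
by rewrite ler_piMr ?sqr_ge0// exprn_ile1// ltW.
Qed.

(** As [mixture] is affine in the prevalence, shifting it by [t] multiplies each mixture by exactly
    1 + t score, which is at most 2; [ln_quadratic_le] with K = 2 gives the constant 8 = 4 K. *)
Lemma hero1_loglik_shift (mu t : R) alpha beta :
  in_box delta (Params mu alpha beta) -> `|t| < delta ->
  hero1_loglik alpha beta z a (mu + t) - hero1_loglik alpha beta z a mu <=
  t * (\sum_(i < n) score (Params mu alpha beta) (z i) (a i)) -
  t ^+ 2 / 8 * (\sum_(i < n) score (Params mu alpha beta) (z i) (a i) ^+ 2).
Proof.
move=> h td; set th := Params mu alpha beta in h *.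
rewrite /hero1_loglik -sumrB !big_distrr -sumrB /=; apply: ler_sum => i _.
have dm : 0 < delta ^+ m by rewrite exprn_gt0//; case/andP: d01.
have /andP[f0 _] := pmixture_box d01 (z i) (a i) h; have {}f0 := lt_le_trans dm f0.
have st : `|t * score th (z i) (a i)| < 1.
  have d0 : 0 < delta by case/andP: d01.
  rewrite normrM; apply: (@le_lt_trans _ _ (`|t| * delta^-1)).
    by rewrite ler_wpM2l// score_le.
  by rewrite ltr_pdivrMr// mul1r.
move: st; rewrite ltr_norml => st.
have e : mixture (mu + t) alpha beta (z i) (a i) =
    pmixture th (z i) (a i) * (1 + t * score th (z i) (a i)).
  rewrite mulrDr mulr1 /score mulrCA (mulrC (pmixture _ _ _)) divfK ?gt_eqF//.
  by rewrite /pmixture /contrast /mixture /=; ring.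
have s0 : 0 < 1 + t * score th (z i) (a i) <= 2 by lra.
rewrite e lnM ?posrE//; last by case/andP: s0.
rewrite -/(pmixture th (z i) (a i)) addrAC subrr add0r.
have := @ln_quadratic_le R 2 _ (ltac:(lra)) s0.
rewrite (addrC 1) addrK; move=> /le_trans; apply.
by rewrite le_eqVlt; apply/orP; left; apply/eqP; field.
Qed.

(** [th0] will carry the true reliabilities and [th] the fitted ones. Slope and curvature at [th]
    are those at [th0] up to multiples of n [pdist]; the last hypothesis makes the curvature term
    beat the slope at distance [t]. *)
Lemma hero1_close (mu t B K : R) alpha beta alpha0 beta0 :
  let th := Params mu alpha beta in
  let th0 := Params mu alpha0 beta0 in
  in_box delta th -> in_box delta th0 -> 0 < t < delta ->
  `|\sum_(i < n) score th0 (z i) (a i)| <= B ->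
  K <= \sum_(i < n) contrast th0 (z i) (a i) ^+ 2 ->
  B + 2 / (delta ^+ m) ^+ 2 * n%:R * pdist th th0
    < t / 8 * (K - 2 * n%:R * pdist th th0) ->
  `|hero1 alpha beta z a - mu| <= t.
Proof.
move=> th th0 h h0 t01 hB hK key.
have mub : delta <= mu <= 1 - delta by case: h.
have D0 := pdist_ge0 th th0.
have S1 : `|\sum_(i < n) score th (z i) (a i)| <=
    B + 2 / (delta ^+ m) ^+ 2 * n%:R * pdist th th0.
  rewrite -[X in `|X|](subrK (\sum_(i < n) score th0 (z i) (a i))) addrC.
  apply: (le_trans (ler_normD _ _)); apply: lerD => //.
  rewrite -sumrB; apply: (le_trans (ler_norm_sum _ _ _)).
  apply: (le_trans (ler_sum _ (fun i _ => score_lip (z i) (a i) h h0))).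
  by rewrite sumr_const card_ord -[leLHS]mulr_natr mulrAC.
have S2 : K - 2 * n%:R * pdist th th0 <= \sum_(i < n) score th (z i) (a i) ^+ 2.
  apply: (@le_trans _ _ (\sum_(i < n) (contrast th0 (z i) (a i) ^+ 2 - 2 * pdist th th0))).
    by rewrite sumrB sumr_const card_ord -[X in _ <= _ - X]mulr_natr mulrAC; lra.
  (* For a and b in [-1, 1], a ^ 2 >= b ^ 2 - 2 |a - b|. *)
  apply: ler_sum => i _; apply: le_trans (contrast_sqr_le_score _ _ h).
  have := contrast_lip (z i) (a i) h h0; have := contrast_le1 (z i) (a i) h.
  have := contrast_le1 (z i) (a i) h0; rewrite !ler_norml => *; nra.
have neg s : `|s| = t -> hero1_loglik alpha beta z a (mu + s) < hero1_loglik alpha beta z a mu.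
  move=> st; rewrite -subr_lt0; apply: le_lt_trans (hero1_loglik_shift h _) _.
    by rewrite st; case/andP: t01.
  rewrite -/th; have -> : s ^+ 2 = t ^+ 2 by rewrite -st real_normK ?num_real.
  have k1 : s * \sum_(i < n) score th (z i) (a i) <=
    t * (B + 2 / (delta ^+ m) ^+ 2 * n%:R * pdist th th0).
    apply: (le_trans (ler_norm _)); rewrite normrM st ler_wpM2l//; lra.
  have k2 := ler_wpM2l (_ : 0 <= t ^+ 2 / 8) S2.
  have {}k2 := k2 ltac:(by rewrite divr_ge0 ?sqr_ge0).
  have t0 : 0 < t by lra.
  move: key; rewrite -(ltr_pM2l t0) => key; lra.
apply: (@hero1_localized delta) => //; try (move: d01 => d; lra).
  by apply: neg; rewrite normrN gtr0_norm; lra.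
by apply: neg; rewrite gtr0_norm; lra.
Qed.

End hero.

(** * Accuracy of the historical fit *)

Section history.
Context {R : realType} {m N : nat}.
Variables (y r : 'I_N -> bool) (z a : 'I_N -> 'I_m -> bool).
Variables (delta kappa K : R).
Hypotheses (d01 : 0 < delta <= 2^-1) (kappa_gt0 : 0 < kappa) (K_gt0 : 0 < K).
Variables (mut : R) (alpha beta : 'I_m -> R).
Let th := Params mut alpha beta.
Hypothesis th_box : in_box delta th.

Let pos := @gold_pos R N y r.
Let neg := @gold_neg R N y r.
Let th1 := @gold_init R m N y r z a delta.
Let sqN : R := Num.sqrt N%:R.

(** The good event, on which the analysis of the fit is deterministic: counts of order N, residual
    sums of order sqrt N, a bounded chi-square statistic. *)
Hypotheses (N_gt0 : (0 < N)%N)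
  (routed_ge : kappa * N%:R <= \sum_i (r i)%:R)
  (pos_ge : forall j, kappa * N%:R <= votes a pos j)
  (neg_ge : forall j, kappa * N%:R <= votes a neg j)
  (prev_close : `|\sum_i (r i)%:R * ((y i)%:R - mut)| <= K * sqN)
  (sens_close : forall j,
     `|\sum_i (a i j)%:R * pos i * ((z i j)%:R - alpha j)| <= K * sqN)
  (spec_close : forall j,
     `|\sum_i (a i j)%:R * neg i * (1 - (z i j)%:R - beta j)| <= K * sqN)
  (chi_le : chi_square r z a th <= K ^+ 2).

Let sqN_gt0 : 0 < sqN.
Proof. by rewrite sqrtr_gt0 ltr0n. Qed.

Let sqNE : N%:R = sqN ^+ 2.
Proof. by rewrite sqr_sqrtr ?ler0n. Qed.

Let ratio_close (A V x : R) : kappa * N%:R <= V -> `|A - V * x| <= K * sqN ->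
  `|A / V - x| <= K / kappa / sqN.
Proof.
move=> hV hA; have V0 : 0 < V by rewrite (lt_le_trans _ hV)// mulr_gt0// ltr0n.
rewrite (_ : A / V - x = (A - V * x) / V); last by field; rewrite gt_eqF.
rewrite normrM normfV (gtr0_norm V0) ler_pdivrMr//.
apply: (le_trans hA); apply: (@le_trans _ _ (K / kappa / sqN * (kappa * N%:R))).
  by rewrite sqNE le_eqVlt; apply/orP; left; apply/eqP; field; rewrite !gt_eqF.
by rewrite ler_wpM2l// !divr_ge0// ltW.
Qed.

Let init_sens j : `|sensitivity th1 j - alpha j| <= K / kappa / sqN.
Proof.
rewrite /th1 gold_initE /=; have [_ al _] := th_box.
apply: (le_trans (clip_contract _ (al j))); apply: ratio_close => //.
apply: le_trans (sens_close j); rewrite le_eqVlt; apply/orP; left; apply/eqP; congr (`|_|).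
by rewrite /hits /votes big_distrl -sumrB; apply: eq_bigr => i _ /=; rewrite -mulrBr.
Qed.

Let init_spec j : `|specificity th1 j - beta j| <= K / kappa / sqN.
Proof.
rewrite /th1 gold_initE /=; have [_ _ be] := th_box.
apply: (le_trans (clip_contract _ (be j))); apply: ratio_close => //.
apply: le_trans (spec_close j); rewrite le_eqVlt; apply/orP; left; apply/eqP; congr (`|_|).
by rewrite /misses /votes big_distrl -sumrB; apply: eq_bigr => i _ /=; rewrite -mulrBr.
Qed.

Let init_prev : `|prevalence th1 - mut| <= K / kappa / sqN.
Proof.
rewrite /th1 gold_initE /=; have [mub _ _] := th_box.
apply: (le_trans (clip_contract _ mub)).
have -> : \sum_i gold_pos y r i + \sum_i gold_neg y r i = \sum_i (r i)%:R :> R.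
  rewrite -big_split; apply: eq_bigr => i _ /=; rewrite /gold_pos /gold_neg.
  by case: (r i); case: (y i); rewrite /= ?addr0 ?add0r.
apply: ratio_close => //.
apply: le_trans prev_close; rewrite le_eqVlt; apply/orP; left; apply/eqP; congr (`|_|).
rewrite big_distrl -sumrB; apply: eq_bigr => i _ /=; rewrite mulrBr; congr (_ - _).
by rewrite /gold_pos; case: (r i); case: (y i); rewrite /= ?mulr1 ?mulr0.
Qed.

(** One error K / kappa / sqrt N for each of the 2 m + 1 parameters. *)
Definition init_rate : R := (2 * m%:R + 1) * (K / kappa).

Let init_pdist : pdist th1 th <= init_rate / sqN.
Proof.
have -> : init_rate / sqN = K / kappa / sqN + m%:R * (K / kappa / sqN)
   + m%:R * (K / kappa / sqN) by rewrite /init_rate; field; rewrite !gt_eqF.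
have c (f : 'I_m -> R) : (forall j, f j <= K / kappa / sqN) ->
    \sum_j f j <= m%:R * (K / kappa / sqN).
  move=> hf; rewrite -[m in m%:R]card_ord -sum1_card natr_sum big_distrl /=.
  by apply: ler_sum => j _; rewrite mul1r.
by rewrite /pdist; apply: lerD; [apply: lerD|]; [exact: init_prev|exact: c|exact: c].
Qed.

(** The x with (delta / 4) kappa x ^ 2 = C, where C bounds the gain on unrouted instances: sqrt N
    times the distance of a fitted reliability to its initial value. *)
Definition em_rate : R :=
  Num.sqrt (2 / delta ^+ m * (K ^+ 2 + 2 ^+ m * init_rate ^+ 2) / (delta / 4 * kappa)).

(** For each of the 2 m reliabilities: from the fit to the initialization, then to the truth. *)
Definition history_rate : R := 2 * m%:R * (em_rate + K / kappa).

(** Both sides carry the same prevalence [mu], since only the reliabilities pass to the current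
    data. *)
Lemma history_close (mu eps : R) :
  let fit := gold_anchored_em y r z a delta eps in
  pdist (Params mu (sensitivity fit) (specificity fit)) (Params mu alpha beta)
    <= history_rate / sqN.
Proof.
cbv zeta; set fit := gold_anchored_em _ _ _ _ _ _.
have dm : 0 < delta ^+ m by rewrite exprn_gt0//; case/andP: d01.
have fit_box : in_box delta fit := gold_anchored_em_box _ _ d01 _ _ _.
have th1_box : in_box delta th1 := gold_init_box _ _ d01 _ _.
have D0 := pdist_ge0 th1 th.
have rate0 : 0 <= init_rate.
  have Kk : 0 <= K / kappa by rewrite divr_ge0// ltW.
  by rewrite /init_rate mulr_ge0// addr_ge0// mulr_ge0.
have gap := em_gold_gap z a d01 y r eps; rewrite -/fit -/th1 -/pos -/neg in gap.
have {}gap := le_trans gap (mixture_gap_chi_square r z a d01 fit_box th1_box th_box).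
set C := 2 / delta ^+ m * (K ^+ 2 + 2 ^+ m * init_rate ^+ 2).
(* The recentring cost N [pdist] ^ 2 is at most [init_rate] ^ 2, so [C] does not grow with N. *)
have {}gap : delta / 4 * \sum_(j < m)
    (votes a pos j * (sensitivity fit j - sensitivity th1 j) ^+ 2 +
     votes a neg j * (specificity fit j - specificity th1 j) ^+ 2) <= C.
  apply: (le_trans gap); rewrite /C ler_wpM2l ?divr_ge0 ?(ltW dm)//; apply: lerD => //.
  rewrite -mulrA ler_wpM2l ?exprn_ge0// sqNE -exprMn.
  have hD : sqN * pdist th1 th <= init_rate by rewrite mulrC -ler_pdivlMr.
  by rewrite lerXn2r ?nnegrE// mulr_ge0// ltW.
have d4 : 0 < delta / 4 by move: d01 => d; lra.
have kN : 0 < kappa * N%:R by rewrite mulr_gt0 ?ltr0n.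
have pos0 j : 0 <= votes a pos j by rewrite (le_trans (ltW kN)).
have neg0 j : 0 <= votes a neg j by rewrite (le_trans (ltW kN)).
have each j : votes a pos j * (sensitivity fit j - sensitivity th1 j) ^+ 2 +
     votes a neg j * (specificity fit j - specificity th1 j) ^+ 2 <= C / (delta / 4).
  rewrite ler_pdivlMr// mulrC; apply: le_trans gap; rewrite ler_wpM2l ?(ltW d4)//.
  rewrite (bigD1 j)//= lerDl; apply: sumr_ge0 => k _.
  by rewrite addr_ge0// mulr_ge0 ?sqr_ge0.
have rate x V : kappa * N%:R <= V -> V * x ^+ 2 <= C / (delta / 4) -> `|x| <= em_rate / sqN.
  move=> hV hx; rewrite ler_pdivlMr// /em_rate -/C.
  rewrite -[`|x| * sqN](ger0_norm) ?mulr_ge0 ?(ltW sqN_gt0)// -sqrtr_sqr ler_wsqrtr//.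
  rewrite exprMn real_normK ?num_real// -sqNE invfM mulrA ler_pdivlMr//.
  by apply: le_trans hx; rewrite -mulrA mulrC (mulrC N%:R) ler_wpM2r ?sqr_ge0.
have tri (x x1 x0 : R) : `|x - x1| <= em_rate / sqN -> `|x1 - x0| <= K / kappa / sqN ->
    `|x - x0| <= (em_rate + K / kappa) / sqN.
  move=> h1 h2; rewrite mulrDl (_ : x - x0 = (x - x1) + (x1 - x0)); last ring.
  by apply: (le_trans (ler_normD _ _)); exact: lerD.
have c (f : 'I_m -> R) : (forall j, f j <= (em_rate + K / kappa) / sqN) ->
    \sum_j f j <= m%:R * ((em_rate + K / kappa) / sqN).
  move=> hf; rewrite -[m in m%:R]card_ord -sum1_card natr_sum big_distrl /=.
  by apply: ler_sum => j _; rewrite mul1r.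
have -> : history_rate / sqN = m%:R * ((em_rate + K / kappa) / sqN) +
   m%:R * ((em_rate + K / kappa) / sqN) by rewrite /history_rate; field; rewrite !gt_eqF.
rewrite /pdist /= subrr normr0 add0r; apply: lerD; apply: c => j.
  apply: (@tri _ (sensitivity th1 j)) => //; apply: (rate _ _ (pos_ge j)).
  by apply: le_trans (each j); rewrite lerDl mulr_ge0 ?sqr_ge0.
apply: (@tri _ (specificity th1 j)) => //; apply: (rate _ _ (neg_ge j)).
by apply: le_trans (each j); rewrite lerDr mulr_ge0 ?sqr_ge0.
Qed.

End history.

(** * Finite-valued random variables *)

Section finite_random_variables.
Context {R : realType} {d : measure_display} {T : measurableType d}.
Variable P : probability T R.

(** Measurability for finite-valued maps; it makes every event defined through the value measurable,
    for an arbitrary predicate. *)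
Definition measurable_fibers (V : finType) (X : T -> V) :=
  forall v, measurable [set w | X w = v].

Lemma measurable_fibers_seq (V : finType) (X : T -> V) (s : seq V) :
  measurable_fibers X -> measurable [set w | X w \in s].
Proof.
move=> mX; elim: s => [|v s IH].
  by rewrite [X in measurable X](_ : _ = set0)//; apply/seteqP; split.
rewrite [X in measurable X](_ : _ = [set w | X w = v] `|` [set w | X w \in s]).
  exact: measurableU.
apply/seteqP; split => w /=; rewrite inE.
  by case/orP => [/eqP|]; [left|right].
by case=> [->|->]; rewrite ?eqxx ?orbT.
Qed.

Lemma measurable_fibers_set (V : finType) (X : T -> V) (Q : V -> Prop) :
  measurable_fibers X -> measurable [set w | Q (X w)].
Proof.
move=> mX.
rewrite [X in measurable X](_ : _ = [set w | X w \in enum [pred v | `[<Q v>]]]).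
  exact: measurable_fibers_seq.
by apply/seteqP; split => w /=; rewrite mem_enum inE.
Qed.

Lemma measurable_fibers_pair (V W : finType) (X : T -> V) (Y : T -> W) :
  measurable_fibers X -> measurable_fibers Y ->
  measurable_fibers (fun w => (X w, Y w)).
Proof.
move=> mX mY [v v'].
rewrite [X in measurable X](_ : _ = [set w | X w = v] `&` [set w | Y w = v']).
  exact: measurableI.
by apply/seteqP; split => w /= [-> ->].
Qed.

Lemma measurable_fibers_ffun (I V : finType) (X : I -> T -> V) :
  (forall i, measurable_fibers (X i)) ->
  measurable_fibers (fun w => [ffun i => X i w]).
Proof.
move=> mX v.
rewrite [X in measurable X](_ : _ = \bigcap_(i in [set: I]) [set w | X i w = v i]).
  by apply: fin_bigcap_measurable => // i _; exact: mX.
apply/seteqP; split => w /=; first by move=> <- i _ /=; rewrite ffunE.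
by move=> h; apply/ffunP => i; rewrite ffunE; exact: h.
Qed.

Lemma measurable_fibers_RV (X : {RV P >-> bool}) : measurable_fibers X.
Proof. by move=> v; have := measurable_funPT X measurableT [set v] I; rewrite setTI. Qed.

Lemma pr_ge0 A : 0 <= pr P A.
Proof. by rewrite /pr fine_ge0. Qed.

Lemma pr_setT : pr P setT = 1.
Proof. by rewrite /pr probability_setT. Qed.

Lemma prU A B : measurable A -> measurable B -> A `&` B = set0 ->
  pr P (A `|` B) = pr P A + pr P B.
Proof.
by move=> mA mB AB; rewrite /pr measureU// fineD ?fin_num_measure.
Qed.

Lemma le_pr A B : measurable A -> measurable B -> A `<=` B -> pr P A <= pr P B.
Proof.
move=> mA mB AB; rewrite /pr fine_le ?fin_num_measure//.
by apply: le_measure => //; rewrite inE.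
Qed.

Lemma pr_sub_setU A B C : measurable A -> measurable B -> measurable C ->
  A `<=` B `|` C -> pr P A <= pr P B + pr P C.
Proof.
move=> mA mB mC ABC.
have mCB : measurable (C `\` B) by exact: measurableD.
apply: (@le_trans _ _ (pr P (B `|` (C `\` B)))).
  apply: le_pr => //; first exact: measurableU.
  by move=> w /ABC [?|?]; [left|have [?|?] := pselect (B w); [left|right]].
rewrite prU//; last by apply/seteqP; split => // w [? []].
by rewrite lerD2l; apply: le_pr => // w [].
Qed.

Lemma pr_finite_sum (V : finType) (X : T -> V) (Q : pred V) :
  measurable_fibers X ->
  pr P [set w | Q (X w)] = \sum_(v | Q v) pr P [set w | X w = v].
Proof.
move=> mX; rewrite -big_enum /=.
rewrite [X in pr P X](_ : _ = [set w | X w \in enum Q]); last first.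
  by apply/seteqP; split => w /=; rewrite mem_enum.
elim: (enum Q) (enum_uniq Q) => [_|v s IH /= /andP[vs us]].
  rewrite big_nil [X in pr P X](_ : _ = set0) /pr ?measure0//.
  by apply/seteqP; split.
rewrite big_cons -IH// -prU//; last first.
- apply/seteqP; split => // w /= [-> ]; by rewrite (negbTE vs).
- exact: measurable_fibers_seq.
congr pr; apply/seteqP; split => w /=; rewrite inE.
  by case/orP => [/eqP|]; [left|right].
by case=> [->|->]; rewrite ?eqxx ?orbT.
Qed.

Lemma sum_pr1 (V : finType) (X : T -> V) : measurable_fibers X ->
  \sum_v pr P [set w | X w = v] = 1.
Proof.
move=> mX; rewrite -(pr_finite_sum predT mX) -pr_setT; congr pr.
by apply/seteqP; split.
Qed.

Lemma pr_markov (V : finType) (X : T -> V) (f : V -> R) (K : R) :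
  measurable_fibers X -> (forall v, 0 <= f v) -> 0 < K ->
  pr P [set w | K < f (X w)] <= (\sum_v pr P [set w | X w = v] * f v) / K.
Proof.
move=> mX f0 K0; rewrite (pr_finite_sum (fun v => K < f v) mX).
rewrite ler_pdivlMr// big_distrl /= [leLHS]big_mkcond /=; apply: ler_sum => v _.
case: ifP => [Kf|_]; last by rewrite mulr_ge0 ?pr_ge0.
by rewrite ler_wpM2l ?pr_ge0// ltW.
Qed.

Lemma pr_exists_le (V I : finType) (X : T -> V) (Q : I -> pred V) :
  measurable_fibers X ->
  pr P [set w | [exists i, Q i (X w)]] <= \sum_i pr P [set w | Q i (X w)].
Proof.
move=> mX; rewrite (pr_finite_sum (fun v => [exists i, Q i v]) mX).
under [leRHS]eq_bigr do rewrite (pr_finite_sum _ mX) big_mkcond /=.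
rewrite exchange_big /= big_mkcond /=; apply: ler_sum => v _.
have nn i : 0 <= (if Q i v then pr P [set w | X w = v] else 0).
  by case: ifP => // _; exact: pr_ge0.
case: existsP => [[i Qi]|_]; last by apply: sumr_ge0.
by rewrite (bigD1 i)//= Qi lerDl sumr_ge0.
Qed.

Lemma pr_independent (I V : finType) (X : I -> T -> V) (v : {ffun I -> V}) :
  mutually_independent P X ->
  pr P [set w | [ffun i => X i w] = v] = \prod_i pr P [set w | X i w = v i].
Proof.
move=> /(_ (fun i => [set v i]%SET)).
rewrite [X in pr P X = _](_ : _ = [set w | [ffun i => X i w] = v]); last first.
  apply/seteqP; split => w /= h.
    by apply/ffunP => i; rewrite ffunE; have := h i; rewrite inE => /eqP.
  by move=> i; rewrite inE -h ffunE.
move=> ->; apply: eq_bigr => i _; congr pr.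
by apply/seteqP; split => w /=; rewrite inE => /eqP.
Qed.

End finite_random_variables.

(** * Second moments under a product law *)

Section product_moments.
Context {R : realType} {I V : finType}.
Variable p : I -> V -> R.
Hypothesis p1 : forall i, \sum_v p i v = 1.

Lemma product_expectation_prod (f : I -> V -> R) :
  \sum_(v : {ffun I -> V}) (\prod_i p i (v i)) * (\prod_i f i (v i)) =
  \prod_i \sum_x p i x * f i x.
Proof.
rewrite (bigA_distr_bigA (fun i x => p i x * f i x)).
by apply: eq_bigr => v _; rewrite big_split.
Qed.

Lemma product_variance (g : I -> V -> R) :
  (forall i, \sum_v p i v * g i v = 0) ->
  \sum_(v : {ffun I -> V}) (\prod_i p i (v i)) * (\sum_i g i (v i)) ^+ 2 =
  \sum_i \sum_x p i x * g i x ^+ 2.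
Proof.
move=> g0.
(* Writes g i * g j as a product over all coordinates, so that its expectation factors; for i = j
   both factors fall on the same coordinate. *)
pose h i j k x : R := (if k == i then g i x else 1) * (if k == j then g j x else 1).
have hE i j (v : {ffun I -> V}) : g i (v i) * g j (v j) = \prod_k h i j k (v k).
  rewrite big_split /=; congr (_ * _).
    by rewrite (bigD1 i)//= eqxx big1 ?mulr1// => k /negbTE ->.
  by rewrite (bigD1 j)//= eqxx big1 ?mulr1// => k /negbTE ->.
transitivity (\sum_i \sum_j \sum_(v : {ffun I -> V})
    (\prod_i p i (v i)) * \prod_k h i j k (v k)).
  under [RHS]eq_bigr do rewrite exchange_big /=.
  rewrite [RHS]exchange_big /=; apply: eq_bigr => v _.
  rewrite expr2 big_distrl big_distrr /=; apply: eq_bigr => i _.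
  rewrite !big_distrr /=; apply: eq_bigr => j _.
  by rewrite hE.
apply: eq_bigr => i _; rewrite (bigD1 i)//= [X in _ + X]big1 ?addr0.
  rewrite product_expectation_prod (bigD1 i)//= [X in _ * X]big1 ?mulr1.
    by apply: eq_bigr => x _; rewrite /h eqxx expr2.
  move=> k ki; rewrite -[RHS](p1 k); apply: eq_bigr => x _.
  by rewrite /h (negbTE ki) !mulr1.
move=> j ji; rewrite product_expectation_prod (bigD1 i)//= [X in X * _](_ : _ = 0) ?mul0r//.
rewrite -[RHS](g0 i); apply: eq_bigr => x _.
by rewrite /h eqxx eq_sym (negbTE ji) mulr1.
Qed.

End product_moments.

(** * Chebyshev's inequality for independent instances *)

Section chebyshev.
Context {R : realType} {d : measure_display} {T : measurableType d}.
Variables (P : probability T R) (N : nat) (V : finType) (X : 'I_N -> T -> V).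
Hypotheses (mX : forall i, measurable_fibers (X i)) (iX : mutually_independent P X).

Definition mean (i : 'I_N) (g : V -> R) : R := \sum_v pr P [set w | X i w = v] * g v.

Lemma mean_le (i : 'I_N) (g : V -> R) b : (forall v, `|g v| <= b) -> `|mean i g| <= b.
Proof.
move=> gb; apply: (le_trans (ler_norm_sum _ _ _)).
rewrite -[leRHS]mul1r -(sum_pr1 P (mX i)) big_distrl /=; apply: ler_sum => v _.
by rewrite normrM ger0_norm ?pr_ge0// ler_wpM2l ?pr_ge0.
Qed.

(** A centred value is at most 2 b in absolute value, whence the variance bound 4 b ^ 2. Means may
    vary with the instance. *)
Lemma pr_deviation (g : V -> R) (b K : R) : (forall v, `|g v| <= b) -> 0 < K ->
  pr P [set w | K < `|\sum_i (g (X i w) - mean i g)|] <= 4 * b ^+ 2 * N%:R / K ^+ 2.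
Proof.
move=> gb K0.
pose D w := [ffun i => X i w].
have mD : measurable_fibers D := measurable_fibers_ffun mX.
pose F (v : {ffun 'I_N -> V}) : R := (\sum_i (g (v i) - mean i g)) ^+ 2.
rewrite [X in pr P X](_ : _ = [set w | K ^+ 2 < F (D w)]); last first.
  apply/funext => w; apply/propext; rewrite /= /F.
  rewrite -[X in _ <-> is_true (_ < X)]real_normK ?num_real//.
  rewrite ltr_pXn2r ?nnegrE ?(ltW K0)//.
  by under [in X in _ <-> X]eq_bigr do rewrite ffunE.
apply: (le_trans (pr_markov P mD _ _)); [by move=> v; exact: sqr_ge0|exact: exprn_gt0|].
rewrite ler_pM2r ?invr_gt0 ?exprn_gt0//.
under eq_bigr do rewrite pr_independent//.
rewrite (@product_variance _ _ _ (fun i v => pr P [set w | X i w = v]) _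
  (fun i v => g v - mean i g)); first last.
- move=> i; under eq_bigr do rewrite mulrBr.
  by rewrite sumrB -big_distrl /= (sum_pr1 P (mX i)) mul1r subrr.
- by move=> i; exact: sum_pr1.
rewrite -[N in leRHS]card_ord -sum1_card natr_sum big_distrr /=.
apply: ler_sum => i _.
have -> : 4 * b ^+ 2 * 1 = (\sum_v pr P [set w | X i w = v]) * (4 * b ^+ 2).
  by rewrite (sum_pr1 P (mX i)) mulr1 mul1r.
rewrite big_distrl /=.
apply: ler_sum => v _; rewrite ler_wpM2l ?pr_ge0//.
have := gb v; have := mean_le i gb; rewrite !ler_norml => h1 h2.
rewrite -subr_ge0 (_ : 4 * b ^+ 2 - _ = (2 * b - (g v - mean i g)) * (2 * b + (g v - mean i g)));
  last ring.
by rewrite mulr_ge0//; lra.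
Qed.

End chebyshev.

(** * The law of one instance *)

Section label_law.
Context {R : realType} {m : nat}.
Local Notation pattern := {ffun 'I_m -> bool}.
Variables (mu : R) (alpha beta : 'I_m -> R).
Let th := Params mu alpha beta.

(** Law of the gold label together with all potential silver labels, available or not. *)
Definition label_law (l : bool * pattern) : R :=
  if l.1 then mu * lik1 alpha l.2 xpredT else (1 - mu) * lik0 beta l.2 xpredT.

Lemma sum_label_lawE (f : bool * pattern -> R) :
  \sum_l label_law l * f l =
  mu * (\sum_(z : pattern) lik1 alpha z xpredT * f (true, z)) +
  (1 - mu) * (\sum_(z : pattern) lik1 (fun j => 1 - beta j) z xpredT * f (false, z)).
Proof.
transitivity (\sum_y \sum_z label_law (y, z) * f (y, z)).
  by rewrite pair_bigA /=; apply: eq_bigr => -[].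
rewrite big_bool /=.
rewrite !big_distrr; congr (_ + _); apply: eq_bigr => z _; rewrite /label_law /= ?lik0E;
  by rewrite mulrA.
Qed.

Lemma sum_label_law_pattern (f : pattern -> R) :
  \sum_l label_law l * f l.2 =
  \sum_(z : pattern) pmixture th z xpredT * f z.
Proof.
rewrite sum_label_lawE !big_distrr -big_split /=; apply: eq_bigr => z _.
by rewrite /pmixture /mixture lik0E !mulrDl !mulrA.
Qed.

Lemma sum_label_law : \sum_l label_law l = 1.
Proof.
transitivity (\sum_l label_law l * 1); first by apply: eq_bigr => l _; rewrite mulr1.
have e p : \sum_(z : pattern) lik1 p z xpredT * 1 = 1 :> R.
  by rewrite -big_distrl /= sum_lik1 mulr1.
by rewrite (sum_label_lawE (fun=> 1)) !e !mulr1 addrC subrK.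
Qed.

Lemma sum_lik1_coord (p : 'I_m -> R) (j : 'I_m) (h : bool -> R) :
  \sum_(z : pattern) lik1 p z xpredT * h (z j) = p j * h true + (1 - p j) * h false.
Proof.
transitivity (\sum_(z : pattern) \prod_k (bern (p k) (z k) * (if k == j then h (z k) else 1))).
  apply: eq_bigr => z _; rewrite lik1E [RHS]big_split /=; congr (_ * _).
  by rewrite (bigD1 j)//= eqxx big1 ?mulr1// => k /negbTE ->.
rewrite -(bigA_distr_bigA (fun k b => bern (p k) b * (if k == j then h b else 1))).
rewrite (bigD1 j)//= [X in _ * X]big1 ?mulr1; first by rewrite big_bool !bernE eqxx.
by move=> k /negbTE kj; rewrite big_bool !bernE kj /= !mulr1 addrC subrK.
Qed.

Lemma sum_lik1_observable (p : 'I_m -> R) (a : 'I_m -> bool) :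
  \sum_(z : pattern | observable a z) lik1 p z a = 1.
Proof.
transitivity (\sum_(z : pattern | observable a z) lik1 p z a * 1).
  by apply: eq_bigr => z _; rewrite mulr1.
by rewrite -(sum_lik1_obs p a (fun=> 1)) -big_distrl /= sum_lik1 mulr1.
Qed.

Variable delta : R.
Hypotheses (d01 : 0 < delta <= 2^-1) (th_box : in_box delta th).

Lemma label_law_ge0 l : 0 <= label_law l.
Proof.
have [mu01 al be] := box01 d01 th_box; rewrite /= in mu01 al be.
rewrite /label_law; case: l.1; (apply: mulr_ge0; first by move: mu01 => /=; lra).
  by apply: lik1_ge0 => j; have := al j => /=; lra.
by rewrite lik0E; apply: lik1_ge0 => j; have := be j => /=; lra.
Qed.

(** On visible patterns [pmixture] times [score] is [contrast], a difference of two probability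
    laws. *)
Lemma sum_label_law_score (a : 'I_m -> bool) :
  \sum_l label_law l * score th l.2 a = 0.
Proof.
have dm : 0 < delta ^+ m by rewrite exprn_gt0//; case/andP: d01.
rewrite (sum_label_law_pattern (fun z => score th z a)).
transitivity (\sum_(z : pattern) pmixture th z xpredT * score th (obs z a) a).
  by apply: eq_bigr => z _; rewrite score_obs.
rewrite (sum_mixture_obs mu alpha beta a (fun z => score th z a)).
transitivity (\sum_(z : pattern | observable a z) contrast th z a).
  apply: eq_bigr => z _; rewrite /score mulrC divfK// gt_eqF//.
  by have /andP[h _] := pmixture_box d01 z a th_box; exact: lt_le_trans h.
rewrite sumrB sum_lik1_observable.
under eq_bigr do rewrite lik0E.
by rewrite sum_lik1_observable subrr.
Qed.

(** Quantitative identifiability: two patterns that differ only at [j] cannot both have a small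
    contrast when alpha j + beta j is away from 1, and each pattern has probability at least
    [delta ^+ m]. *)
Lemma sum_label_law_contrast (a : 'I_m -> bool) (j : 'I_m) : a j ->
  delta ^+ m * ((delta ^+ m * (alpha j + beta j - 1)) ^+ 2 / 2) <=
  \sum_l label_law l * contrast th l.2 a ^+ 2.
Proof.
move=> aj; have dm : 0 < delta ^+ m by rewrite exprn_gt0//; case/andP: d01.
have [_ al be] := box01 d01 th_box; rewrite /= in al be.
rewrite (sum_label_law_pattern (fun z => contrast th z a ^+ 2)).
pose z1 : pattern := [ffun=> true]; pose z0 : pattern := [ffun k => k != j].
have z10 : z0 != z1 by apply/eqP => /ffunP/(_ j); rewrite !ffunE eqxx.
have terms : contrast th z1 a ^+ 2 + contrast th z0 a ^+ 2 <=
    \sum_(z : pattern) contrast th z a ^+ 2.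
  rewrite (bigD1 z1)//= lerD2l (bigD1 z0)//= lerDl; apply: sumr_ge0 => z _.
  exact: sqr_ge0.
apply: (@le_trans _ _ (delta ^+ m * \sum_(z : pattern) contrast th z a ^+ 2)); last first.
  rewrite big_distrr /=; apply: ler_sum => z _; rewrite ler_wpM2r ?sqr_ge0//.
  by have /andP[] := pmixture_box d01 z xpredT th_box.
rewrite ler_wpM2l ?(ltW dm)//; apply: le_trans terms.
have split_j p (z : pattern) : (forall k, k != j -> z k) ->
    lik1 p z a = bern (p j) (z j) * \prod_(k < m | a k && (k != j)) p k.
  move=> hz; rewrite lik1E (bigD1 j)//=; congr (_ * _); apply: eq_bigr => k /andP[_ kj].
  by rewrite bernE hz.
pose A := \prod_(k < m | a k && (k != j)) alpha k.
pose B := \prod_(k < m | a k && (k != j)) (1 - beta k).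
have c1 : contrast th z1 a = alpha j * A - (1 - beta j) * B.
  by rewrite /contrast lik0E !split_j ?bernE ?ffunE// => k; rewrite ffunE.
have c0 : contrast th z0 a = (1 - alpha j) * A - beta j * B.
  rewrite /contrast lik0E !split_j ?bernE ?ffunE ?eqxx /= ?subKr//;
  by move=> k kj; rewrite ffunE.
have A1 : delta ^+ m <= A.
  have /= /andP[h _] := lik1_box d01 z1 (fun k => a k && (k != j)) th_box.
  apply: (le_trans h); rewrite lik1E le_eqVlt; apply/orP; left; apply/eqP.
  by apply: eq_bigr => k _; rewrite bernE ffunE.
(* This combination eliminates [B]. *)
have comb : beta j * contrast th z1 a - (1 - beta j) * contrast th z0 a =
    A * (alpha j + beta j - 1) by rewrite c1 c0; ring.
set x1 := contrast th z1 a in comb *; set x0 := contrast th z0 a in comb *.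
have AD : (delta ^+ m * (alpha j + beta j - 1)) ^+ 2 <= (A * (alpha j + beta j - 1)) ^+ 2.
  rewrite !exprMn ler_wpM2r ?sqr_ge0// lerXn2r ?nnegrE// ?(ltW dm)//.
  exact: (le_trans (ltW dm) A1).
rewrite -comb in AD.
rewrite ler_pdivrMr//; apply: (le_trans AD).
have bj := be j.
have e1 : beta j ^+ 2 <= 1 by rewrite exprn_ile1//; lra.
have e0 : (1 - beta j) ^+ 2 <= 1 by rewrite exprn_ile1//; lra.
have := ler_wpM2r (sqr_ge0 x1) e1; have := ler_wpM2r (sqr_ge0 x0) e0.
(* The squares of difference and sum add up to at most 2 (x1 ^ 2 + x0 ^ 2); hence the division by
   2. *)
have := sqr_ge0 (beta j * x1 + (1 - beta j) * x0).
nra.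
Qed.

End label_law.

Section single_instance.
Context {R : realType} {d : measure_display} {T : measurableType d} {m : nat}.
Variables (P : probability T R) (G : {RV P >-> bool}) (S : 'I_m -> {RV P >-> bool}).
Variables (mu : R) (alpha beta : 'I_m -> R).
Hypotheses (mu01 : 0 < mu < 1)
  (mean_G : ('E_P[fun w => (G w)%:R%R])%E = mu%:E)
  (sens : forall j, cond_pr P [set w | S j w = true] [set w | G w = true] = alpha j)
  (spec : forall j, cond_pr P [set w | S j w = false] [set w | G w = false] = beta j)
  (indep : forall (z : 'I_m -> bool) (y : bool),
    cond_pr P [set w | forall j, S j w = z j] [set w | G w = y]
    = \prod_(j < m) cond_pr P [set w | S j w = z j] [set w | G w = y]).

Let mG := measurable_fibers_RV G.
Let mS j := measurable_fibers_RV (S j).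

Let pr_gold y : pr P [set w | G w = y] = if y then mu else 1 - mu.
Proof.
have pt : pr P [set w | G w = true] = mu.
  rewrite /pr -(expectation_indic _ (mG true)) -[RHS]/(fine mu%:E) -mean_G.
  congr (fine ('E_P[_])); apply/funext => w; rewrite indicE.
  by rewrite (_ : w \in _ = G w)//; apply/idP/idP => [/set_mem //|Gw]; exact: mem_set.
case: y => //; have := sum_pr1 P mG; rewrite big_bool /= pt; lra.
Qed.

Let cond_silver j b y :
  cond_pr P [set w | S j w = b] [set w | G w = y] =
  bern (if y then alpha j else 1 - beta j) b.
Proof.
have y0 : pr P [set w | G w = y] != 0.
  by move: mu01 => h; rewrite pr_gold gt_eqF//; case: (y); lra.
(* The hypotheses give one label value per class; the other one has the complementary
   probability. *)
have tot : cond_pr P [set w | S j w = true] [set w | G w = y] +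
    cond_pr P [set w | S j w = false] [set w | G w = y] = 1.
  rewrite /cond_pr -mulrDl -prU; last first.
  - by apply/seteqP; split => // w [[/= -> _] [/= ]].
  - by apply: measurableI; [exact: mS|exact: mG].
  - by apply: measurableI; [exact: mS|exact: mG].
  rewrite (_ : _ `|` _ = [set w | G w = y]) ?divff//.
  apply/seteqP; split => w /=; first by case => [[]|[]].
  by case: (S j w) => ?; [left|right].
rewrite bernE; move: tot; case: y y0 => _.
  by rewrite sens; case: b; rewrite ?sens//; lra.
by rewrite spec; case: b; rewrite ?spec//; lra.
Qed.

Lemma pr_labels (l : bool * {ffun 'I_m -> bool}) :
  pr P [set w | (G w, [ffun j => S j w]) = l] = label_law mu alpha beta l.
Proof.
case: l => y z.
have y0 : pr P [set w | G w = y] != 0.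
  by move: mu01 => h; rewrite pr_gold gt_eqF//; case: (y); lra.
have -> : [set w | (G w, [ffun j => S j w]) = (y, z)] =
   [set w | forall j, S j w = z j] `&` [set w | G w = y].
  apply/seteqP; split => w /=.
    by case=> -> <-; split => // j; rewrite ffunE.
  by case=> h ->; congr pair; apply/ffunP => j; rewrite ffunE.
have := indep z y; rewrite /cond_pr => /(canRL (divfK y0)) ->.
under eq_bigr do rewrite -/(cond_pr _ _ _) cond_silver.
rewrite pr_gold mulrC /label_law /=; case: (y); first by rewrite lik1E.
by rewrite lik0E lik1E.
Qed.

End single_instance.

(** * Expectation of the chi-square statistic *)

Section chi_square_expectation.
Context {R : realType} {m N : nat}.
Local Notation pattern := {ffun 'I_m -> bool}.
Local Notation instance := (((bool * pattern) * pattern) * bool)%type.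

Definition rec_gold (v : instance) : bool := v.1.1.1.
Definition rec_silver (v : instance) : pattern := v.1.1.2.
Definition rec_avail (v : instance) : pattern := v.1.2.
Definition rec_routed (v : instance) : bool := v.2.

Lemma sum_ffun_pair (I A B : finType) (F : {ffun I -> A * B} -> R) :
  \sum_v F v = \sum_(a : {ffun I -> A}) \sum_(b : {ffun I -> B}) F [ffun i => (a i, b i)].
Proof.
rewrite pair_bigA /=.
rewrite (reindex (fun p : {ffun I -> A} * {ffun I -> B} => [ffun i => (p.1 i, p.2 i)]))//=.
exists (fun v : {ffun I -> A * B} => ([ffun i => (v i).1], [ffun i => (v i).2])).
  by move=> [a b] _ /=; congr pair; apply/ffunP => i; rewrite !ffunE.
by move=> v _; apply/ffunP => i; rewrite !ffunE; case: (v i).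
Qed.

Variables (mut : R) (alpha beta : 'I_m -> R) (delta : R).
Let th := Params mut alpha beta.
Hypotheses (d01 : 0 < delta <= 2^-1) (th_box : in_box delta th).
Variables (pa : 'I_N -> pattern -> R) (pb : 'I_N -> bool -> R).
Hypotheses (pa0 : forall i s, 0 <= pa i s) (pb0 : forall i b, 0 <= pb i b)
  (pa1 : forall i, \sum_s pa i s = 1) (pb1 : forall i, \sum_b pb i b = 1).
Let q := label_law mut alpha beta.

Let q1 (i : 'I_N) : \sum_l q l = 1. Proof. exact: sum_label_law. Qed.

Let q0 l : 0 <= q l. Proof. exact: label_law_ge0 d01 th_box l. Qed.

(** Routing and availability are fixed and only the labels are random: the centred cell count is a
    sum of [pattern_count] independent centred terms of variance at most 1. *)
Lemma cell_variance (r : 'I_N -> bool) (a : 'I_N -> 'I_m -> bool) (s x : pattern) :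
  observable s x ->
  \sum_(l : {ffun 'I_N -> bool * pattern}) (\prod_i q (l i)) *
    ((cell_count r (fun i => (l i).2) a s x - pattern_count r a s * pmixture th x s) ^+ 2
       / pattern_count r a s) <= 1.
Proof.
move=> sx; set n := pattern_count r a s.
have n0 : 0 <= n := pattern_count_ge0 _ _ _.
pose g (i : 'I_N) (l : bool * pattern) : R :=
  (unrouted_with r a s i)%:R * ((obs l.2 s == x)%:R - pmixture th x s).
have -> : \sum_(l : {ffun 'I_N -> bool * pattern}) (\prod_i q (l i)) *
    ((cell_count r (fun i => (l i).2) a s x - n * pmixture th x s) ^+ 2 / n) =
  (\sum_(l : {ffun 'I_N -> bool * pattern})
    (\prod_i q (l i)) * (\sum_i g i (l i)) ^+ 2) / n.
  rewrite [RHS]big_distrl /=; apply: eq_bigr => l _; rewrite mulrA; congr (_ * _ ^+ 2 / _).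
  rewrite /n /pattern_count /cell_count big_distrl -sumrB /=; apply: eq_bigr => i _.
  by rewrite /g mulrBr; case: (unrouted_with _ _ _ _) => /=; rewrite ?mul1r ?mul0r.
have mean0 : \sum_l q l * ((obs l.2 s == x)%:R - pmixture th x s) = 0.
  under eq_bigr do rewrite mulrBr.
  rewrite sumrB -big_distrl /= sum_label_law mul1r.
  rewrite (sum_label_law_pattern mut alpha beta (fun z : pattern => (obs z s == x)%:R)).
  rewrite (sum_mixture_obs mut alpha beta s (fun z : pattern => (z == x)%:R)).
  rewrite (bigD1 x)//= eqxx mulr1 big1 ?addr0 ?subrr// => z /andP[_ /negbTE ->].
  by rewrite mulr0.
rewrite (@product_variance _ _ _ (fun=> q) q1 g); last first.
  move=> i; transitivity ((unrouted_with r a s i)%:R *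
      \sum_l q l * ((obs l.2 s == x)%:R - pmixture th x s)); last by rewrite mean0 mulr0.
  by rewrite big_distrr /=; apply: eq_bigr => l _; rewrite /g mulrCA.
have [->|nN0] := eqVneq n 0; first by rewrite invr0 mulr0.
rewrite ler_pdivrMr ?mul1r; last by rewrite lt_def nN0.
apply: ler_sum => i _; rewrite /g; case: (unrouted_with r a s i) => /=; last first.
  by rewrite big1// => l _; rewrite mul0r expr0n mulr0.
rewrite -[leRHS](q1 i); apply: ler_sum => l _; rewrite mul1r ler_piMr//.
have dm : 0 < delta ^+ m by rewrite exprn_gt0//; case/andP: d01.
have := pmixture_box d01 x s th_box; case: (_ == x) => /= ?; nra.
Qed.

Definition rec_law (i : 'I_N) (v : instance) : R := q v.1.1 * pa i v.1.2 * pb i v.2.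

(** By randomization the labels keep their law when availability and routing are fixed, so
    [cell_variance] applies inside the sum; 4 ^ m counts 2 ^ m strata of at most 2 ^ m cells. *)
Lemma chi_square_expectation :
  \sum_(v : {ffun 'I_N -> instance}) (\prod_i rec_law i (v i)) *
    chi_square (fun i => rec_routed (v i)) (fun i => rec_silver (v i))
               (fun i => rec_avail (v i)) th <= 4 ^+ m.
Proof.
have card_pattern : #|{: pattern}| = (2 ^ m)%N by rewrite card_ffun card_bool card_ord.
rewrite sum_ffun_pair sum_ffun_pair exchange_big /=.
pose w (s : {ffun 'I_N -> pattern}) (b : {ffun 'I_N -> bool}) : R :=
  (\prod_i pa i (s i)) * \prod_i pb i (b i).
have w1 : \sum_s \sum_b w s b = 1.
  have pb_prod : \sum_(b : {ffun 'I_N -> bool}) \prod_i pb i (b i) = 1.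
    by rewrite -(bigA_distr_bigA pb) big1.
  under eq_bigr do rewrite -big_distrr /= pb_prod mulr1.
  by rewrite -(bigA_distr_bigA pa) big1.
have -> : 4 ^+ m = (\sum_s \sum_b w s b) * 4 ^+ m by rewrite w1 mul1r.
rewrite big_distrl /=; apply: ler_sum => s _.
rewrite exchange_big big_distrl /=; apply: ler_sum => b _.
have w0 : 0 <= w s b by rewrite mulr_ge0 ?prodr_ge0.
pose chi (l : {ffun 'I_N -> bool * pattern}) :=
  chi_square b (fun i => (l i).2) (fun i => s i) th.
apply: (@le_trans _ _ (w s b * \sum_(l : {ffun 'I_N -> bool * pattern})
    (\prod_i q (l i)) * chi l)).
  rewrite big_distrr /= le_eqVlt; apply/orP; left; apply/eqP; apply: eq_bigr => l _.
  rewrite mulrA; congr (_ * _).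
    rewrite /w -!big_split /=; apply: eq_bigr => i _; rewrite /rec_law !ffunE /=.
    by ring.
  rewrite /chi; congr chi_square; apply/funext => i; rewrite /rec_routed /rec_silver /rec_avail !ffunE//=.
rewrite ler_wpM2l//.
have -> : \sum_(l : {ffun 'I_N -> bool * pattern}) (\prod_i q (l i)) * chi l =
  \sum_(t : pattern) \sum_(x : pattern | observable t x)
   \sum_(l : {ffun 'I_N -> bool * pattern}) (\prod_i q (l i)) *
   ((cell_count b (fun i => (l i).2) (fun i => s i) t x -
     pattern_count b (fun i => s i) t * pmixture th x t) ^+ 2
       / pattern_count b (fun i => s i) t).
  rewrite /chi /chi_square; under eq_bigr do rewrite big_distrr /=.
  rewrite exchange_big /=; apply: eq_bigr => t _.
  under eq_bigr do rewrite big_distrr /=.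
  by rewrite exchange_big.
apply: (@le_trans _ _ (\sum_(t : pattern) \sum_(x : pattern) 1)).
  apply: ler_sum => t _; rewrite big_mkcond /=; apply: ler_sum => x _.
  by case: ifP => // tx; exact: cell_variance.
rewrite !sumr_const -mulrnA -natrX ler_nat.
by rewrite !(eq_card (B := {: pattern}))// card_pattern -expnMn.
Qed.

End chi_square_expectation.

(** * Probability bounds on the historical data *)

Section history_probability.
Context {R : realType} {m n N : nat}.
Variable E : experiment R m n N.
Local Notation P := (sample_prob E).
Local Notation pattern := {ffun 'I_m -> bool}.
Local Notation instance := (((bool * pattern) * pattern) * bool)%type.

Definition hinstance (i : 'I_N) (w : sample_space E) : instance :=
  (hlabels i w, havails i w, hrouted E i w).

Definition cinstance (i : 'I_n) (w : sample_space E) : (bool * pattern) * pattern :=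
  (labels i w, avails i w).

Lemma measurable_hinstance i : measurable_fibers (hinstance i).
Proof.
apply: measurable_fibers_pair; last exact: measurable_fibers_RV.
apply: measurable_fibers_pair.
  apply: measurable_fibers_pair; first exact: measurable_fibers_RV.
  by apply: measurable_fibers_ffun => j; exact: measurable_fibers_RV.
by apply: measurable_fibers_ffun => j; exact: measurable_fibers_RV.
Qed.

Lemma measurable_cinstance i : measurable_fibers (cinstance i).
Proof.
apply: measurable_fibers_pair.
  apply: measurable_fibers_pair; first exact: measurable_fibers_RV.
  by apply: measurable_fibers_ffun => j; exact: measurable_fibers_RV.
by apply: measurable_fibers_ffun => j; exact: measurable_fibers_RV.
Qed.

Lemma pr_independent2 (V W : finType) (X : sample_space E -> V)
    (Y : sample_space E -> W) x y : independent2 P X Y ->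
  pr P [set w | (X w, Y w) = (x, y)] = pr P [set w | X w = x] * pr P [set w | Y w = y].
Proof.
move=> /(_ [set x]%SET [set y]%SET).
have e (U : finType) (Z : sample_space E -> U) u :
    [set w | Z w \in [set u]%SET] = [set w | Z w = u].
  by apply/seteqP; split => w /=; rewrite inE => /eqP.
rewrite !e => <-; congr pr; apply/seteqP; split => w /=.
  by case=> -> ->; rewrite !inE !eqxx.
by case; rewrite !inE => /eqP -> /eqP ->.
Qed.

Variables (c pi_min rho_min rho mu mut : R) (alpha beta : 'I_m -> R) (delta : R).
Hypotheses (c_gt0 : 0 < c) (pi_gt0 : 0 < pi_min) (rho_gt0 : 0 < rho_min)
  (ind : independent_instances E)
  (rnd : randomized_labeling E pi_min rho_min rho)
  (cor : correct_specification E c mu mut alpha beta)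
  (delta_bounds : 0 < delta <= c).

Let th := Params mut alpha beta.
Let cth := Params mu alpha beta.

Lemma delta_half : 0 < delta <= 2^-1.
Proof. by have := mu_bounds cor; move: delta_bounds => ? ?; lra. Qed.

Lemma hist_box : in_box delta th.
Proof.
move: delta_bounds => d; split => [|j|j] /=.
- by have := mut_bounds cor; lra.
- by have := alpha_bounds cor j; lra.
- by have := beta_bounds cor j; lra.
Qed.

Lemma current_box : in_box delta cth.
Proof.
move: delta_bounds => d; split => [|j|j] /=.
- by have := mu_bounds cor; lra.
- by have := alpha_bounds cor j; lra.
- by have := beta_bounds cor j; lra.
Qed.

Let pa i s := pr P [set w | havails i w = s].
Let pb i b := pr P [set w | hrouted E i w = b].

Lemma pr_hinstance i v :
  pr P [set w | hinstance i w = v] = rec_law mut alpha beta pa pb i v.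
Proof.
case: v => [[l s] b].
rewrite /hinstance (pr_independent2 _ _ (hrouted_randomized rnd i)).
rewrite (pr_independent2 _ _ (havail_randomized rnd i)) /rec_law /=; congr (_ * _ * _).
rewrite -(pr_labels _ (hgold_mean cor i) (hsensitivityE cor i)
  (hspecificityE cor i) (hsilver_cond_indep cor i)) //.
by have := mut_bounds cor; move: c_gt0 => ? ?; lra.
Qed.

Lemma pr_cinstance i v : pr P [set w | cinstance i w = v] =
  label_law mu alpha beta v.1 * pr P [set w | avails i w = v.2].
Proof.
case: v => [l s].
rewrite /cinstance (pr_independent2 _ _ (avail_randomized rnd i)); congr (_ * _).
rewrite -(pr_labels _ (gold_mean cor i) (sensitivityE cor i)
  (specificityE cor i) (silver_cond_indep cor i)) //.
by have := mu_bounds cor; move: c_gt0 => ? ?; lra.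
Qed.

(** The statistics of [history_close] in one indexed family, so that one deviation bound and one
    union bound serve all: 0 routed count, 1 prevalence residual, 2 and 3 votes on positive and
    negative gold labels, 4 and 5 sensitivity and specificity residuals. *)
Definition label_stat (k : nat) (j : 'I_m) (l : bool * pattern) : R :=
  match k with
  | 0 => 1
  | 1 => l.1%:R - mut
  | 2 => l.1%:R
  | 3 => (~~ l.1)%:R
  | 4 => l.1%:R * ((l.2 j)%:R - alpha j)
  | _ => (~~ l.1)%:R * (1 - (l.2 j)%:R - beta j)
  end.

Definition avail_stat (k : nat) (j : 'I_m) (s : pattern) : R :=
  if (k < 2)%N then 1 else (s j)%:R.

Definition stat k j (v : instance) : R :=
  label_stat k j v.1.1 * avail_stat k j v.1.2 * v.2%:R.

Definition label_stat_mean (k : nat) : R :=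
  match k with 0 => 1 | 2 => mut | 3 => 1 - mut | _ => 0 end.

Lemma sum_label_stat k j : \sum_l label_law mut alpha beta l * label_stat k j l =
  label_stat_mean k.
Proof.
rewrite sum_label_lawE /label_stat /label_stat_mean.
have one p : \sum_(z : pattern) lik1 p z xpredT * 1 = 1 :> R.
  by rewrite -big_distrl /= sum_lik1 mulr1.
have cst p x : \sum_(z : pattern) lik1 p z xpredT * x = x :> R.
  by rewrite -big_distrl /= sum_lik1 mul1r.
case: k => [|[|[|[|[|k]]]]] /=; rewrite ?cst; try ring.
- rewrite (sum_lik1_coord alpha j (fun b => 1 * (b%:R - alpha j))).
  by rewrite (sum_lik1_coord _ j (fun b => 0 * (b%:R - alpha j))) /=; ring.
- rewrite (sum_lik1_coord alpha j (fun b => 0 * (1 - b%:R - beta j))).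
  by rewrite (sum_lik1_coord _ j (fun b => 1 * (1 - b%:R - beta j))) /=; ring.
Qed.

Lemma stat_le1 k j v : `|stat k j v| <= 1.
Proof.
have c0 := c_gt0; have mutb := mut_bounds cor.
have aj := alpha_bounds cor j; have bj := beta_bounds cor j.
rewrite /stat /label_stat /avail_stat.
case: v => [[[y z] s] b] /=; case: b; last by rewrite mulr0 normr0.
rewrite mulr1; case: k => [|[|[|[|[|k]]]]] /=; rewrite ler_norml ?mulr1.
- lra.
- by case: y => /=; lra.
- by case: y; case: (s j) => /=; lra.
- by case: y; case: (s j) => /=; lra.
- by case: y; case: (s j); case: (z j) => /=; lra.
- by case: y; case: (s j); case: (z j) => /=; lra.
Qed.

Lemma mean_stat i k j : mean P hinstance i (stat k j) =
  label_stat_mean k * (\sum_s pa i s * avail_stat k j s) * rho.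
Proof.
rewrite -(sum_label_stat k j) -(hrouted_pr rnd i).
have -> : pr P [set w | hrouted E i w = true] = \sum_b pb i b * b%:R.
  by rewrite big_bool /= mulr1 mulr0 addr0.
rewrite /mean; under eq_bigr do rewrite pr_hinstance.
transitivity (\sum_ls \sum_b (label_law mut alpha beta ls.1 * pa i ls.2
   * (label_stat k j ls.1 * avail_stat k j ls.2)) * (pb i b * b%:R)).
  by rewrite pair_bigA /=; apply: eq_bigr => -[[l s] b] _; rewrite /rec_law /stat /=; ring.
transitivity ((\sum_ls label_law mut alpha beta ls.1 * pa i ls.2
   * (label_stat k j ls.1 * avail_stat k j ls.2)) * \sum_b pb i b * b%:R).
  by rewrite big_distrl /=; apply: eq_bigr => ls _; rewrite big_distrr.
congr (_ * _).
transitivity (\sum_l \sum_s (label_law mut alpha beta l * label_stat k j l)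
   * (pa i s * avail_stat k j s)).
  by rewrite pair_bigA /=; apply: eq_bigr => -[l s] _ /=; ring.
rewrite big_distrl /=; apply: eq_bigr => l _.
by rewrite big_distrr.
Qed.

(** Half of a lower bound for the mean counts; the other half absorbs the deviations. *)
Definition kappa : R := c * pi_min * rho_min / 2.

Lemma kappa_gt0 : 0 < kappa.
Proof. by rewrite /kappa divr_gt0// !mulr_gt0. Qed.

Lemma mean_stat_ge i k j : k \in [:: 0; 2; 3]%N -> 2 * kappa <= mean P hinstance i (stat k j).
Proof.
move=> hk; rewrite mean_stat (_ : 2 * kappa = c * pi_min * rho_min);
  last by rewrite /kappa; field.
have mb := mut_bounds cor; have c0 := c_gt0; have r0 := rho_gt0; have p0 := pi_gt0.
have hav : pi_min <= \sum_s pa i s * (s j)%:R.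
  apply: (le_trans (havail_ge rnd i j)).
  have mA : measurable_fibers (havails (E := E) i).
    by apply: measurable_fibers_ffun => j'; exact: measurable_fibers_RV.
  have := pr_finite_sum P (fun s : pattern => s j) mA.
  have -> : [set w | havails i w j] = [set w | havail E i j w = true].
    by apply/seteqP; split => w /=; rewrite /havails ffunE.
  move=> ->; rewrite big_mkcond /= le_eqVlt; apply/orP; left; apply/eqP.
  by apply: eq_bigr => s _; case: (s j); rewrite ?mulr1 ?mulr0.
have sum1 : \sum_s pa i s = 1.
  by apply: sum_pr1; apply: measurable_fibers_ffun => j'; exact: measurable_fibers_RV.
have hav1 : \sum_s pa i s * (s j)%:R <= 1.
  rewrite -[leRHS]sum1; apply: ler_sum => s _.
  by case: (s j); rewrite ?mulr1 ?mulr0//; exact: pr_ge0.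
have key A B : c <= A -> pi_min <= B -> c * pi_min * rho_min <= A * B * rho.
  move=> cA pB; apply: ler_pM; [by rewrite mulr_ge0; lra|lra| |exact: rho_ge rnd].
  by apply: ler_pM => //; lra.
rewrite /avail_stat; case: k hk => [|[|[|[|k]]]] //= _; apply: key => //; try lra.
by rewrite -big_distrl /= sum1 mul1r; lra.
Qed.

Definition hdata (w : sample_space E) : {ffun 'I_N -> instance} := [ffun i => hinstance i w].

Lemma measurable_hdata : measurable_fibers hdata.
Proof. exact: measurable_fibers_ffun measurable_hinstance. Qed.

Definition data_fit (eps : R) (D : {ffun 'I_N -> instance}) : params R m :=
  gold_anchored_em (fun i => rec_gold (D i)) (fun i => rec_routed (D i))
    (fun i => rec_silver (D i)) (fun i => rec_avail (D i)) delta eps.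

Lemma historical_fitE eps w : historical_fit (E := E) delta eps w = data_fit eps (hdata w).
Proof.
have e1 : (fun i => rec_gold (hdata w i)) = hgold E ^~ w.
  by apply/funext => i; rewrite /rec_gold /hdata ffunE.
have e2 : (fun i => rec_routed (hdata w i)) = hrouted E ^~ w.
  by apply/funext => i; rewrite /rec_routed /hdata ffunE.
have e3 : (fun i => rec_silver (hdata w i) : 'I_m -> bool) =
    (fun i j => hsilver E i j w).
  by apply/funext => i; apply/funext => j; rewrite /rec_silver /hdata ffunE /= ffunE.
have e4 : (fun i => rec_avail (hdata w i) : 'I_m -> bool) =
    (fun i j => havail E i j w).
  by apply/funext => i; apply/funext => j; rewrite /rec_avail /hdata ffunE /= ffunE.
by rewrite /historical_fit /data_fit e1 e2 e3 e4.
Qed.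

Definition fit_error (eps : R) (w : sample_space E) : R :=
  let fit := historical_fit (E := E) delta eps w in
  pdist (Params mu (sensitivity fit) (specificity fit)) cth.

Definition data_chi (D : {ffun 'I_N -> instance}) : R :=
  chi_square (fun i => rec_routed (D i)) (fun i => rec_silver (D i))
    (fun i => rec_avail (D i)) th.

(** Each of 6 m statistics deviates with probability at most 4 / K ^ 2; Markov's inequality for the
    chi-square statistic at level K ^ 2 adds 4 ^ m / K ^ 2. *)
Lemma history_pr (K eps : R) : (0 < N)%N -> 0 < K ->
  K / kappa <= Num.sqrt N%:R ->
  pr P [set w | @history_rate R m delta kappa K / Num.sqrt N%:R < fit_error eps w]
    <= (24 * m%:R + 4 ^+ m) / K ^+ 2.
Proof.
move=> N0 K0 KN; have mD := measurable_hdata.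
have sN0 : 0 < Num.sqrt N%:R :> R by rewrite sqrtr_gt0 ltr0n.
have sNE : N%:R = Num.sqrt N%:R ^+ 2 :> R by rewrite sqr_sqrtr ?ler0n.
pose bad (kj : 'I_6 * 'I_m) (D : {ffun 'I_N -> instance}) : bool :=
  K * Num.sqrt N%:R < `|\sum_i (stat kj.1 kj.2 (D i) - mean P hinstance i (stat kj.1 kj.2))|.
pose A := [set w | [exists kj, bad kj (hdata w)]].
pose B := [set w | K ^+ 2 < data_chi (hdata w)].
have mA : measurable A := measurable_fibers_set (fun D => [exists kj, bad kj D]) mD.
have mB : measurable B := measurable_fibers_set (fun D => K ^+ 2 < data_chi D) mD.
have sub : [set w | @history_rate R m delta kappa K / Num.sqrt N%:R < fit_error eps w]
    `<=` A `|` B.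
  move=> w /= hw; have [|nA] := boolP [exists kj, bad kj (hdata w)]; first by left.
  right; rewrite /B /= ltNge; apply/negP => chi_le; move: hw; apply/negP; rewrite -leNgt.
  have dev (k : nat) j : (k < 6)%N ->
      `|\sum_i (stat k j (hdata w i) - mean P hinstance i (stat k j))| <= K * Num.sqrt N%:R.
    move=> k6; rewrite leNgt; apply: contra nA => h.
    by apply/existsP; exists (Ordinal k6, j).
  have big_stat k j : k \in [:: 0; 2; 3]%N ->
      kappa * N%:R <= \sum_i stat k j (hdata w i).
    move=> hk; have k6 : (k < 6)%N by move: hk; rewrite !inE => /or3P[] /eqP ->.
    have := dev k j k6; rewrite sumrB ler_norml => /andP[lo _].
    have : 2 * kappa * N%:R <= \sum_i mean P hinstance i (stat k j).
      rewrite -[N in leLHS]card_ord -sum1_card natr_sum big_distrr /=.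
      by apply: ler_sum => i _; rewrite mulr1; exact: mean_stat_ge.
    have : K * Num.sqrt N%:R <= kappa * N%:R.
      rewrite (_ : kappa * N%:R = kappa * Num.sqrt N%:R * Num.sqrt N%:R); last first.
        by rewrite -mulrA -expr2 -sNE.
      rewrite ler_wpM2r ?(ltW sN0)//.
      by rewrite mulrC -ler_pdivrMr ?kappa_gt0.
    lra.
  have zero_stat k j : k \in [:: 1; 4; 5]%N ->
      `|\sum_i stat k j (hdata w i)| <= K * Num.sqrt N%:R.
    move=> hk; have k6 : (k < 6)%N by move: hk; rewrite !inE => /or3P[] /eqP ->.
    have := dev k j k6; rewrite sumrB [X in _ - X]big1 ?subr0// => i _.
    by rewrite mean_stat; move: hk; rewrite !inE => /or3P[] /eqP -> /=; rewrite !mul0r.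
  (* Statistics 0 and 1 do not depend on the labeler but are indexed by one; for m = 0 the error and
     the rate are both 0. *)
  have [j0 _|no] := pickP (pred_of_simpl (@predT 'I_m)); last first.
    rewrite /fit_error /pdist /= subrr normr0 !big1; try by move=> j; have := no j.
    rewrite !addr0 /history_rate (_ : m = 0%N) ?mulr0 ?mul0r//.
    by have := card_ord m; rewrite (eq_card0 no).
  have stat_eq k j (f : instance -> R) : (forall v, stat k j v = f v) ->
      \sum_i stat k j (hdata w i) = \sum_i f (hdata w i).
    by move=> sf; apply: eq_bigr => i _; exact: sf.
  rewrite /fit_error historical_fitE.
  apply: (@history_close R m N _ _ _ _ delta kappa K delta_half kappa_gt0 K0
    mut alpha beta hist_box) => //.
  - rewrite -(stat_eq 0 j0 (fun v => (rec_routed v)%:R)); first exact: big_stat.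
    by move=> v; rewrite /stat /= !mul1r.
  - move=> j; rewrite /votes -(stat_eq 2 j (fun v => (rec_avail v j)%:R *
       (rec_routed v && rec_gold v)%:R)); first exact: big_stat.
    move=> [[[y z] s] b]; rewrite /stat /avail_stat /rec_avail /rec_routed /rec_gold /=.
    by case: y; case: b; case: (s j); rewrite /= ?mulr1 ?mulr0 ?mul0r.
  - move=> j; rewrite /votes -(stat_eq 3 j (fun v => (rec_avail v j)%:R *
       (rec_routed v && ~~ rec_gold v)%:R)); first exact: big_stat.
    move=> [[[y z] s] b]; rewrite /stat /avail_stat /rec_avail /rec_routed /rec_gold /=.
    by case: y; case: b; case: (s j); rewrite /= ?mulr1 ?mulr0 ?mul0r.
  - rewrite -(stat_eq 1 j0 (fun v => (rec_routed v)%:R * ((rec_gold v)%:R - mut)));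
      first exact: zero_stat.
    by move=> v; rewrite /stat /= mulr1 mulrC.
  - move=> j; rewrite -(stat_eq 4 j (fun v => (rec_avail v j)%:R *
       (rec_routed v && rec_gold v)%:R * ((rec_silver v j)%:R - alpha j)));
       first exact: zero_stat.
    move=> [[[y z] s] b].
    rewrite /stat /avail_stat /rec_avail /rec_routed /rec_gold /rec_silver /=.
    by case: y; case: b; case: (s j); rewrite /= ?(mulr1, mulr0, mul0r, mul1r).
  - move=> j; rewrite -(stat_eq 5 j (fun v => (rec_avail v j)%:R *
       (rec_routed v && ~~ rec_gold v)%:R * (1 - (rec_silver v j)%:R - beta j)));
       first exact: zero_stat.
    move=> [[[y z] s] b].
    rewrite /stat /avail_stat /rec_avail /rec_routed /rec_gold /rec_silver /=.
    by case: y; case: b; case: (s j); rewrite /= ?(mulr1, mulr0, mul0r, mul1r).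
apply: (@le_trans _ _ (pr P A + pr P B)).
  apply: pr_sub_setU => //.
  have := @measurable_fibers_set _ _ _ _ (fun D => @history_rate R m delta kappa K / Num.sqrt N%:R <
    let fit := data_fit eps D in
    pdist (Params mu (sensitivity fit) (specificity fit)) cth) mD.
  by under eq_fun do rewrite -historical_fitE.
rewrite mulrDl; apply: lerD.
  apply: (le_trans (pr_exists_le P bad mD)).
  have each kj : pr P [set w | bad kj (hdata w)] <= 4 / K ^+ 2.
    have := pr_deviation measurable_hinstance (proj1 ind) (stat_le1 kj.1 kj.2)
      (mulr_gt0 K0 sN0).
    have -> : 4 * 1 ^+ 2 * N%:R / (K * Num.sqrt N%:R) ^+ 2 = 4 / K ^+ 2.
      rewrite exprMn -sNE; field; rewrite gt_eqF//= pnatr_eq0 -lt0n//.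
    apply: le_trans; rewrite le_eqVlt; apply/orP; left; apply/eqP; congr pr.
    apply/funext => w; rewrite /= /bad.
    by congr (is_true (_ < `|_|)); apply: eq_bigr => i _; rewrite ffunE.
  apply: (le_trans (ler_sum _ (fun kj _ => each kj))).
  rewrite sumr_const card_prod !card_ord -[leLHS]mulr_natr natrM.
  by rewrite le_eqVlt; apply/orP; left; apply/eqP; field; rewrite gt_eqF.
apply: (le_trans (pr_markov P mD _ _)); [|exact: exprn_gt0|].
  move=> D; apply: sumr_ge0 => s _; apply: sumr_ge0 => x _.
  by rewrite divr_ge0 ?sqr_ge0// pattern_count_ge0.
rewrite ler_pM2r ?invr_gt0 ?exprn_gt0//.
under eq_bigr do rewrite (pr_independent _ (proj1 ind)).
under eq_bigr do under eq_bigr do rewrite pr_hinstance.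
apply: (chi_square_expectation delta_half hist_box).
- by move=> i s; exact: pr_ge0.
- by move=> i b; exact: pr_ge0.
- by move=> i; apply: sum_pr1; apply: measurable_fibers_ffun => j; exact: measurable_fibers_RV.
- by move=> i; apply: sum_pr1; exact: measurable_fibers_RV.
Qed.

End history_probability.

(** * Probability bounds on the current data *)

Section hero_probability.
Context {R : realType} {m n N : nat}.
Variable E : experiment R m n N.
Local Notation P := (sample_prob E).
Local Notation pattern := {ffun 'I_m -> bool}.
Variables (c pi_min rho_min rho mu mut : R) (alpha beta : 'I_m -> R) (delta : R).
Hypotheses (c_gt0 : 0 < c) (pi_gt0 : 0 < pi_min) (rho_gt0 : 0 < rho_min)
  (ind : independent_instances E)
  (rnd : randomized_labeling E pi_min rho_min rho)
  (cor : correct_specification E c mu mut alpha beta)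
  (delta_bounds : 0 < delta <= c).
Variable j0 : 'I_m.
Hypothesis informative : alpha j0 + beta j0 != 1.

Let cth := Params mu alpha beta.
Let d01 := delta_half cor delta_bounds.
Let cth_box : in_box delta cth := current_box cor delta_bounds.

(** Half of a lower bound for the mean squared contrast: that of [sum_label_law_contrast] times the
    least probability [pi_min] that [j0] is available. The other half absorbs the deviations. *)
Definition curvature : R :=
  delta ^+ m * ((delta ^+ m * (alpha j0 + beta j0 - 1)) ^+ 2 / 2) * pi_min / 2.

Lemma curvature_gt0 : 0 < curvature.
Proof.
have dm : 0 < delta ^+ m by rewrite exprn_gt0//; case/andP: delta_bounds.
have sq : 0 < (delta ^+ m * (alpha j0 + beta j0 - 1)) ^+ 2.
  by rewrite exprn_even_gt0//= mulf_neq0 ?subr_eq0// gt_eqF.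
by rewrite /curvature divr_gt0// mulr_gt0// mulr_gt0// divr_gt0.
Qed.

Let av i s := pr P [set w | avails (E := E) i w = s].

Let mean_cinstance i (f : (bool * pattern) * pattern -> R) :
  mean P (cinstance (E := E)) i f =
  \sum_s av i s * \sum_l label_law mu alpha beta l * f (l, s).
Proof.
rewrite /mean; under eq_bigr do rewrite (pr_cinstance c_gt0 rnd cor).
transitivity (\sum_l \sum_s label_law mu alpha beta l * av i s * f (l, s)).
  by rewrite pair_bigA /=; apply: eq_bigr => -[].
rewrite exchange_big /=; apply: eq_bigr => s _; rewrite big_distrr /=.
by apply: eq_bigr => l _; ring.
Qed.

Let mavails i : measurable_fibers (avails (E := E) i).
Proof. by apply: measurable_fibers_ffun => j; exact: measurable_fibers_RV. Qed.

Lemma mean_contrast_ge i :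
  2 * curvature <= mean P (cinstance (E := E)) i (fun v => contrast cth v.1.2 v.2 ^+ 2).
Proof.
have dm : 0 < delta ^+ m by rewrite exprn_gt0//; case/andP: delta_bounds.
rewrite mean_cinstance /=.
set h := delta ^+ m * ((delta ^+ m * (alpha j0 + beta j0 - 1)) ^+ 2 / 2).
have h0 : 0 <= h by rewrite mulr_ge0 ?(ltW dm)// divr_ge0 ?sqr_ge0.
rewrite (_ : 2 * curvature = pi_min * h); last by rewrite /curvature -/h; field.
apply: (@le_trans _ _ ((\sum_s av i s * (s j0)%:R) * h)).
  rewrite ler_wpM2r//; apply: (le_trans (avail_ge rnd i j0)).
  have := pr_finite_sum P (fun s : pattern => s j0) (@mavails i).
  have -> : [set w | avails i w j0] = [set w | avail E i j0 w = true].
    by apply/seteqP; split => w /=; rewrite /avails ffunE.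
  move=> ->; rewrite big_mkcond /= le_eqVlt; apply/orP; left; apply/eqP.
  by apply: eq_bigr => s _; rewrite /av; case: (s j0); rewrite ?mulr1 ?mulr0.
rewrite big_distrl /=; apply: ler_sum => s _; rewrite -mulrA ler_wpM2l ?pr_ge0//.
case: (boolP (s j0)) => sj; last first.
  rewrite mul0r; apply: sumr_ge0 => l _; rewrite mulr_ge0 ?sqr_ge0//.
  exact: label_law_ge0 d01 cth_box l.
by rewrite mul1r; apply: sum_label_law_contrast.
Qed.

Lemma mean_score i : mean P (cinstance (E := E)) i (fun v => score cth v.1.2 v.2) = 0.
Proof.
rewrite mean_cinstance big1// => s _ /=.
by rewrite (sum_label_law_score d01 cth_box) mulr0.
Qed.

Definition total_score (w : sample_space E) : R :=
  \sum_(i < n) score cth (fun j => silver E i j w) (fun j => avail E i j w).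

Definition total_contrast (w : sample_space E) : R :=
  \sum_(i < n) contrast cth (fun j => silver E i j w) (fun j => avail E i j w) ^+ 2.

Let cE i w (f : ('I_m -> bool) -> ('I_m -> bool) -> R) :
  f (fun j => silver E i j w) (fun j => avail E i j w) =
  f (cinstance i w).1.2 (cinstance i w).2.
Proof. by congr f; apply/funext => j; rewrite /cinstance /= ffunE. Qed.

Let mC := @measurable_cinstance R m n N E.

Definition cdata (w : sample_space E) : {ffun 'I_n -> (bool * pattern) * pattern} :=
  [ffun i => cinstance i w].

Lemma measurable_cdata : measurable_fibers cdata.
Proof. exact: measurable_fibers_ffun mC. Qed.

Lemma measurable_fit_error eps (Q : R -> Prop) :
  measurable [set w : sample_space E | Q (fit_error mu alpha beta delta eps w)].
Proof.
have := measurable_fibers_set (fun D : {ffun 'I_N -> ((bool * pattern) * pattern) * bool} =>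
  let fit := data_fit delta eps D in
  Q (pdist (Params mu (sensitivity fit) (specificity fit)) cth)) (@measurable_hdata _ _ _ _ E).
congr measurable; apply/funext => w; rewrite /mkset /fit_error.
by rewrite historical_fitE.
Qed.

Lemma measurable_total_score (Q : R -> Prop) : measurable [set w | Q (total_score w)].
Proof.
have := measurable_fibers_set (fun D : {ffun 'I_n -> (bool * pattern) * pattern} =>
  Q (\sum_i score cth (D i).1.2 (D i).2)) measurable_cdata.
congr measurable; apply/funext => w; rewrite /mkset; congr Q.
by apply: eq_bigr => i _; rewrite ffunE (cE i w (score cth)).
Qed.

Lemma measurable_total_contrast (Q : R -> Prop) : measurable [set w | Q (total_contrast w)].
Proof.
have := measurable_fibers_set (fun D : {ffun 'I_n -> (bool * pattern) * pattern} =>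
  Q (\sum_i contrast cth (D i).1.2 (D i).2 ^+ 2)) measurable_cdata.
congr measurable; apply/funext => w; rewrite /mkset; congr Q.
apply: eq_bigr => i _; rewrite ffunE.
by rewrite -(cE i w (fun s x => contrast cth s x ^+ 2)).
Qed.

(** Factoring through finite data makes HERO-1 measurable despite its definition by choice of a
    maximizer. *)
Lemma mu_hero1_data eps : exists f, forall w,
  mu_hero1 E delta eps w = f (hdata w, cdata w).
Proof.
exists (fun v : {ffun 'I_N -> ((bool * pattern) * pattern) * bool} *
            {ffun 'I_n -> (bool * pattern) * pattern} =>
  hero1 (sensitivity (data_fit delta eps v.1)) (specificity (data_fit delta eps v.1))
    (fun i => (v.2 i).1.2) (fun i => (v.2 i).2)) => w.
rewrite /mu_hero1 historical_fitE /=.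
have -> : (fun i => (cdata w i).1.2 : 'I_m -> bool) = (fun i j => silver E i j w).
  by apply/funext => i; apply/funext => j; rewrite ffunE /= ffunE.
have -> : (fun i => (cdata w i).2 : 'I_m -> bool) = (fun i j => avail E i j w).
  by apply/funext => i; apply/funext => j; rewrite ffunE /= ffunE.
by [].
Qed.

Lemma measurable_mu_hero1 eps (Q : R -> Prop) :
  measurable [set w | Q (mu_hero1 E delta eps w)].
Proof.
have [f fE] := mu_hero1_data eps.
have mD : measurable_fibers (fun w => (hdata w, cdata w)).
  exact: measurable_fibers_pair (@measurable_hdata _ _ _ _ E) measurable_cdata.
have := measurable_fibers_set (fun v => Q (f v)) mD.
by congr measurable; apply/funext => w; rewrite /mkset fE.
Qed.

Lemma score_pr (K : R) : (0 < n)%N -> 0 < K ->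
  pr P [set w | K * Num.sqrt n%:R < `|total_score w|] <= 4 * delta^-1 ^+ 2 / K ^+ 2.
Proof.
move=> n0 K0.
have sn0 : 0 < Num.sqrt n%:R :> R by rewrite sqrtr_gt0 ltr0n.
have snE : Num.sqrt n%:R ^+ 2 = n%:R :> R by rewrite sqr_sqrtr ?ler0n.
have := pr_deviation mC (proj2 ind)
  (fun v => score_le d01 v.1.2 v.2 cth_box) (mulr_gt0 K0 sn0).
rewrite exprMn snE invfM mulrACA divff ?pnatr_eq0 -?lt0n// mulr1 => h.
apply: le_trans h; rewrite le_eqVlt; apply/orP; left; apply/eqP; congr pr.
apply/funext => w /=; congr (is_true (_ < `|_|)); apply: eq_bigr => i _.
by rewrite mean_score subr0 (cE i w (score cth)).
Qed.

Lemma contrast_pr (K : R) : (0 < n)%N -> 0 < K -> K / curvature <= Num.sqrt n%:R ->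
  pr P [set w | total_contrast w < curvature * n%:R] <= 4 / K ^+ 2.
Proof.
move=> n0 K0 Kn.
have sn0 : 0 < Num.sqrt n%:R :> R by rewrite sqrtr_gt0 ltr0n.
have snE : Num.sqrt n%:R ^+ 2 = n%:R :> R by rewrite sqr_sqrtr ?ler0n.
have g1 (v : (bool * pattern) * pattern) : `|contrast cth v.1.2 v.2 ^+ 2| <= 1.
  by rewrite normrX exprn_ile1// (contrast_le1 d01).
have := pr_deviation mC (proj2 ind) g1 (mulr_gt0 K0 sn0).
rewrite exprMn snE expr1n mulr1 invfM mulrACA divff ?pnatr_eq0 -?lt0n// mulr1.
apply: le_trans.
pose D := cdata; have mD := measurable_cdata.
have tcE w : total_contrast w = \sum_i contrast cth (D w i).1.2 (D w i).2 ^+ 2.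
  apply: eq_bigr => i _; rewrite ffunE.
  exact: (cE i w (fun s x => contrast cth s x ^+ 2)).
apply: le_pr.
- exact: (measurable_total_contrast (fun x => x < curvature * n%:R)).
- have := measurable_fibers_set (fun D : {ffun 'I_n -> (bool * pattern) * pattern} =>
    K * Num.sqrt n%:R < `|\sum_i (contrast cth (D i).1.2 (D i).2 ^+ 2 -
      mean P (cinstance (E := E)) i (fun v => contrast cth v.1.2 v.2 ^+ 2))|) mD.
  congr measurable; apply/funext => w /=; congr (is_true (_ < `|_|)).
  by apply: eq_bigr => i _; rewrite ffunE.
move=> w /=; rewrite tcE => hw.
have kn : K * Num.sqrt n%:R <= curvature * n%:R.
  rewrite -[X in _ <= curvature * X]snE expr2 mulrA ler_wpM2r ?(ltW sn0)//.
  by rewrite mulrC -ler_pdivrMr ?curvature_gt0.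
have hm : 2 * curvature * n%:R <= \sum_i
    mean P (cinstance (E := E)) i (fun v => contrast cth v.1.2 v.2 ^+ 2).
  rewrite -[n in leLHS]card_ord -sum1_card natr_sum big_distrr /=.
  by apply: ler_sum => i _; rewrite mulr1; exact: mean_contrast_ge.
rewrite sumrB -normrN; apply: lt_le_trans (ler_norm _).
have -> : \sum_i contrast cth (cinstance i w).1.2 (cinstance i w).2 ^+ 2 =
  \sum_i contrast cth (D w i).1.2 (D w i).2 ^+ 2.
  by apply: eq_bigr => i _; rewrite ffunE.
lra.
Qed.

(** * Error of HERO-1 for fixed n and N *)

Section rate.
Variables (K eps : R).
Hypotheses (K_gt0 : 0 < K) (n_gt0 : (0 < n)%N) (n_le_N : (n <= N)%N).
Let kap := kappa c pi_min rho_min.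
Let H := @history_rate R m delta kap K.

(** With C = 2 / (delta ^ m) ^ 2, the slope is at most (K + C H) sqrt n and the curvature left at
    least [curvature] n / 2; in [hero1_close] a shift of rate / sqrt n needs rate > 16 (K + C H) /
    [curvature], and the 1 makes this strict. *)
Definition hero_rate : R :=
  16 * (K + 2 / (delta ^+ m) ^+ 2 * H) / curvature + 1.

(** In order: historical counts are of order N, the total contrast is of order n, the fit error
    takes at most half of the curvature, and the shift stays below [delta]. *)
Hypotheses (n_large1 : K / kap <= Num.sqrt n%:R)
  (n_large2 : K / curvature <= Num.sqrt n%:R)
  (n_large3 : 4 * H / curvature <= Num.sqrt n%:R)
  (n_large4 : hero_rate / delta < Num.sqrt n%:R).

Let H_ge0 : 0 <= H.
Proof.
have k0 : 0 < kap := kappa_gt0 c_gt0 pi_gt0 rho_gt0.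
by rewrite /H /history_rate !mulr_ge0// addr_ge0 ?sqrtr_ge0// divr_ge0// ltW.
Qed.

Lemma hero_rate_gt0 : 0 < hero_rate.
Proof.
have dm : 0 < delta ^+ m by rewrite exprn_gt0//; case/andP: delta_bounds.
rewrite /hero_rate ltr_wpDl// divr_ge0 ?(ltW curvature_gt0)// mulr_ge0// addr_ge0 ?(ltW K_gt0)//.
by rewrite mulr_ge0// divr_ge0// exprn_ge0// ltW.
Qed.

Let sn0 : 0 < Num.sqrt n%:R :> R.
Proof. by rewrite sqrtr_gt0 ltr0n. Qed.

Lemma hero_error_le w :
  fit_error mu alpha beta delta eps w <= H / Num.sqrt N%:R ->
  `|total_score w| <= K * Num.sqrt n%:R ->
  curvature * n%:R <= total_contrast w ->
  `|mu_hero1 E delta eps w - mu| <= hero_rate / Num.sqrt n%:R.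
Proof.
move=> hfit hscore hcontrast.
have fit_box : in_box delta (historical_fit (E := E) delta eps w).
  exact: gold_anchored_em_box.
set fit := historical_fit delta eps w in fit_box hfit *.
have [q0 n3 n4] := And3 sn0 n_large3 n_large4.
set q := Num.sqrt n%:R in q0 n3 n4 hscore *.
have qE : n%:R = q ^+ 2 by rewrite /q sqr_sqrtr ?ler0n.
rewrite /fit_error -/fit -/cth in hfit; set D := pdist _ _ in hfit.
have D0 : 0 <= D := pdist_ge0 _ _.
have d0 : 0 < delta by case/andP: delta_bounds.
(* Here n <= N turns the historical error into one of order 1 / sqrt n. *)
have Dq : q * D <= H.
  rewrite mulrC -ler_pdivlMr//; apply: (le_trans hfit); rewrite ler_wpM2l//.
  by rewrite lef_pV2 ?posrE// ?sqrtr_gt0 ?ltr0n ?(leq_trans n_gt0)// ler_wsqrtr// ler_nat.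
have [mub _ _] := cth_box; have [_ sb pb] := fit_box.
apply: (@hero1_close _ _ _ _ _ delta d01 mu (hero_rate / q) (K * q) (curvature * n%:R)
  (sensitivity fit) (specificity fit) alpha beta) => //.
  by rewrite divr_gt0 ?hero_rate_gt0//= ltr_pdivrMr// mulrC -ltr_pdivrMr.
rewrite -/D qE; set C := 2 / _.
have C0 : 0 <= C by rewrite divr_ge0// exprn_ge0// exprn_ge0// ltW.
have L : K * q + C * q ^+ 2 * D <= (K + C * H) * q.
  have := ler_wpM2l C0 (ler_wpM2r (ltW q0) Dq); lra.
apply: (le_lt_trans L).
have cv := curvature_gt0.
have h4 : 4 * H <= curvature * q by rewrite [leRHS]mulrC -ler_pdivrMr.
have eR : hero_rate / q / 8 * (curvature * q ^+ 2 - 2 * q ^+ 2 * D) =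
    hero_rate / 8 * (curvature * q - 2 * (q * D)) by field; rewrite gt_eqF.
rewrite eR.
have -> : (K + C * H) * q = (hero_rate - 1) / 8 * (curvature * q / 2).
  by rewrite /hero_rate -/C; field; rewrite gt_eqF.
have cq : 0 < curvature * q by rewrite mulr_gt0.
have hr := hero_rate_gt0.
apply: (@lt_le_trans _ _ (hero_rate / 8 * (curvature * q / 2))).
  by rewrite ltr_pM2r ?divr_gt0//; lra.
by rewrite ler_wpM2l; lra.
Qed.

(** Union bound: 24 m + 4 ^ m comes from the historical fit, 4 / delta ^ 2 from the score and 4 from
    the contrast. *)
Lemma hero_pr :
  pr P [set w | hero_rate / Num.sqrt n%:R < `|mu_hero1 E delta eps w - mu|] <=
  (24 * m%:R + 4 ^+ m + 4 * delta^-1 ^+ 2 + 4) / K ^+ 2.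
Proof.
have k0 : 0 < kap := kappa_gt0 c_gt0 pi_gt0 rho_gt0.
set A := [set w : sample_space E | H / Num.sqrt N%:R < fit_error mu alpha beta delta eps w].
set B := [set w | K * Num.sqrt n%:R < `|total_score w|].
set C := [set w | total_contrast w < curvature * n%:R].
have mA : measurable A := measurable_fit_error eps (fun x => H / Num.sqrt N%:R < x).
have mB : measurable B := measurable_total_score (fun x => K * Num.sqrt n%:R < `|x|).
have mC' : measurable C := measurable_total_contrast (fun x => x < curvature * n%:R).
have mH : measurable [set w | hero_rate / Num.sqrt n%:R < `|mu_hero1 E delta eps w - mu|].
  exact: (measurable_mu_hero1 eps (fun x => hero_rate / Num.sqrt n%:R < `|x - mu|)).
have pA : pr P A <= (24 * m%:R + 4 ^+ m) / K ^+ 2.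
  apply: (history_pr c_gt0 pi_gt0 rho_gt0 ind rnd cor delta_bounds) => //.
    exact: leq_trans n_le_N.
  by apply: (le_trans n_large1); rewrite ler_wsqrtr// ler_nat.
have pB := score_pr n_gt0 K_gt0.
have pC := contrast_pr n_gt0 K_gt0 n_large2.
rewrite -/B in pB; rewrite -/C in pC.
have sub : [set w | hero_rate / Num.sqrt n%:R < `|mu_hero1 E delta eps w - mu|]
    `<=` A `|` (B `|` C).
  move=> w /= hw; case: (ltP (H / Num.sqrt N%:R) (fit_error mu alpha beta delta eps w)) => hA;
    first by left.
  right; case: (ltP (K * Num.sqrt n%:R) `|total_score w|) => hB; first by left.
  right; rewrite /C /= ltNge; apply/negP => hC.
  by move: hw; rewrite ltNge hero_error_le.
have mBC : measurable (B `|` C) := measurableU _ _ mB mC'.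
have := pr_sub_setU P mH mA mBC sub.
have := pr_sub_setU P mBC mB mC' (@subset_refl _ _).
rewrite !mulrDl; rewrite mulrDl in pA; lra.
Qed.

End rate.
End hero_probability.

(** * Rate of convergence *)

Section asymptotic_rate.
Context {R : realType} {m : nat} {n N : nat -> nat}.
Hypothesis n_to_oo : n @ \oo --> \oo.
Hypothesis n_ll_N : (fun k => (n k)%:R : R) =o_\oo (fun k => (N k)%:R : R).

Lemma near_sqrt_gt (x : R) : \forall k \near \oo, x < Num.sqrt (n k)%:R.
Proof.
have [B hB] : exists B : nat, `|x| + 1 <= B%:R.
  by exists (Num.bound (`|x| + 1)); apply/ltW/archi_boundP; rewrite addr_ge0.
have : \forall k \near \oo, (B ^ 2 <= n k)%N by exact: (n_to_oo (nbhs_infty_ge (B ^ 2))).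
apply: filterS => k hk.
apply: (@lt_le_trans _ _ B%:R); first by have := ler_norm x; lra.
rewrite -[leLHS]ger0_norm ?ler0n// -sqrtr_sqr ler_wsqrtr//.
by rewrite -natrX ler_nat.
Qed.

Lemma near_n_le_N : \forall k \near \oo, (n k <= N k)%N.
Proof.
have /eqoP h := n_ll_N; have := h 1 ltr01.
by apply: filterS => k; rewrite mul1r !ger0_norm// ler_nat.
Qed.

Variable E : forall k, experiment R m (n k) (N k).
Variables (c pi_min rho_min rho mu mut : R) (alpha beta : 'I_m -> R).
Variables (delta : R) (eps : nat -> R).

Lemma hero1_O_p :
  admissible_model E c pi_min rho_min rho mu mut alpha beta ->
  informative_labeler alpha beta ->
  0 < delta <= c ->
  O_p (fun k w => mu_hero1 (E k) delta (eps (N k)) w - mu)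
      (fun k => (Num.sqrt (n k)%:R)^-1).
Proof.
move=> [c0 pi0 rho0 model] [j0 hj0] dc e e0.
have d0 : 0 < delta by case/andP: dc.
pose A : R := 24 * m%:R + 4 ^+ m + 4 * delta^-1 ^+ 2 + 4.
have A0 : 0 < A.
  by rewrite /A ltr_wpDl// !addr_ge0 ?mulr_ge0 ?exprn_ge0// invr_ge0 ltW.
(* Makes the bound A / K ^ 2 of [hero_pr] equal to [e], for all k at once. *)
pose K := Num.sqrt (A / e).
have K0 : 0 < K by rewrite sqrtr_gt0 divr_gt0.
have KE : A / K ^+ 2 = e by rewrite sqr_sqrtr ?divr_ge0 ?ltW// invf_div mulrC divfK// gt_eqF.
exists (@hero_rate R m c pi_min rho_min alpha beta delta j0 K).
  exact: (hero_rate_gt0 c0 pi0 rho0 dc hj0 K0).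
near=> k.
have [ind rnd cor] := model k.
rewrite -KE; apply: (hero_pr c0 pi0 rho0 ind rnd cor dc hj0 (eps (N k)) K0).
- have : 0 < Num.sqrt (n k)%:R :> R by near: k; exact: near_sqrt_gt.
  by rewrite sqrtr_gt0 ltr0n.
- by near: k; exact: near_n_le_N.
- by apply: ltW; near: k; exact: near_sqrt_gt.
- by apply: ltW; near: k; exact: near_sqrt_gt.
- by apply: ltW; near: k; exact: near_sqrt_gt.
- by near: k; exact: near_sqrt_gt.
Unshelve. all: by end_near.
Qed.

Lemma hero1_decomposition :
  admissible_model E c pi_min rho_min rho mu mut alpha beta ->
  informative_labeler alpha beta ->
  0 < delta <= c ->
  exists U V : forall k, {RV (sample_prob (E k)) >-> R},
    [/\ forall k w, mu_hero1 (E k) delta (eps (N k)) w - mu = U k w + V k w,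
        O_p (fun k => U k : sample_space (E k) -> R)
            (fun k => (Num.sqrt (n k)%:R)^-1) &
        O_p (fun k => V k : sample_space (E k) -> R)
            (fun k => (Num.sqrt (N k)%:R)^-1)].
Proof.
move=> adm inf dc.
have mU k : measurable_fun setT (fun w => mu_hero1 (E k) delta (eps (N k)) w - mu).
  move=> _ B _; rewrite setTI.
  exact: (measurable_mu_hero1 (E k) delta (eps (N k)) (fun x => B (x - mu))).
pose U k : {RV (sample_prob (E k)) >-> R} :=
  HB.pack_for {mfun (sample_space (E k)) >-> R}
    (fun w => mu_hero1 (E k) delta (eps (N k)) w - mu)
    (isMeasurableFun.Build _ _ (sample_space (E k)) R _ (mU k)).
exists U, (fun k => cst 0); split.
- by move=> k w /=; rewrite addr0.
- exact: hero1_O_p.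
- move=> e e0; exists 1 => //; apply: nearW => k.
  rewrite (_ : [set w | _] = set0) ?/pr ?measure0 ?ltW//.
  apply/seteqP; split => // w /=; rewrite normr0 mul1r.
  by rewrite ltNge invr_ge0 sqrtr_ge0.
Qed.

End asymptotic_rate.

(** * Non-identifiability of the gold labels *)

Section discrete_space.
Context {R : realType} {m K : nat}.
Local Notation pattern := {ffun 'I_m -> bool}.

(** K independent copies of one labelled instance. The space is finite with the discrete
    sigma-algebra, so all sets and maps are measurable. *)
Definition outcome := {ffun 'I_K -> bool * pattern}.

HB.instance Definition _ := Finite.on outcome.
HB.instance Definition _ := isPointed.Build outcome [ffun=> (true, [ffun=> true])].
HB.instance Definition _ := @isMeasurable.Build default_measure_display
  outcome discrete_measurable discrete_measurable0
  discrete_measurableC discrete_measurableU.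

Variable q : bool * pattern -> R.
Hypotheses (q0 : forall l, 0 <= q l) (q1 : \sum_l q l = 1).

Definition weight (w : outcome) : R := \prod_k q (w k).

Lemma weight_ge0 w : 0 <= weight w.
Proof. by apply: prodr_ge0. Qed.

(** Only indices below the cardinality enter [outcome_measure], so the default of [nth] does not
    occur there. *)
Definition atom (k : nat) : {measure set outcome -> \bar R} :=
  mscale (NngNum (weight_ge0 (nth point (enum outcome) k)))
         (@dirac _ outcome (nth point (enum outcome) k) R).

Definition outcome_measure : set outcome -> \bar R := msum atom #|outcome|.

HB.instance Definition _ := Measure.on outcome_measure.

Lemma outcome_measureE (A : set outcome) :
  outcome_measure A = (\sum_(w : outcome) weight w * (w \in A)%:R)%:E.
Proof.
have -> : \sum_(w : outcome) weight w * (w \in A)%:R =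
    \sum_(w <- enum outcome) weight w * (w \in A)%:R by rewrite big_enum.
rewrite (big_nth point) -cardE big_mkord -sumEFin /outcome_measure /= /msum.
by apply: eq_bigr => k _; rewrite /atom /= /mscale /= diracE -EFinM.
Qed.

Lemma sum_weight_family (Q : 'I_K -> pred (bool * pattern)) :
  \sum_(w : outcome | [forall k, Q k (w k)]) weight w = \prod_k \sum_(l | Q k l) q l.
Proof.
rewrite (bigA_distr_big_dep Q (fun=> q)); apply: eq_bigl => w.
by apply/forallP/familyP.
Qed.

Lemma outcome_measure_setT : outcome_measure setT = 1%E.
Proof.
rewrite outcome_measureE; congr (_%:E).
rewrite (eq_bigr weight); last by move=> w _; rewrite in_setT mulr1.
rewrite (eq_bigl (fun w : outcome => [forall k, predT (w k)])); last first.
  by move=> w; apply/esym/forallP.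
by rewrite (sum_weight_family (fun=> predT)) big1.
Qed.

HB.instance Definition _ := Measure_isProbability.Build _ _ _
  outcome_measure outcome_measure_setT.

Definition outcome_prob : probability outcome R := outcome_measure.

Lemma pr_outcome (Q : pred outcome) :
  pr outcome_prob [set w | Q w] = \sum_(w : outcome | Q w) weight w.
Proof.
rewrite /pr /= outcome_measureE /= [RHS]big_mkcond; apply: eq_bigr => w _.
rewrite (_ : w \in _ = Q w); first by case: (Q w); rewrite ?mulr1 ?mulr0.
by apply/idP/idP => [/set_mem //|Qw]; exact: mem_set.
Qed.

(** The constraints are regrouped into one per coordinate of the space; off the image of [h] the
    constraint is void and its factor is 1. *)
Lemma pr_coordinates (I : finType) (h : I -> 'I_K) (Q : I -> pred (bool * pattern)) :
  injective h ->
  pr outcome_prob [set w | forall i, Q i (w (h i))] = \prod_i \sum_(l | Q i l) q l.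
Proof.
move=> h_inj.
pose Q' k : pred (bool * pattern) := fun l => [forall i, (h i == k) ==> Q i l].
transitivity (pr outcome_prob [set w : outcome | [forall k, Q' k (w k)]]).
  congr pr; apply/seteqP; split => w /= H.
    by apply/forallP => k; apply/forallP => i; apply/implyP => /eqP <-.
  by move=> i; have /forallP/(_ (h i))/forallP/(_ i) := H; rewrite eqxx.
rewrite (pr_outcome (fun w => [forall k, Q' k (w k)])) sum_weight_family.
rewrite (bigID (mem [set h i | i in [set: I]]%SET)) /= [X in _ * X]big1 ?mulr1.
  rewrite big_imset /=; last by move=> i j _ _; exact: h_inj.
  rewrite (eq_bigl predT); last by move=> i; rewrite inE.
  apply: eq_bigr => i _; apply: eq_bigl => l; apply/forallP/idP => [/(_ i)|Ql j].
    by rewrite eqxx.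
  by apply/implyP => /eqP/h_inj ->.
move=> k hk; rewrite -q1; apply: eq_bigl => l; apply/forallP => i.
by apply/implyP => /eqP hik; move: hk; rewrite -hik imset_f ?inE.
Qed.

Lemma pr_coordinate (k : 'I_K) (Q : pred (bool * pattern)) :
  pr outcome_prob [set w | Q (w k)] = \sum_(l | Q l) q l.
Proof.
have := @pr_coordinates unit (fun=> k) (fun=> Q).
rewrite big_const card_unit /= mulr1 => <-; last by move=> [] [].
by congr pr; apply/seteqP; split => w /=; [move=> ? _|apply].
Qed.

Lemma independent_coordinates (I V : finType) (h : I -> 'I_K)
    (phi : bool * pattern -> V) (X : I -> outcome -> V) :
  injective h -> (forall i w, X i w = phi (w (h i))) ->
  mutually_independent outcome_prob X.
Proof.
move=> h_inj XE B.
have -> : [set w | forall i, X i w \in B i] =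
    [set w | forall i, phi (w (h i)) \in B i].
  by apply/seteqP; split => w /= H i; [rewrite -XE|rewrite XE].
rewrite (pr_coordinates (fun i l => phi l \in B i) h_inj).
apply: eq_bigr => i _; rewrite -(pr_coordinate (h i) (fun l => phi l \in B i)).
by congr pr; apply/seteqP; split => w /=; rewrite XE.
Qed.

Lemma measurable_outcome_fun d (T : measurableType d) (g : outcome -> T) :
  measurable_fun setT g.
Proof. by []. Qed.

Definition outcome_rv (g : outcome -> bool) : {RV outcome_prob >-> bool} :=
  HB.pack_for {mfun outcome >-> bool} g
    (isMeasurableFun.Build _ _ outcome bool g (measurable_outcome_fun g)).

End discrete_space.

(** * Two experiments with the same silver labels *)

Section flipped_experiment.
Context {R : realType} {m n N : nat}.
Local Notation pattern := {ffun 'I_m -> bool}.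
Local Notation Omega := (@outcome m (n + N)).

Definition third : R := 3^-1.

(** A prevalence other than 1 / 2 changes when the classes are exchanged; the two reliabilities of a
    labeler sum to 4 / 3, and to 2 / 3 after the exchange, so labelers are informative in both
    models. *)
Definition base : params R m := Params third (fun=> 2 * third) (fun=> 2 * third).

Lemma base_box : in_box third base.
Proof. by split => [|j|j]; rewrite /= /third; lra. Qed.

Lemma third01 : 0 < third <= 2^-1.
Proof. by rewrite /third; lra. Qed.

Definition base_law : bool * pattern -> R :=
  label_law third (fun=> 2 * third) (fun=> 2 * third).

Lemma base_law_ge0 l : 0 <= base_law l.
Proof. exact: label_law_ge0 third01 base_box l. Qed.

Lemma sum_base_law : \sum_l base_law l = 1.
Proof. exact: sum_label_law. Qed.

Definition base_prob : probability Omega R :=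
  outcome_prob base_law_ge0 sum_base_law.

Let rv (g : Omega -> bool) : {RV base_prob >-> bool} :=
  outcome_rv base_law_ge0 sum_base_law g.

(* Both values of [f] give the same silver labels: negating the gold labels
   exchanges the two latent classes. *)
Definition flipped (f : bool) : experiment R m n N := @Experiment R m n N
  default_measure_display Omega base_prob
  (fun i => rv (fun w => f (+) (w (rshift n i)).1))
  (fun i j => rv (fun w => (w (rshift n i)).2 j))
  (fun i j => rv (fun=> true))
  (fun i => rv (fun=> true))
  (fun i => rv (fun w => f (+) (w (lshift N i)).1))
  (fun i j => rv (fun w => (w (lshift N i)).2 j))
  (fun i j => rv (fun=> true)).

Definition class_prob (y : bool) : R := if y then third else 1 - third.

(** Probability of a positive silver label in class [y] of the base law. *)
Definition class_rate (y : bool) : R := if y then 2 * third else 1 - 2 * third.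

Lemma pr_class (k : 'I_(n + N)) (y : bool) (Q : pred pattern) :
  pr base_prob [set w : Omega | Q (w k).2 /\ (w k).1 = y] =
  class_prob y * \sum_(z : pattern) lik1 (fun=> class_rate y) z xpredT * (Q z)%:R.
Proof.
transitivity (pr base_prob [set w : Omega | Q (w k).2 && ((w k).1 == y)]).
  congr pr; apply/seteqP; split => w /=; first by case=> -> ->; rewrite eqxx.
  by case/andP => -> /eqP.
rewrite (pr_coordinate _ _ k (fun l => Q l.2 && (l.1 == y))).
rewrite big_mkcond /=.
transitivity (\sum_l base_law l * (Q l.2 && (l.1 == y))%:R).
  by apply: eq_bigr => l _; case: ifP; rewrite ?mulr1 ?mulr0.
rewrite sum_label_lawE /class_prob /class_rate.
have z0 (p : 'I_m -> R) (b : bool) : b = false ->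
    \sum_(z : pattern) lik1 p z xpredT * (Q z && b)%:R = 0.
  by move=> ->; apply: big1 => z _; rewrite andbF mulr0.
case: y => /=; rewrite [X in _ + X]/=.
  rewrite [X in _ + _ * X]z0// mulr0 addr0; congr (_ * _).
  by apply: eq_bigr => z _; rewrite andbT.
rewrite [X in _ * X + _]z0// mulr0 add0r; congr (_ * _).
by apply: eq_bigr => z _; rewrite andbT.
Qed.

Lemma class_prob_gt0 y : 0 < class_prob y.
Proof. by rewrite /class_prob /third; case: y; lra. Qed.

Lemma pr_gold_class (k : 'I_(n + N)) (f y : bool) :
  pr base_prob [set w : Omega | f (+) (w k).1 = y] = class_prob (f (+) y).
Proof.
have := pr_class k (f (+) y) predT.
rewrite -big_distrl /= sum_lik1 !mulr1 => <-; congr pr.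
apply/seteqP; split => w /=; first by move=> <-; rewrite addKb.
by case=> _ ->; rewrite addKb.
Qed.

Lemma cond_pr_class (k : 'I_(n + N)) (f y : bool) (Q : pred pattern) :
  cond_pr base_prob [set w : Omega | Q (w k).2] [set w : Omega | f (+) (w k).1 = y] =
  \sum_(z : pattern) lik1 (fun=> class_rate (f (+) y)) z xpredT * (Q z)%:R.
Proof.
have -> : cond_pr base_prob [set w : Omega | Q (w k).2] [set w : Omega | f (+) (w k).1 = y] =
    pr base_prob [set w : Omega | Q (w k).2 /\ (w k).1 = f (+) y] /
    pr base_prob [set w : Omega | f (+) (w k).1 = y].
  rewrite /cond_pr; congr (pr _ _ / _).
  apply/seteqP; split => w /= [-> ]; first by move=> <-; rewrite addKb.
  by move=> ->; rewrite addKb.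
by rewrite pr_gold_class pr_class mulrC mulKf// gt_eqF// class_prob_gt0.
Qed.

Lemma cond_pr_silver (k : 'I_(n + N)) (f y b : bool) (j : 'I_m) :
  cond_pr base_prob [set w : Omega | (w k).2 j = b] [set w : Omega | f (+) (w k).1 = y] =
  bern (class_rate (f (+) y)) b.
Proof.
transitivity (cond_pr base_prob [set w : Omega | ((w k).2 j == b)] [set w : Omega | f (+) (w k).1 = y]).
  by congr cond_pr; apply/seteqP; split => w /= /eqP.
rewrite (cond_pr_class k f y (fun z => z j == b)).
rewrite (sum_lik1_coord _ j (fun b' => (b' == b)%:R)) bernE.
by case: b => /=; rewrite ?mulr1 ?mulr0 ?addr0 ?add0r.
Qed.

Lemma cond_pr_pattern (k : 'I_(n + N)) (f y : bool) (z : 'I_m -> bool) :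
  cond_pr base_prob [set w : Omega | forall j, (w k).2 j = z j] [set w : Omega | f (+) (w k).1 = y] =
  \prod_(j < m) cond_pr base_prob [set w : Omega | (w k).2 j = z j]
     [set w : Omega | f (+) (w k).1 = y].
Proof.
under eq_bigr do rewrite cond_pr_silver.
transitivity (cond_pr base_prob [set w : Omega | ((w k).2 == [ffun j => z j])]
  [set w : Omega | f (+) (w k).1 = y]).
  congr cond_pr; apply/seteqP; split => w /= h.
    by apply/eqP/ffunP => j; rewrite ffunE.
  by move=> j; rewrite (eqP h) ffunE.
rewrite (cond_pr_class k f y (fun x => x == [ffun j => z j])).
rewrite (bigD1 [ffun j => z j])//= eqxx mulr1 big1 ?addr0.
  by rewrite lik1E; apply: eq_bigr => j _; rewrite ffunE.
by move=> x /negbTE ->; rewrite mulr0.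
Qed.

Lemma mean_gold_class (k : 'I_(n + N)) (f : bool) :
  ('E_(base_prob)[fun w : Omega => (f (+) (w k).1)%:R%R])%E = (class_prob (f (+) true))%:E.
Proof.
pose A : set Omega := [set w : Omega | f (+) (w k).1 = true].
have mA : measurable A by [].
rewrite -(pr_gold_class k f true) /pr fineK ?fin_num_measure//.
rewrite -(expectation_indic base_prob mA); congr ('E_(_)[_])%E.
apply/funext => w; rewrite indicE.
rewrite (_ : w \in A = f (+) (w k).1)//.
by apply/idP/idP => [/set_mem //|Gw]; exact: mem_set.
Qed.

Lemma independent2_cst (V W : finType) (X : Omega -> V)
    (Y : Omega -> W) (c : W) :
  (forall w, Y w = c) -> independent2 base_prob X Y.
Proof.
move=> Yc B C; have [cC|cC] := boolP (c \in C).
  rewrite [X in _ = _ * X](_ : _ = 1) ?mulr1.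
    by congr pr; apply/seteqP; split => w /=; [case|rewrite Yc].
  by rewrite -(pr_setT base_prob); congr pr; apply/seteqP; split => w //= _; rewrite Yc.
rewrite [X in _ = _ * X](_ : _ = 0) ?mulr0.
  rewrite (_ : [set w | _] = set0) /pr ?measure0//.
  by apply/seteqP; split => w //= [_]; rewrite Yc (negbTE cC).
rewrite (_ : [set w | _] = set0) /pr ?measure0//.
by apply/seteqP; split => w //=; rewrite Yc (negbTE cC).
Qed.

(** Historical and current gold labels are flipped together, which keeps the reliabilities
    transportable. Everything is available and routed, so randomization is independence from a
    constant; 4^-1 is below the values 1 / 3 and 2 / 3 that occur. *)
Lemma flipped_admissible (f : bool) :
  [/\ independent_instances (flipped f),
      randomized_labeling (flipped f) 1 1 1 &
      correct_specification (flipped f) (4^-1) (class_prob (~~ f)) (class_prob (~~ f))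
        (fun=> class_rate (~~ f)) (fun=> 1 - class_rate f)].
Proof.
have addbTr : f (+) true = ~~ f by rewrite addbT.
have addbFr : f (+) false = f by rewrite addbF.
have pr1 : pr base_prob [set w : Omega | true = true] = 1.
  by rewrite -(pr_setT base_prob); congr pr; apply/seteqP; split.
split.
- split.
    apply: (independent_coordinates _ _ (h := @rshift n N)
      (phi := fun l => (f (+) l.1, [ffun j => l.2 j], [ffun=> true], true))).
      exact: rshift_inj.
    by [].
  apply: (independent_coordinates _ _ (h := @lshift n N)
      (phi := fun l => (f (+) l.1, [ffun j => l.2 j], [ffun=> true]))).
    exact: lshift_inj.
  by [].
- split; rewrite /=; try by move=> *; rewrite pr1.
  + by move=> i; apply: (independent2_cst _ (c := [ffun=> true])).
  + by move=> i; apply: (independent2_cst _ (c := [ffun=> true])).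
  + by move=> i; apply: (independent2_cst _ (c := true)).
  + by [].
- split; rewrite /=.
  + by move=> j; rewrite /class_rate /third; case: (f) => /=; lra.
  + by move=> j; rewrite /class_rate /third; case: (f) => /=; lra.
  + by rewrite /class_prob /third; case: (f) => /=; lra.
  + by rewrite /class_prob /third; case: (f) => /=; lra.
  + by move=> i; rewrite mean_gold_class addbTr.
  + by move=> i; rewrite mean_gold_class addbTr.
  + by move=> i j; rewrite cond_pr_silver addbTr bernE.
  + by move=> i j; rewrite cond_pr_silver addbTr bernE.
  + by move=> i j; rewrite cond_pr_silver addbFr bernE.
  + by move=> i j; rewrite cond_pr_silver addbFr bernE.
  + by move=> i z y; exact: cond_pr_pattern.
  + by move=> i z y; exact: cond_pr_pattern.
Qed.

End flipped_experiment.

(** * Inconsistency of estimators based on silver labels alone *)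

Section inconsistency.
Context {R : realType} {m : nat} {n N : nat -> nat}.
Hypothesis m_gt0 : (0 < m)%N.

(** Otherwise the balls of radius |a - b| / 3 about a and b are disjoint, yet for some k each
    contains [Y k] with probability above 1 / 2. *)
Lemma base_prob_limit_unique (Y : forall k, @outcome m (n k + N k) -> R) (a b : R) :
  (forall e, 0 < e ->
     pr (@base_prob R m (n k) (N k)) [set w | e < `|Y k w - a|] @[k --> \oo] --> (0 : R)) ->
  (forall e, 0 < e ->
     pr (@base_prob R m (n k) (N k)) [set w | e < `|Y k w - b|] @[k --> \oo] --> (0 : R)) ->
  a = b.
Proof.
move=> Ya Yb; apply/eqP/negPn/negP => ab.
have e0 : 0 < `|a - b| / 3 by rewrite divr_gt0// normr_gt0 subr_eq0.
have /cvgrPdist_lt/(_ 2^-1 ltac:(by rewrite invr_gt0)) ha := Ya _ e0.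
have /cvgrPdist_lt/(_ 2^-1 ltac:(by rewrite invr_gt0)) hb := Yb _ e0.
have [k [/= Pa Pb]] := filter_ex (filterI ha hb).
move: Pa Pb; rewrite !sub0r !normrN !(ger0_norm (pr_ge0 _ _)).
set A := [set w | _]; set B := [set w | _] => Pa Pb.
have : pr (@base_prob R m (n k) (N k)) setT <= pr (@base_prob R m (n k) (N k)) A
    + pr (@base_prob R m (n k) (N k)) B.
  apply: pr_sub_setU => // w _ /=.
  have [?|ha'] := ltP (`|a - b| / 3) `|Y k w - a|; first by left.
  right; rewrite /B /= ltNge; apply/negP => hb'.
  have := ler_distD (Y k w) a b; rewrite (distrC a (Y k w)); lra.
rewrite pr_setT; lra.
Qed.

(** Both values of [f] give the same estimate on the same probability space, with targets 1 / 3 and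
    2 / 3, so convergence fails for one of them; which one depends on [est], hence the argument by
    contradiction. *)
Lemma silver_only_inconsistent
    (est : forall k, ('I_(n k) -> 'I_m -> bool) -> ('I_(n k) -> 'I_m -> bool) -> R) :
  exists (E : forall k, experiment R m (n k) (N k))
    (c pi_min rho_min rho mu mut : R) (alpha beta : 'I_m -> R),
    admissible_model E c pi_min rho_min rho mu mut alpha beta /\
    informative_labeler alpha beta /\
    ~ cvg_in_probability
        (fun k (w : sample_space (E k)) =>
           est k (fun i j => silver (E k) i j w) (fun i j => avail (E k) i j w)) mu.
Proof.
pose E f k : experiment R m (n k) (N k) := flipped f.
pose X f k (w : sample_space (E f k)) :=
  est k (fun i j => silver (E f k) i j w) (fun i j => avail (E f k) i j w).
have [f nX] : exists f, ~ cvg_in_probability (X f) (class_prob (~~ f)).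
  apply: contrapT => /forallNP both.
  have /contrapT c0 := both false; have /contrapT c1 := both true.
  have := base_prob_limit_unique c0 c1.
  by rewrite /class_prob /third /=; lra.
exists (E f), 4^-1, 1, 1, 1, (class_prob (~~ f)), (class_prob (~~ f)),
  (fun=> class_rate (~~ f)), (fun=> 1 - class_rate f); split.
  split; rewrite ?ltr01 ?invr_gt0// => k; exact: flipped_admissible.
split => //; exists (Ordinal m_gt0).
by rewrite /class_rate /third; case: (f) => /=; apply/eqP; lra.
Qed.

End inconsistency.

Theorem theorem1 (R : realType) (m : nat) (n N : nat -> nat)
    (m_gt0 : (0 < m)%N)
    (n_to_oo : n @ \oo --> \oo)
    (n_ll_N : (fun k => (n k)%:R : R) =o_\oo (fun k => (N k)%:R : R)) :
  (forall (E : forall k, experiment R m (n k) (N k))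
      (c pi_min rho_min rho mu mut : R) (alpha beta : 'I_m -> R)
      (delta : R) (eps : nat -> R),
    admissible_model E c pi_min rho_min rho mu mut alpha beta ->
    informative_labeler alpha beta ->
    0 < delta <= c ->
    (forall K, 0 < eps K) ->
    eps =o_\oo (fun K => K%:R^-1 : R) ->
    exists U V : forall k, {RV (sample_prob (E k)) >-> R},
      [/\ forall k w, mu_hero1 (E k) delta (eps (N k)) w - mu = U k w + V k w,
          O_p (fun k => U k : sample_space (E k) -> R)
              (fun k => (Num.sqrt (n k)%:R)^-1) &
          O_p (fun k => V k : sample_space (E k) -> R)
              (fun k => (Num.sqrt (N k)%:R)^-1)]) /\
  (forall tie : R, 0 <= tie <= 1 ->
    exists (E : forall k, experiment R m (n k) (N k))
      (c pi_min rho_min rho mu mut : R) (alpha beta : 'I_m -> R),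
      admissible_model E c pi_min rho_min rho mu mut alpha beta /\
      informative_labeler alpha beta /\
      ~ cvg_in_probability
          (fun k (w : sample_space (E k)) => mu_majority_vote (E k) tie w) mu) /\
  (forall (init : forall k, ('I_(n k) -> 'I_m -> bool) ->
                            ('I_(n k) -> 'I_m -> bool) -> params R m)
      (delta : R) (eps : nat -> R),
    0 <= delta < 2^-1 ->
    (forall K, 0 < eps K) ->
    exists (E : forall k, experiment R m (n k) (N k))
      (c pi_min rho_min rho mu mut : R) (alpha beta : 'I_m -> R),
      admissible_model E c pi_min rho_min rho mu mut alpha beta /\
      informative_labeler alpha beta /\
      ~ cvg_in_probability
          (fun k (w : sample_space (E k)) =>
             mu_dawid_skene (E k) (init k) delta (eps (n k)) w) mu).
Proof.
split; last split.
- move=> E c pi_min rho_min rho mu mut alpha beta delta eps adm inf dc _ _.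
  exact: hero1_decomposition adm inf dc.
- move=> tie _.
  exact: (silver_only_inconsistent m_gt0 (fun k => majority_vote tie)).
- move=> init delta eps _ _.
  exact: (silver_only_inconsistent m_gt0 (fun k => dawid_skene (init k) delta (eps (n k)))).
Qed.
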